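(* Let $p(\cdot)\in\mathcal{P}(\mathbb{R}^n)$ satisfy $1\le p_-\le p_+<\infty$ and $p(\cdot)\in LH(\mathbb{R}^n)$. (1) If $W$ is a $d\times d$ matrix weight on $\mathbb{R}^n$ with $W\in\mathcal{A}_{p(\cdot)}(\mathbb{R}^n)$, then $C_c^\infty(\mathbb{R}^n;\mathbb{R}^d)$ is dense in $\mathscr{W}^{1,p(\cdot)}(W,\mathbb{R}^n)$. (2) If $W$ is an $n\times n$ matrix weight on $\mathbb{R}^n$ with $W\in\mathcal{A}_{p(\cdot)}(\mathbb{R}^n)$ and $v=|W|_{\mathrm{op}}$, then $C_c^\infty(\mathbb{R}^n)$ is dense in $\mathscr{W}^{1,p(\cdot)}(v,W,\mathbb{R}^n)$.
   Context: Exponents: $\mathcal{P}(\mathbb{R}^n)$ is the set of Lebesgue measurable $p(\cdot):\mathbb{R}^n\to[1,\infty]$; $p_-=\operatorname{ess\,inf} p$, $p_+=\operatorname{ess\,sup} p$; $1/p(x)+1/p'(x)=1$ with $1/\infty=0$. Modular: $\rho_{p(\cdot)}(f)=\int_{\{p<\infty\}}|f(x)|^{p(x)}dx+\|f\|_{L^\infty(\{p=\infty\})}$. Norm: $\|f\|_{L^{p(\cdot)}(\mathbb{R}^n)}=\inf\{\lambda>0:\rho_{p(\cdot)}(f/\lambda)\le1\}$. Log-Hölder continuity: $p(\cdot)\in LH(\mathbb{R}^n)$ if there are real constants $C_0,C_\infty,p_\infty$ with $|p(x)-p(y)|\le \frac{C_0}{-\log|x-y|}$ for all $x,y$ with $|x-y|<1/2$,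 and $|p(x)-p_\infty|\le\frac{C_\infty}{\log(e+|x|)}$ for all $x$. Weights: $\mathcal{S}_m$ is the set of self-adjoint positive semidefinite $m\times m$ matrices; $|\cdot|_{\mathrm{op}}$ is the operator norm. An $m\times m$ matrix weight is a measurable $W:\mathbb{R}^n\to\mathcal{S}_m$ with $|W|_{\mathrm{op}}\in L^1_{\mathrm{loc}}(\mathbb{R}^n)$. $\|\mathbf{f}\|_{L^{p(\cdot)}(W,\mathbb{R}^n)}:=\||W\mathbf{f}|\|_{L^{p(\cdot)}(\mathbb{R}^n)}$ for measurable $\mathbf{f}:\mathbb{R}^n\to\mathbb{R}^m$, and $\|f\|_{L^{p(\cdot)}(v,\mathbb{R}^n)}:=\|fv\|_{L^{p(\cdot)}(\mathbb{R}^n)}$ for scalar $f$. $\mathcal{A}_{p(\cdot)}(\mathbb{R}^n)$: matrix weights $W$, positive definite a.e., with $$[W]_{\mathcal{A}_{p(\cdot)}}=\sup_{Q}|Q|^{-1}\Big\|\,\big\||W(x)W^{-1}(\cdot)|_{\mathrm{op}}\chi_Q(\cdot)\big\|_{L^{p'(\cdot)}(\mathbb{R}^n)}\chi_Q(x)\Big\|_{L^{p(\cdot)}_x(\mathbb{R}^n)}<\infty,$$ the supremum over all cubes $Q\subset\mathbb{R}^n$; $L^{p(\cdot)}_x$ is the norm in the variable $x$. Sobolev spaces: $\mathscr{W}^{1,1}_{\mathrm{loc}}$ denotes locally integrable functions (scalar, or $\mathbb{R}^d$-valued componentwise) whose weak first derivatives all exist as locally integrable functions; $D\mathbf{f}=(\partial_jf_i)_{i,j}$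 is the $d\times n$ Jacobian. $\mathscr{W}^{1,p(\cdot)}(W,\mathbb{R}^n)$ is the set of $\mathbf{f}\in\mathscr{W}^{1,1}_{\mathrm{loc}}(\mathbb{R}^n;\mathbb{R}^d)$ with $\|\mathbf{f}\|_{L^{p(\cdot)}(W,\mathbb{R}^n)}+\||WD\mathbf{f}|_{\mathrm{op}}\|_{L^{p(\cdot)}(\mathbb{R}^n)}<\infty$, normed by this quantity. $\mathscr{W}^{1,p(\cdot)}(v,W,\mathbb{R}^n)$ is the set of $f\in\mathscr{W}^{1,1}_{\mathrm{loc}}(\mathbb{R}^n)$ with $\|f\|_{L^{p(\cdot)}(v,\mathbb{R}^n)}+\|\nabla f\|_{L^{p(\cdot)}(W,\mathbb{R}^n)}<\infty$, normed by this quantity. *)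

(* Defs.v *)
From HB Require Import structures.
From mathcomp Require Import all_boot all_order all_algebra.
From mathcomp Require Import all_classical all_reals all_analysis.
From mathcomp Require Import measurable_realfun ess_sup_inf.

Set Implicit Arguments.
Unset Strict Implicit.
Unset Printing Implicit Defensive.

Import Order.TTheory GRing.Theory Num.Theory.
Import numFieldNormedType.Exports.

Local Open Scope classical_set_scope.
Local Open Scope ring_scope.

Section lebesgue_Rn.
Context {R : realType} {n : nat}.
Implicit Types (a b : 'rV[R]_n) (X : set 'rV[R]_n).

Definition box a b : set 'rV[R]_n :=
  [set x | forall i, a 0 i < x 0 i <= b 0 i].

Definition box_vol a b : \bar R := (\prod_i Num.max (b 0 i - a 0 i) 0)%:E.

(* [None] stands for the empty set: covers by finitely many boxes are allowed,
   which only matters when [n = 0]. *)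
Definition obox (o : option ('rV[R]_n * 'rV[R]_n)) : set 'rV[R]_n :=
  if o is Some ab then box ab.1 ab.2 else set0.

Definition obox_vol (o : option ('rV[R]_n * 'rV[R]_n)) : \bar R :=
  if o is Some ab then box_vol ab.1 ab.2 else 0%E.

Definition box_cover X : set (nat -> option ('rV[R]_n * 'rV[R]_n)) :=
  [set B | X `<=` \bigcup_k obox (B k)].

Local Open Scope ereal_scope.

Definition lebesgue_outer X : \bar R :=
  ereal_inf [set \sum_(k <oo) obox_vol (B k) | B in box_cover X].

Lemma obox_vol_ge0 o : 0 <= obox_vol o.
Proof.
case: o => [[a b]|] //=; rewrite lee_fin; apply: prodr_ge0 => i _.
by rewrite le_max lexx orbT.
Qed.

Lemma lebesgue_outer_ge0 X : 0 <= lebesgue_outer X.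
Proof.
apply: le_ereal_inf_tmp => _ [B _ <-].
by apply: nneseries_ge0 => k _ _; exact: obox_vol_ge0.
Qed.

Lemma lebesgue_outer0 : lebesgue_outer set0 = 0.
Proof.
apply/eqP; rewrite eq_le lebesgue_outer_ge0 andbT.
apply: ereal_inf_lbound; exists (fun=> None) => //.
by rewrite eseries0.
Qed.

Lemma le_lebesgue_outer :
  {homo lebesgue_outer : A B / A `<=` B >-> A <= B}.
Proof.
move=> A B AB; apply/ereal_inf_le_tmp => _ [C BC <-].
by exists C => //; exact: subset_trans BC.
Qed.

Lemma lebesgue_outer_sigma_subadditive : sigma_subadditive lebesgue_outer.
Proof.
move=> A; have [[i ioo]|] := pselect (exists i, lebesgue_outer (A i) = +oo).
  rewrite (eseries_pinfty _ _ ioo) ?leey// => k _.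
  by rewrite -ltNye (lt_le_trans _ (lebesgue_outer_ge0 _)).
rewrite -forallNE => Aoo.
apply/lee_addgt0Pr => _/posnumP[e].
rewrite (le_trans _ (epsilon_trick _ _ _))//; last first.
  by move=> k; exact: lebesgue_outer_ge0.
pose P k (B : nat -> option ('rV[R]_n * 'rV[R]_n)) := box_cover (A k) B /\
  \sum_(j <oo) obox_vol (B j)
    <= lebesgue_outer (A k) + (e%:num / (2 ^ k.+1)%:R)%:E.
have [G PG] : {G & forall k, P k (G k)}.
  apply: (@choice _ _ P) => k.
  have fA : lebesgue_outer (A k) \is a fin_num.
    by rewrite ge0_fin_numE ?lebesgue_outer_ge0// ltey; exact/eqP/Aoo.
  have en1 : (0 < e%:num / (2 ^ k.+1)%:R)%R by [].
  have [_ [B AB <-] xS] := lb_ereal_inf_adherent en1 fA.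
  by exists B; split => //; exact/ltW.
pose v := obox_vol \o uncurry G.
have v0 x : 0 <= v x by exact: obox_vol_ge0.
apply: (@le_trans _ _ (\esum_(i in setT) v i)).
  apply: ereal_inf_lbound => /=.
  have /card_esym/ppcard_eqP[f] := card_nat2.
  exists (uncurry G \o f).
    move=> t [i _ Ait]; have [j _ Gij] := (PG i).1 _ Ait.
    by exists (f^-1%FUN (i, j)) => //=; rewrite invK ?inE.
  rewrite -(esum_pred_image v _ xpredT) ?[fun=> _]set_true//.
  by rewrite image_eq.
rewrite (_ : esum _ _ = \sum_(i <oo) \sum_(j <oo) obox_vol (G i j)); last first.
  pose J : nat -> set (nat * nat) := fun i => [set (i, j) | j in setT].
  rewrite (_ : setT = \bigcup_k J k); last first.
    by rewrite predeqE => -[a b]; split => // _; exists a => //; exists b.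
  rewrite esum_bigcupT /=; last 2 first.
    - apply/trivIsetP => i j _ _ ij.
      rewrite predeqE => -[l m] /=; split => //= -[] [_] _ [<-{l} _].
      by move=> [m' _] [] /esym/eqP; rewrite (negbTE ij).
    - by move=> x; exact: v0.
  rewrite -(image_id [set: nat]) -fun_true esum_pred_image//; last first.
    by move=> k _; exact: esum_ge0.
  apply: eq_eseriesr => /= j _.
  rewrite -(esum_pred_image v (pair j) predT)//=; last first.
    by move=> ? ? _ _; exact: (@can_inj _ _ _ snd).
  by congr esum; rewrite predeqE => -[a b]; split; move=> [i _ <-]; exists i.
apply: lee_nneseries => [i _ _|i _]; last exact: (PG i).2.
by apply: nneseries_ge0 => m _ _; exact: obox_vol_ge0.
Qed.

HB.instance Definition _ := isOuterMeasure.Build R 'rV[R]_n lebesgue_outer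
  lebesgue_outer0 lebesgue_outer_ge0 le_lebesgue_outer
  lebesgue_outer_sigma_subadditive.

End lebesgue_Rn.

(* ['rV[R]_n] equipped with the sigma-algebra of Lebesgue measurable sets, i.e.
   the Caratheodory measurable sets of [lebesgue_outer]. *)
Notation Rn R n := (caratheodory_type (@lebesgue_outer R n)).

Section lebesgue_measure_Rn.
Context (R : realType) (n : nat).

Definition lebesgueRn : set (Rn R n) -> \bar R := @lebesgue_outer R n.

HB.instance Definition _ := isMeasure.Build _ (Rn R n) R lebesgueRn
  (@caratheodory_measure0 _ _ (@lebesgue_outer R n))
  (@caratheodory_measure_ge0 _ _ (@lebesgue_outer R n))
  (@caratheodory_measure_sigma_additive _ _ (@lebesgue_outer R n)).

End lebesgue_measure_Rn.

Arguments lebesgueRn : clear implicits.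
Notation leb := (lebesgueRn _ _).

Section matrices.
Context {R : realType}.

(* Euclidean norm of a row or column vector; the norm [`|x|] of the library
   is the sup norm. *)
Definition enorm {m k} (x : 'M[R]_(m, k)) : R :=
  Num.sqrt (\sum_i \sum_j x i j ^+ 2).

Definition opnorm {m k} (A : 'M[R]_(m, k)) : R :=
  sup [set enorm (A *m v) | v in [set v : 'cV[R]_k | enorm v <= 1]].

Definition psdmx {m} (A : 'M[R]_m) :=
  A^T = A /\ forall v : 'cV[R]_m, 0 <= (v^T *m A *m v) 0 0.

Definition pdmx {m} (A : 'M[R]_m) :=
  A^T = A /\ forall v : 'cV[R]_m, v != 0 -> 0 < (v^T *m A *m v) 0 0.

End matrices.

Section variable_lebesgue.
Context {R : realType} {n : nat}.
Local Open Scope ereal_scope.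
Implicit Types (p f : 'rV[R]_n -> \bar R).

Definition exponent p :=
  measurable_fun [set: Rn R n] p /\ forall x, 1 <= p x.

Definition modular p f : \bar R :=
  \int[leb]_(x in [set x : Rn R n | p x < +oo]) (`|f x| `^ fine (p x))
  + ess_sup leb ((fun x : Rn R n => `|f x|) \_ [set x | p x = +oo]).

Definition lpnorm p f : \bar R :=
  ereal_inf [set l%:E | l in
    [set l : R | (0 < l)%R /\ modular p (fun x => (l^-1)%:E * f x) <= 1]].

(* For [x = y] the first bound reads [0 <= 0] on paper (log 0 = -oo). *)
Definition log_hoelder p := exists C0 Coo poo : R,
  (forall x y, (0 < enorm (x - y) < 1 / 2)%R ->
     `|p x - p y| <= (C0 / - ln (enorm (x - y)))%:E) /\
  (forall x, `|p x - poo%:E| <= (Coo / ln (expR 1 + enorm x))%:E).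

End variable_lebesgue.

Section weights.
Context {R : realType} {n : nat}.

Definition loc_integrable (f : 'rV[R]_n -> R) :=
  measurable_fun [set: Rn R n] f /\
  forall K : set 'rV[R]_n, compact K ->
    (\int[leb]_(x in (K : set (Rn R n))) `|f x|%:E < +oo)%E.

Definition matrix_weight {m} (W : 'rV[R]_n -> 'M[R]_m) :=
  [/\ forall x, psdmx (W x),
      forall i j, measurable_fun [set: Rn R n] (fun x => W x i j)
    & loc_integrable (fun x => opnorm (W x))].

Definition cube (a : 'rV[R]_n) (l : R) : set (Rn R n) :=
  [set x : 'rV[R]_n | forall i, a 0 i <= x 0 i <= a 0 i + l].

Definition Ap_const {m} (p : 'rV[R]_n -> \bar R) (W : 'rV[R]_n -> 'M[R]_m) :=
  ereal_sup [set ((leb Q)^-1 *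
    lpnorm p (fun x =>
      lpnorm (fun y => hoelder_conjugate (p y))
        (fun y => (opnorm (W x *m invmx (W y)) * \1_Q y)%:E)
      * (\1_Q x)%:E))%E
    | Q in [set cube a l | a in setT & l in [set l | 0 < l]]].

Definition Ap {m} (p : 'rV[R]_n -> \bar R) (W : 'rV[R]_n -> 'M[R]_m) :=
  [/\ matrix_weight W, \forall x \ae leb, pdmx (W x)
    & (Ap_const p W < +oo)%E].

End weights.

Section sobolev.
Context {R : realType} {n : nat}.
Implicit Types (f g phi : 'rV[R]_n -> R) (p : 'rV[R]_n -> \bar R).

Definition partial (j : 'I_n) f : 'rV[R]_n -> R :=
  fun x => 'D_(delta_mx 0 j) f x.

Definition smooth f := forall s : seq 'I_n,
  let g := foldr partial f s in
  continuous g /\ forall j x, derivable g x (delta_mx 0 j).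

Definition Ccoo f := smooth f /\ compact (closure [set x | f x != 0]).

Definition Ccoo_vec {d} (f : 'rV[R]_n -> 'cV[R]_d) :=
  forall i, Ccoo (fun x => f x i 0).

Definition is_weak_partial (j : 'I_n) f g := loc_integrable g /\
  forall phi, Ccoo phi ->
    \int[leb]_x (f x * partial j phi x)
    = - \int[leb]_x (g x * phi x).

Definition W11loc f :=
  loc_integrable f /\ forall j, exists g, is_weak_partial j f g.

(* A representative of the weak derivative, which is unique up to null sets;
   meaningful only if a weak derivative exists. *)
Definition weak_partial (j : 'I_n) f : 'rV[R]_n -> R :=
  xget (fun=> 0) [set g | is_weak_partial j f g].

Definition weak_grad f (x : 'rV[R]_n) : 'cV[R]_n :=
  \col_j weak_partial j f x.

Definition weak_jacobian {d} (f : 'rV[R]_n -> 'cV[R]_d) (x : 'rV[R]_n) :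
    'M[R]_(d, n) :=
  \matrix_(i, j) weak_partial j (fun y => f y i 0) x.

Definition sobolev_norm_vec {d} p (W : 'rV[R]_n -> 'M[R]_d)
    (f : 'rV[R]_n -> 'cV[R]_d) : \bar R :=
  (lpnorm p (fun x => (enorm (W x *m f x))%:E)
   + lpnorm p (fun x => (opnorm (W x *m weak_jacobian f x))%:E))%E.

Definition sobolev_vec {d} p (W : 'rV[R]_n -> 'M[R]_d) :
    set ('rV[R]_n -> 'cV[R]_d) :=
  [set f : 'rV[R]_n -> 'cV[R]_d | (forall i, W11loc (fun x => f x i 0))
         /\ (sobolev_norm_vec p W f < +oo)%E].

Definition sobolev_norm p (v : 'rV[R]_n -> R) (W : 'rV[R]_n -> 'M[R]_n) f :
    \bar R :=
  (lpnorm p (fun x => (f x * v x)%:E)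
   + lpnorm p (fun x => (enorm (W x *m weak_grad f x))%:E))%E.

Definition sobolev p (v : 'rV[R]_n -> R) (W : 'rV[R]_n -> 'M[R]_n) :
    set ('rV[R]_n -> R) :=
  [set f | W11loc f /\ (sobolev_norm p v W f < +oo)%E].

(* [A] is a dense subset of [S] for the distance [N (u - w)]. *)
Definition dense_subset {V : zmodType} (N : ('rV[R]_n -> V) -> \bar R)
    (S A : set ('rV[R]_n -> V)) :=
  A `<=` S /\
  forall u, S u -> forall e : R, 0 < e ->
    exists2 w, A w & (N (fun x => u x - w x)%R < e%:E)%E.

End sobolev.

(* Main.v *)
Require Import Defs.
From HB Require Import structures.
From mathcomp Require Import all_boot all_order all_algebra.
From mathcomp Require Import all_classical all_reals all_analysis.
From mathcomp Require Import measurable_realfun ess_sup_inf.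
From mathcomp Require Import ring lra.

Set Implicit Arguments.
Unset Strict Implicit.
Unset Printing Implicit Defensive.

Import Order.TTheory GRing.Theory Num.Theory.
Import numFieldNormedType.Exports.

Local Open Scope classical_set_scope.
Local Open Scope ring_scope.

(* Only the local, small scale content of the A_p condition is needed, and no
   maximal function. On a cube Q, the condition, Hoelder's inequality in the inner
   variable and the scaling of the norm show that if g(x) is at most the average
   over Q of |W(x) W(y)^-1| h(y), then the modular of g 1_Q / c is at most 1 as
   soon as that of h 1_Q is. With h = |W F| this controls the mollification
   of F at scale e on a grid cell of side e by F on the doubled cell. Such an
   inequality between unit balls of the norm becomes an inequality between modulars
   after rescaling by a power of rho, the larger of the modular of h on the cell
   and of e^(n+1): the exponent oscillates by O(1 / log (1/e)) on the cell,
   so the error is the bounded factor (e^(n+1))^(-O(1 / log (1/e))). Summing over the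
   cells gives
     modular (W F_e) <= C (modular (W F) + e)
   on bounded sets, with C independent of e. Truncating F, whose bounded part is
   handled by L^1 convergence and the local integrability of |W|^p, yields
   convergence of the mollifications of functions with bounded support; cutoff
   functions and the product rule for weak derivatives reduce to that case.
   A function f and its derivative are matrix valued functions F_0 and F_1,
   treated uniformly with the Frobenius norm. *)

(** * Lebesgue measure on R^n *)

Section box_volume.
Context {R : realType}.
Local Open Scope ereal_scope.

(** Lebesgue measure is here the Caratheodory measure of an outer measure by half-open boxes, and no
    Fubini theorem on R^n is invoked: the uniform L^1 bound for mollifications comes from the same
    grid as the weighted one, integrals of partial derivatives vanish by translation invariance, and
    mollifications are differentiated through a quadratic Taylor remainder. Kernels live in
    [-e, 0]^n instead of a centred ball. This confines the kernel at a point of a cell to the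
    doubled cell, and mollified indicators of half-open boxes become exact at every point, boundary
    included, once e is small. The floor e^(n+1) in rho is dictated by the grid: a ball meets
    O(e^-n) cells, so the floors add up to O(e), while the logarithm of the floor is still
    comparable to log e. Where p = 1 the conjugate exponent is infinite and the inner norm of the
    A_p condition combines an integral with an essential supremum. Young's inequality, applied
    pointwise, treats both at the cost of a factor 2. For measurability the kernel |W(x) W(y)^-1| is
    replaced by a smaller one, up to a constant, made of the Frobenius norm and Cramer's formula. *)

Lemma box_vol_cover (n : nat) (a b : nat -> R) (P : nat -> bool)
    (A B : nat -> nat -> R) :
  (forall x : nat -> R, (forall i, (i < n)%N -> (a i < x i <= b i)%R) ->
    exists2 k, P k & forall i, (i < n)%N -> (A k i < x i <= B k i)%R) ->
  (\prod_(i < n) Num.max (b i - a i) 0)%:E <=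
  \sum_(k <oo) if P k then (\prod_(i < n) Num.max (B k i - A k i) 0)%:E else 0.
Proof.
have vol0 m (u v : nat -> R) : (0 <= \prod_(i < m) Num.max (v i - u i) 0)%R.
  by apply: prodr_ge0 => i _; rewrite le_max lexx orbT.
elim: n a b P A B => [|n IH] a b P A B cov.
  (* In dimension 0 every volume is the empty product 1, so a single selected box suffices. *)
  have [//|k Pk _] := cov (fun=> 0%R).
  rewrite big_ord0 (@nneseriesD1 _ _ k)//; last first.
    by move=> j _; case: ifP => // _; rewrite lee_fin.
  rewrite Pk big_ord0 leeDl//; apply: nneseries_ge0 => j _ _.
  by case: ifP => // _; rewrite lee_fin.
have [ba|ab] := leP (b n) (a n).
  rewrite big_ord_recr/= [Num.max (b n - a n)%R 0%R]max_r ?subr_le0// mulr0.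
  by apply: nneseries_ge0 => k _ _; case: ifP => // _; rewrite lee_fin; exact: vol0.
pose V := (\prod_(i < n) Num.max (b i - a i) 0)%R.
pose W k := if P k then (\prod_(i < n) Num.max (B k i - A k i) 0)%R else 0%R.
have W0 k : (0 <= W k)%R by rewrite /W; case: ifP.
(* The boxes whose last side contains t cover the slice at height t; this is why the statement
   carries a selection [P] of boxes. The induction hypothesis bounds the volume of the slice, and
   integrating over t restores the last factor. *)
have slice t : `]a n, b n]%classic t ->
    V%:E <= \sum_(k <oo) (W k * \1_(`]A k n, B k n]) t)%:E.
  rewrite /= in_itv/= => tab.
  have := IH a b (fun k => P k && (t \in `]A k n, B k n])) A B.
  move=> /(_ _)/le_trans; apply.
    move=> x xab.
    have [|k Pk xk] := cov (fun i => if i == n then t else x i).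
      move=> i; rewrite ltnS leq_eqVlt; case: eqP => [->//|_ /= ilt].
      exact: xab.
    exists k.
      by rewrite Pk/= in_itv/=; have := xk n (ltnSn n); rewrite eqxx.
    move=> i ilt; have := xk i (ltnW ilt).
    by rewrite (ltn_eqF ilt).
  apply: lee_nneseries => [k _ _|k _]; first by case: ifP => // _; rewrite lee_fin.
  rewrite /W indicE mem_setE; case: (P k) => /=; last by rewrite mul0r.
  by case: ifP => _; rewrite ?mulr1 ?mulr0.
have mE k : measurable (`]A k n, B k n]%classic : set R) by exact: measurable_itv.
rewrite big_ord_recr/= [Num.max (b n - a n)%R 0%R]max_l; last by rewrite subr_ge0 ltW.
have -> : (V * (b n - a n))%:E = \int[lebesgue_measure]_(t in `]a n, b n]) V%:E.
  rewrite integral_cst//=.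
  rewrite lebesgue_measure_itv/= lte_fin ab.
  by rewrite -EFinD -EFinM.
apply: (@le_trans _ _ (\int[lebesgue_measure]_(t in `]a n, b n])
   \sum_(k <oo) (W k * \1_(`]A k n, B k n]) t)%:E)).
  apply: ge0_le_integral => //.
  - by move=> t _; rewrite lee_fin; exact: vol0.
  - apply: ge0_emeasurable_sum => [k t _ _|k _].
      by rewrite lee_fin mulr_ge0.
    apply/measurable_EFinP; apply: measurable_funM => //.
rewrite integral_nneseries//; last 2 first.
- by move=> k; apply/measurable_EFinP; apply: measurable_funM.
- by move=> k t _; rewrite lee_fin mulr_ge0.
apply: lee_nneseries => [k _ _|k _].
  by apply: integral_ge0 => t _; rewrite lee_fin mulr_ge0.
under eq_integral do rewrite EFinM.
rewrite ge0_integralZl//; [|by apply/measurable_EFinP; exact: measurable_indic|by rewrite lee_fin].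
rewrite integral_indic// setIC.
have -> : (if P k then (\prod_(i < n.+1) Num.max (B k i - A k i) 0)%R%:E
    else 0) = (W k)%:E * (Num.max (B k n - A k n) 0)%:E.
  by rewrite /W; case: (P k); rewrite ?mul0e// big_ord_recr/= EFinM.
apply: lee_wpmul2l; first by rewrite lee_fin.
apply: (le_trans (le_measure _ _ _ (@subIsetr _ _ _))); rewrite ?inE//.
  by apply: measurableI.
rewrite /= lebesgue_measure_itv/= lte_fin; case: ltP => // ?.
  by rewrite -EFinD lee_fin le_max lexx.
by rewrite lee_fin le_max lexx orbT.
Qed.

End box_volume.

Section lebesgue_box.
Context {R : realType} {n : nat}.
Local Open Scope ereal_scope.
Implicit Types (a b : 'rV[R]_n) (X : set 'rV[R]_n).

Lemma lebesgue_outer_box_le a b :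
  lebesgue_outer (box a b) <= box_vol a b.
Proof.
apply: ereal_inf_lbound.
exists (fun k => if k == 0%N then Some (a, b) else None).
  by move=> x abx; exists 0%N.
rewrite (@nneseriesD1 _ _ 0%N)//=; last by move=> k _; exact: obox_vol_ge0.
rewrite eseries0 ?adde0// => k _.
by case: eqP.
Qed.

Lemma lebesgue_outer_box a b : lebesgue_outer (box a b) = box_vol a b.
Proof.
apply/eqP; rewrite eq_le lebesgue_outer_box_le/=.
apply: le_ereal_inf_tmp => _ [B abB <-].
(* The covering lemma indexes coordinates by [nat], so that its induction drops the last one without
   reshaping vectors; [ext] pads a row vector by zeros. *)
pose ext (u : 'rV[R]_n) (i : nat) : R := if insub i is Some j then u 0%R j else 0%R.
have extE u (i : 'I_n) : ext u i = u 0%R i.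
  by rewrite /ext insubT//= => p; congr (u _ _); exact: val_inj.
pose lo k := if B k is Some uv then ext uv.1 else fun=> 0%R.
pose hi k := if B k is Some uv then ext uv.2 else fun=> 0%R.
have := @box_vol_cover R n (ext a) (ext b) (fun k => B k) lo hi.
have -> : (\prod_(i < n) Num.max (ext b i - ext a i) 0)%:E = box_vol a b.
  by congr EFin; apply: eq_bigr => i _; rewrite !extE.
move=> /(_ _)/le_trans; apply.
  move=> x xab.
  have [|k _] := abB (\row_i x i).
    by move=> i; rewrite mxE -!extE; exact: xab.
  rewrite /obox /lo /hi => Bk; exists k; case: (B k) Bk => // uv Bk i ilt.
  by have := Bk (Ordinal ilt); rewrite mxE -!extE.
apply: lee_nneseries => [k _ _|k _].
  case: (B k) => //= uv; rewrite lee_fin; apply: prodr_ge0 => i _.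
  by rewrite le_max lexx orbT.
rewrite /lo /hi; case: (B k) => //= uv.
by rewrite lee_fin; apply: ler_prod => i _; rewrite !extE lexx le_max lexx orbT.
Qed.

Lemma box_split_le a b i c :
  box a b `&` [set x | (x 0 i <= c)%R] =
  box a (\row_j if j == i then Num.min (b 0 j) c else b 0 j)%R.
Proof.
apply/seteqP; split=> [x [abx /= xc] j|x /= abx].
  rewrite mxE; case: eqP => [->|_]; last exact: abx.
  by have /andP[-> ?] := abx i; rewrite le_min xc andbT.
split=> [j|].
  have := abx j; rewrite mxE; case: eqP => // ->.
  by rewrite le_min => /and3P[-> ->].
by have := abx i; rewrite mxE eqxx le_min => /and3P[].
Qed.

Lemma box_split_gt a b i c :
  box a b `&` [set x | (c < x 0 i)%R] =
  box (\row_j if j == i then Num.max (a 0 j) c else a 0 j)%R b.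
Proof.
apply/seteqP; split=> [x [abx /= xc] j|x /= abx].
  rewrite mxE; case: eqP => [->|_]; last exact: abx.
  by have /andP[? ->] := abx i; rewrite gt_max xc !andbT.
split=> [j|].
  have := abx j; rewrite mxE; case: eqP => // ->.
  by rewrite gt_max => /andP[/andP[-> _] ->].
by have := abx i; rewrite mxE eqxx gt_max => /andP[/andP[]].
Qed.

Lemma box_vol_split a b i c :
  box_vol a (\row_j if j == i then Num.min (b 0 j) c else b 0 j)%R +
  box_vol (\row_j if j == i then Num.max (a 0 j) c else a 0 j)%R b =
  box_vol a b.
Proof.
rewrite /box_vol -EFinD; congr EFin.
rewrite (bigD1 i)//= [X in (_ + X)%R](bigD1 i)//= [RHS](bigD1 i)//=.
rewrite !mxE !eqxx.
under eq_bigr => j ji do rewrite mxE (negbTE ji).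
under [X in (_ + _ * X)%R]eq_bigr => j ji do rewrite mxE (negbTE ji).
rewrite -mulrDl; congr (_ * _)%R.
rewrite /Num.max /Num.min.
move: (a 0%R i) (b 0%R i) => u v.
case: (ltP v c) => vc; case: (ltP u c) => uc; case: (ltP (v - u) 0)%R => ?.
all: try (case: (ltP (v - c) 0)%R => ?).
all: try (case: (ltP (c - u) 0)%R => ?).
all: by lra.
Qed.

(** Cutting each box of a cover along the hyperplane gives covers of the two halves with the same
    total volume, which is the Caratheodory inequality. *)
Lemma measurable_halfspace (i : 'I_n) (c : R) :
  measurable [set x : Rn R n | (x 0 i <= c)%R].
Proof.
apply: le_caratheodory_measurable => X.
apply: le_ereal_inf_tmp => _ [B XB <-].
pose B1 k := if B k is Some ab then
  Some (ab.1, (\row_j if j == i then Num.min (ab.2 0 j) c else ab.2 0 j)%R) else None.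
pose B2 k := if B k is Some ab then
  Some ((\row_j if j == i then Num.max (ab.1 0 j) c else ab.1 0 j)%R, ab.2) else None.
apply: (@le_trans _ _ (\sum_(k <oo) obox_vol (B1 k) + \sum_(k <oo) obox_vol (B2 k))).
  apply: leeD; apply: ereal_inf_lbound.
    exists B1 => // x [/XB[k _ Bk] xc]; exists k => //.
    rewrite /B1; case: (B k) Bk => //= ab Bk.
    by rewrite -box_split_le.
  exists B2 => // x [/XB[k _ Bk] /negP]; rewrite -ltNge => xc; exists k => //.
  rewrite /B2; case: (B k) Bk => //= ab Bk.
  by rewrite -box_split_gt.
rewrite -nneseriesD//; [|by move=> ? _ _; exact: obox_vol_ge0..].
apply: lee_nneseries => [k _ _|k _].
  by rewrite adde_ge0// obox_vol_ge0.
rewrite /B1 /B2; case: (B k) => [ab|] /=; last by rewrite adde0.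
by rewrite box_vol_split.
Qed.

Lemma measurable_coord (i : 'I_n) :
  measurable_fun [set: Rn R n] (fun x : Rn R n => x 0%R i).
Proof.
apply: (measurability _ (RGenOInfty.measurableE R)) => //.
move=> _ [_ [c ->] <-]; rewrite setTI.
have -> : (fun x : Rn R n => x 0%R i) @^-1` `]c, +oo[%classic =
   ~` [set x | (x 0 i <= c)%R].
  apply/seteqP; split => x /=; rewrite in_itv/= andbT ltNge => /negP//.
by apply: measurableC; exact: measurable_halfspace.
Qed.

Lemma measurable_coords (P : 'I_n -> set R) :
  (forall i, measurable (P i)) ->
  measurable [set x : Rn R n | forall i, P i (x 0%R i)].
Proof.
move=> mP.
have -> : [set x : Rn R n | forall i, P i (x 0%R i)] =
  \bigcap_(i in [set: 'I_n]) ((fun x : Rn R n => x 0%R i) @^-1` P i).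
  by apply/seteqP; split => x /= h i; [move=> _; exact: h|exact: h].
apply: fin_bigcap_measurable => [|i _]; first exact: finite_finset.
by rewrite -[X in measurable X]setTI; exact: measurable_coord.
Qed.

Lemma measurable_box a b : measurable (box a b : set (Rn R n)).
Proof.
apply: (@measurable_coords (fun i => `]a 0 i, b 0 i]%classic)%R) => i.
exact: measurable_itv.
Qed.

Lemma measurable_cube a l : measurable (cube a l).
Proof.
apply: (@measurable_coords (fun i => `[a 0 i, a 0 i + l]%classic)%R) => i.
exact: measurable_itv.
Qed.

End lebesgue_box.

Section invariant_integral.
Context d (T : measurableType d) (R : realType) (mu : {measure set T -> \bar R}).
Context (phi : T -> T) (mphi : measurable_fun setT phi).
Hypothesis inv : forall A, measurable A -> mu (phi @^-1` A) = mu A.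
Local Open Scope ereal_scope.

Lemma ge0_integral_invariant (f : T -> \bar R) :
  measurable_fun setT f -> (forall x, 0 <= f x) ->
  \int[mu]_x f (phi x) = \int[mu]_x f x.
Proof.
move=> mf f0.
have := @ge0_integral_pushforward _ _ _ _ R _ mphi mu setT f measurableT mf.
rewrite preimage_setT => <- //.
by apply: eq_measure_integral => A mA _; exact: inv.
Qed.

Lemma integral_invariant (f : T -> \bar R) :
  measurable_fun setT f -> \int[mu]_x f (phi x) = \int[mu]_x f x.
Proof.
move=> mf; transitivity (\int[mu]_x (f \o phi) x) => //.
rewrite integralE [RHS]integralE (funepos_comp f phi) (funeneg_comp f phi); congr (_ - _).
  by apply: ge0_integral_invariant => //; exact: measurable_funepos.
by apply: ge0_integral_invariant => //; exact: measurable_funeneg.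
Qed.

Lemma Rintegral_invariant (f : T -> R) :
  measurable_fun setT f -> (\int[mu]_x f (phi x) = \int[mu]_x f x)%R.
Proof.
move=> mf; rewrite /Rintegral (integral_invariant (f := EFin \o f))//.
exact/measurable_EFinP.
Qed.

End invariant_integral.

Section translation.
Context {R : realType} {n : nat}.
Local Open Scope ereal_scope.
Implicit Types (h : 'rV[R]_n) (X : set 'rV[R]_n).

Lemma le_lebesgue_outer_shift h X :
  lebesgue_outer ((fun x => x + h)%R @^-1` X) <= lebesgue_outer X.
Proof.
apply: le_ereal_inf_tmp => _ [B XB <-].
pose B' k := if B k is Some ab then Some (ab.1 - h, ab.2 - h)%R else None.
have -> : \sum_(k <oo) obox_vol (B k) = \sum_(k <oo) obox_vol (B' k).
  apply: eq_eseriesr => k _; rewrite /B'; case: (B k) => //= ab.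
  by congr EFin; apply: eq_bigr => i _; rewrite !mxE; congr (Num.max _ _); ring.
apply: ereal_inf_lbound; exists B' => // x /XB[k _ Bk]; exists k => //.
rewrite /B'; case: (B k) Bk => //= ab Bk i.
by have := Bk i; rewrite !mxE ltrBlDr lerBrDr.
Qed.

Lemma lebesgue_outer_shift h X :
  lebesgue_outer ((fun x => x + h)%R @^-1` X) = lebesgue_outer X.
Proof.
apply/eqP; rewrite eq_le le_lebesgue_outer_shift/=.
rewrite (le_trans _ (le_lebesgue_outer_shift (- h) _))//.
rewrite le_eqVlt; apply/orP; left; apply/eqP; congr lebesgue_outer.
by apply/seteqP; split => x /=; rewrite addrNK.
Qed.

Lemma caratheodory_shift h (A : set 'rV[R]_n) :
  lebesgue_outer.-caratheodory A ->
  lebesgue_outer.-caratheodory ((fun x => x + h)%R @^-1` A).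
Proof.
move=> mA X; have := mA ((fun x => x - h)%R @^-1` X).
rewrite lebesgue_outer_shift => ->.
by congr (_ + _); rewrite -[LHS](lebesgue_outer_shift h); congr lebesgue_outer;
  apply/seteqP; split => x /=; rewrite addrK.
Qed.

Lemma measurable_shift h :
  measurable_fun [set: Rn R n] (fun x : Rn R n => (x + h)%R : Rn R n).
Proof. by move=> _ A mA; rewrite setTI; exact: caratheodory_shift. Qed.

Lemma Rintegral_shift h (f : Rn R n -> R) :
  measurable_fun setT f -> (\int[leb]_x f (x + h) = \int[leb]_x f x)%R.
Proof.
apply: (Rintegral_invariant (measurable_shift h)) => A _.
exact: lebesgue_outer_shift.
Qed.

End translation.

Section open_measurable.
Context {R : realType} {n : nat}.

(** An open set is the union of the countably many open boxes with rational centre and half-side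
    that it contains. *)
Lemma open_measurable_Rn (U : set 'rV[R]_n) :
  open U -> measurable (U : set (Rn R n)).
Proof.
move=> oU.
pose B (q : 'rV[rat]_n * rat) : set (Rn R n) :=
  [set x : 'rV[R]_n | forall i, x 0 i \in `]ratr (q.1 0 i) - ratr q.2, ratr (q.1 0 i) + ratr q.2[ ].
have -> : U = \bigcup_q (if pselect (B q `<=` U) then B q else set0).
  apply/seteqP; split => x; last by case=> q _; case: pselect => // BU; exact: BU.
  move=> Ux.
  have /nbhs_ballP[e /= e0 xe] : nbhs x U by exact: open_nbhs_nbhs.
  (* If the centre is within r of x in each coordinate, the box of half-side r stays within 2 r of
     x; hence the bound e / 2. *)
  have [r _ /=] : exists2 r : rat, True & ratr r \in `]0, e / 2[.
    have := @rat_in_itvoo R 0 (e / 2); rewrite divr_gt0// => /(_ erefl)[r ?].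
    by exists r.
  rewrite in_itv/= => /andP[r0 re].
  have /choice[q qx] : forall i, exists q : rat,
      ratr q \in `]x 0 i - ratr r, x 0 i + ratr r[.
    by move=> i; apply: rat_in_itvoo; lra.
  exists (\row_i q i, r) => //; case: pselect => /=; last first.
    case=> y By; apply: xe; split => // i j; rewrite ord1.
    have := By j; have := qx j; rewrite !in_itv/= mxE /ball/= => ? ?.
    by rewrite ltr_norml; lra.
  by move=> _ i; have := qx i; rewrite !in_itv/= mxE; lra.
apply: countable_bigcupT_measurable => // q; case: (pselect (B q `<=` U)) => //= _.
by apply: (@measurable_coords R n (fun i => `]ratr (q.1 0 i) - ratr q.2, ratr (q.1 0 i) + ratr q.2[%classic)) => i; exact: measurable_itv.
Qed.

Lemma closed_measurable_Rn (U : set 'rV[R]_n) :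
  closed U -> measurable (U : set (Rn R n)).
Proof.
move=> cU; rewrite -[U]setCK; apply: measurableC.
by apply: open_measurable_Rn; exact: closed_openC.
Qed.

Lemma compact_measurable_Rn (K : set 'rV[R]_n) :
  compact K -> measurable (K : set (Rn R n)).
Proof.
move=> cK; apply: closed_measurable_Rn; apply: compact_closed cK.
exact: norm_hausdorff.
Qed.

Lemma continuous_measurable_Rn (f : 'rV[R]_n -> R) :
  continuous f -> measurable_fun [set: Rn R n] f.
Proof.
move=> cf; apply: (measurability _ (RGenOInfty.measurableE R)) => //.
move=> _ [_ [c ->] <-]; rewrite setTI.
apply: open_measurable_Rn; exact: open_comp.
Qed.

End open_measurable.

(** * Smooth functions and mollification *)

Section rowvec_norm.
Context {R : realType} {n : nat}.
Implicit Types (x : 'rV[R]_n).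

Lemma coord_le_norm x i : `|x 0 i| <= `|x|.
Proof.
rewrite [leRHS]mx_normrE.
exact: (le_bigmax_cond _ (fun i : 'I_1 * 'I_n => `|x i.1 i.2|) (j := (0, i))).
Qed.

Lemma norm_le_coord x (r : R) :
  0 <= r -> (forall i, `|x 0 i| <= r) -> `|x| <= r.
Proof.
move=> r0 xr; rewrite [leLHS]mx_normrE; apply/bigmax_leP; split => // -[i j] _ /=.
by rewrite ord1.
Qed.

Lemma compact_norm_le (r : R) : compact [set x : 'rV[R]_n | `|x| <= r].
Proof.
apply: bounded_closed_compact.
  exists r; split; first exact: num_real.
  by move=> M rM x /= xr; exact: le_trans xr (ltW rM).
have -> : [set x : 'rV[R]_n | `|x| <= r] = (@Num.norm _ _) @^-1` [set y | y <= r] by [].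
apply: preimage_closed; last exact: closed_le.
by move=> x _; exact: norm_continuous.
Qed.

End rowvec_norm.

Section smooth_calculus.
Context {R : realType} {n : nat}.
Implicit Types (f g phi : 'rV[R]_n -> R) (x y : 'rV[R]_n).
Local Notation e_ j := (delta_mx 0 j : 'rV[R]_n).

(** [smooth] speaks of all iterated derivatives at once. This order-by-order form is what inductions
    for sums, products, shifts and mollifications use; [smoothP] translates. *)
Fixpoint Ck (k : nat) f : Prop := continuous f /\
  if k is k'.+1 then
    forall j, (forall x, derivable f x (e_ j)) /\ Ck k' (partial j f)
  else True.

Lemma CkW k f : Ck k.+1 f -> Ck k f.
Proof.
elim: k f => [|k IH] f [cf df]; split => // j; split; first exact: (df j).1.
by apply: IH; exact: (df j).2.
Qed.

Lemma smoothP f : smooth f <-> forall k, Ck k f.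
Proof.
split=> [sf k|].
  elim: k f sf => [|k IH] f sf; first by split => //; exact: (sf [::]).1.
  split; first exact: (sf [::]).1.
  move=> j; split; first exact: ((sf [::]).2 j).
  by apply: IH => s; have := sf (rcons s j); rewrite foldr_rcons.
move=> + s; elim/last_ind: s f => [|s j IH] f Cf.
  split; first by have [] := Cf 0%N.
  by move=> j; have [_ /(_ j)[]] := Cf 1%N.
rewrite foldr_rcons; apply: IH => k.
by have [_ /(_ j)[]] := Cf k.+1.
Qed.

Lemma smooth_partial f j : smooth f -> smooth (partial j f).
Proof. by move=> sf s; have := sf (rcons s j); rewrite foldr_rcons. Qed.

Lemma smooth_continuous f : smooth f -> continuous f.
Proof. by move=> /(_ [::])[]. Qed.

Lemma smooth_derivable f j x : smooth f -> derivable f x (e_ j).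
Proof. by move=> /(_ [::])[]. Qed.

Lemma Ck_cst k (c : R) : Ck k (fun=> c).
Proof.
elim: k c => [|k IH] c; split => //; try exact: cst_continuous.
move=> j; split; first by move=> x; exact: ex_derive.
have -> : partial j (fun=> c) = (fun=> 0); last exact: IH.
by apply/funext => x; rewrite /partial derive_cst.
Qed.

Lemma smooth_cst (c : R) : @smooth R n (fun=> c).
Proof. by apply/smoothP => k; exact: Ck_cst. Qed.

Lemma Ck_add k f g : Ck k f -> Ck k g -> Ck k (fun x => f x + g x).
Proof.
elim: k f g => [|k IH] f g [cf df] [cg dg].
  by split => // x; exact: (@continuousD _ _ _ f g x (cf x) (cg x)).
split=> [x|j]; first exact: (@continuousD _ _ _ f g x (cf x) (cg x)).
split=> [x|]; first by apply: derivableD; [exact: (df j).1|exact: (dg j).1].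
have -> : partial j (fun x => f x + g x) = (fun x => partial j f x + partial j g x).
  apply/funext => x; rewrite /partial deriveD//; [exact: (df j).1|exact: (dg j).1].
by apply: IH; [exact: (df j).2|exact: (dg j).2].
Qed.

Lemma partialM j f g x : derivable f x (e_ j) -> derivable g x (e_ j) ->
  partial j (fun x => f x * g x) x = partial j f x * g x + f x * partial j g x.
Proof.
move=> df dg; rewrite /partial (deriveM df dg) addrC; congr (_ + _).
by rewrite [RHS]mulrC.
Qed.

Lemma Ck_mul k f g : Ck k f -> Ck k g -> Ck k (fun x => f x * g x).
Proof.
elim: k f g => [|k IH] f g; first move=> [cf df] [cg dg].
  by split => // x; exact: (@continuousM _ _ f g x (cf x) (cg x)).
move=> Cf Cg; have [cf df] := Cf; have [cg dg] := Cg.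
split=> [x|j]; first exact: (@continuousM _ _ f g x (cf x) (cg x)).
split=> [x|]; first by apply: derivableM; [exact: (df j).1|exact: (dg j).1].
have -> : partial j (fun x => f x * g x) =
    (fun x => partial j f x * g x + f x * partial j g x).
  by apply/funext => x; rewrite partialM//; [exact: (df j).1|exact: (dg j).1].
apply: Ck_add; apply: IH; by [exact: CkW|exact: (df j).2|exact: (dg j).2].
Qed.

Lemma smoothM f g : smooth f -> smooth g -> smooth (fun x => f x * g x).
Proof. by move=> /smoothP sf /smoothP sg; apply/smoothP => k; exact: Ck_mul. Qed.

Lemma smooth_prod (I : Type) (s : seq I) (F : I -> 'rV[R]_n -> R) :
  (forall i, smooth (F i)) -> smooth (fun x => \prod_(i <- s) F i x).
Proof.
move=> sF; elim: s => [|i s IH].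
  have -> : (fun x => \prod_(i <- [::]) F i x) = (fun=> 1).
    by apply/funext => x; rewrite big_nil.
  exact: smooth_cst.
have -> : (fun x => \prod_(j <- i :: s) F j x) =
    (fun x => F i x * \prod_(j <- s) F j x).
  by apply/funext => x; rewrite big_cons.
exact: smoothM.
Qed.

Lemma is_derive_line f x v (t df : R) : is_derive (t *: v + x) v f df ->
  is_derive t 1 (fun s => f (s *: v + x)) df.
Proof.
move=> [dv <-].
have E : (fun h : R => h^-1 *: (((fun s => f (s *: v + x)) \o shift t) (h *: (1 : R)) - f (t *: v + x)))
  = (fun h : R => h^-1 *: ((f \o shift (t *: v + x)) (h *: v) - f (t *: v + x))).
  apply/funext => h /=; congr (_ *: (f _ - _)).
  have -> : h *: (1 : R) = h := mulr1 h.
  by rewrite scalerDl addrA.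
by split; rewrite /derivable /derive E.
Qed.

Lemma line_MVT f j (x : 'rV[R]_n) (t : R) :
  (forall y, derivable f y (e_ j)) ->
  exists2 s, `|s| <= `|t| & f (t *: e_ j + x) - f x = t * partial j f (s *: e_ j + x).
Proof.
move=> df; pose g s := f (s *: e_ j + x).
have dg (s : R) : is_derive s (1 : R) g (partial j f (s *: e_ j + x)).
  by apply: is_derive_line; exact: derivableP.
have cg a b : {within `[a, b], continuous g}.
  apply: continuous_subspaceT => s.
  by apply/differentiable_continuous/derivable1_diffP.
have g0 : g 0 = f x by rewrite /g scale0r add0r.
have [t0|t0] := leP 0 t.
  have [s] := MVT_segment t0 (fun s _ => dg s) (cg _ _).
  rewrite in_itv/= => /andP[s0 st]; rewrite g0 subr0 mulrC => gE.
  by exists s => //; rewrite !ger0_norm.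
have [s] := MVT_segment (ltW t0) (fun s _ => dg s) (cg _ _).
rewrite in_itv/= => /andP[ts s0]; rewrite g0 sub0r mulrN => gE.
exists s; first by rewrite !ler0_norm ?lerN2// ltW.
by rewrite -opprB gE opprK mulrC.
Qed.

Lemma partial_lipschitz f (M : R) x y :
  (forall j z, derivable f z (e_ j)) ->
  (forall j z, `|partial j f z| <= M) ->
  `|f x - f y| <= n%:R * (M * `|x - y|).
Proof.
move=> df fM.
(* The points [z k] lead from y to x by changing one coordinate at a time, each change being
   controlled by the mean value theorem. *)
pose z k : 'rV[R]_n := \row_j if (j < k)%N then x 0 j else y 0 j.
have zS (k : 'I_n) : z k.+1 = (x 0 k - y 0 k) *: e_ k + z k.
  apply/rowP => j; rewrite !mxE eqxx/= ltnS leq_eqVlt.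
  have [->|jk] := eqVneq j k; first by rewrite eqxx/= ltnn mulr1 subrK.
  have -> : (j == k :> nat) = false by apply/negbTE; rewrite (inj_eq val_inj).
  by rewrite mulr0 add0r.
have stepz (k : 'I_n) : `|f (z k.+1) - f (z k)| <= M * `|x - y|.
  rewrite zS; have [s _ ->] := line_MVT (z k) (x 0 k - y 0 k) (df k).
  rewrite normrM mulrC ler_pM//.
  have -> : x 0 k - y 0 k = (x - y) 0 k by rewrite !mxE.
  exact: coord_le_norm.
have tele k : (k <= n)%N -> `|f (z k) - f (z 0%N)| <= k%:R * (M * `|x - y|).
  elim: k => [|k IH] kn; first by rewrite subrr normr0 mul0r.
  rewrite -(subrK (f (z k)) (f (z k.+1))) -addrA (le_trans (ler_normD _ _))//.
  by rewrite -natr1 mulrDl mul1r [leRHS]addrC lerD// ?(stepz (Ordinal kn))// IH// ltnW.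
have zn : z n = x by apply/rowP => j; rewrite mxE ltn_ord.
have z0 : z 0%N = y by apply/rowP => j; rewrite mxE.
by have := tele n (leqnn n); rewrite zn z0.
Qed.

End smooth_calculus.

(** Tolerances are chosen as e / (c + 1), so that a factor c that may vanish needs no separate
    case. *)
Lemma mulr_div1D_le {R : realFieldType} (c e : R) :
  0 <= c -> 0 <= e -> c * (e / (c + 1)) <= e.
Proof.
move=> c0 e0; rewrite mulrA ler_pdivrMr ?ltr_wpDl//.
by rewrite mulrDr mulr1 mulrC lerDl.
Qed.

Section compact_support.
Context {R : realType} {n : nat}.
Implicit Types (f g phi : 'rV[R]_n -> R) (x y h : 'rV[R]_n).
Local Notation e_ j := (delta_mx 0 j : 'rV[R]_n).

Lemma Ccoo_supp phi : Ccoo phi ->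
  exists2 r, 0 < r & forall x, phi x != 0 -> `|x| <= r.
Proof.
move=> [_ /compact_bounded[M [_ HM]]].
exists (`|M| + 1); first by rewrite ltr_wpDl.
move=> x x0; apply: HM; last exact: subset_closure.
by rewrite (le_lt_trans (ler_norm _))// ltrDl.
Qed.

Lemma Ccoo_ball phi r : smooth phi -> (forall x, phi x != 0 -> `|x| <= r) ->
  Ccoo phi.
Proof.
move=> sphi phir; split => //.
apply: (@subclosed_compact _ _ [set x : 'rV[R]_n | `|x| <= r]).
- exact: closed_closure.
- exact: compact_norm_le.
- have cl : closed [set x : 'rV[R]_n | `|x| <= r].
    by apply: compact_closed; [exact: norm_hausdorff|exact: compact_norm_le].
  by rewrite [X in _ `<=` X](closure_id _).1//; exact: closure_subset.
Qed.

Lemma Ccoo_bounded phi : Ccoo phi -> exists2 M, 0 < M & forall x, `|phi x| <= M.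
Proof.
move=> cphi; have [r r0 phir] := Ccoo_supp cphi.
have /compact_bounded[M [_ HM]] : compact (phi @` [set x : 'rV[R]_n | `|x| <= r]).
  apply: continuous_compact; last exact: compact_norm_le.
  by apply: continuous_subspaceT; exact: smooth_continuous cphi.1.
exists (`|M| + 1); first by rewrite ltr_wpDl.
move=> x; have [->|x0] := eqVneq (phi x) 0; first by rewrite normr0 addr_ge0.
apply: HM; last by exists x => //; exact: phir.
by rewrite (le_lt_trans (ler_norm _))// ltrDl.
Qed.

Lemma partial_supp j phi r x : (forall x, phi x != 0 -> `|x| <= r) ->
  partial j phi x != 0 -> `|x| <= r.
Proof.
move=> phir; apply: contraNle => rx; apply/eqP; rewrite /partial.
rewrite (@near_eq_derive _ _ _ phi (cst 0) x (e_ j)).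
- by rewrite derive_cst.
- near=> y; apply/eqP/negPn/negP => /phir; apply/negP; rewrite -ltNge.
  near: y; apply: (cvgr_gt `|x|) => //; exact: norm_continuous.
Unshelve. all: by end_near. Qed.

Lemma Ccoo_partial j phi : Ccoo phi -> Ccoo (partial j phi).
Proof.
move=> cphi; have [r _ phir] := Ccoo_supp cphi.
apply: (@Ccoo_ball _ r); first exact: smooth_partial cphi.1.
by move=> x; exact: partial_supp phir.
Qed.

Lemma CcooM f phi : smooth f -> Ccoo phi -> Ccoo (fun x => f x * phi x).
Proof.
move=> sf cphi; have [r _ phir] := Ccoo_supp cphi.
apply: (@Ccoo_ball _ r); first by apply: smoothM => //; exact: cphi.1.
by move=> x; rewrite mulf_eq0 negb_or => /andP[_]; exact: phir.
Qed.

Lemma is_derive_shift_in phi h y v df : is_derive (y + h) v phi df ->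
  is_derive y v (fun z => phi (z + h)) df.
Proof.
move=> [dv <-].
have E : (fun t : R => t^-1 *: (((fun z => phi (z + h)) \o shift y) (t *: v) - phi (y + h)))
  = (fun t : R => t^-1 *: ((phi \o shift (y + h)) (t *: v) - phi (y + h))).
  by apply/funext => t /=; rewrite addrA.
by split; rewrite /derivable /derive E.
Qed.

Lemma partial_shift j phi h y : derivable phi (y + h) (e_ j) ->
  partial j (fun z => phi (z + h)) y = partial j phi (y + h).
Proof.
move=> /derivableP d; rewrite /partial.
by have /@derive_val := is_derive_shift_in d.
Qed.

Lemma Ck_shift k phi h : Ck k phi -> Ck k (fun z => phi (z + h)).
Proof.
have cont f : continuous f -> continuous (fun z : 'rV[R]_n => f (z + h)).
  move=> cf x; apply: (@continuous_comp 'rV[R]_n 'rV[R]_n R (fun z : 'rV[R]_n => z + h) f); last exact: cf.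
  by apply: (@continuousD _ _ _ (@id 'rV[R]_n) (cst h)) => //; exact: cst_continuous.
elim: k phi => [|k IH] phi [cphi dphi]; split => //; try exact: cont.
move=> j; split=> [x|].
  have /derivableP d := (dphi j).1 (x + h).
  by have [] := is_derive_shift_in d.
have -> : partial j (fun z => phi (z + h)) = (fun z => partial j phi (z + h)).
  by apply/funext => z; rewrite partial_shift//; exact: (dphi j).1.
by apply: IH; exact: (dphi j).2.
Qed.

Lemma Ccoo_shift phi h : Ccoo phi -> Ccoo (fun z => phi (z + h)).
Proof.
move=> cphi; have [r r0 phir] := Ccoo_supp cphi.
apply: (@Ccoo_ball _ (r + `|h|)).
  apply/smoothP => k; apply: Ck_shift; move: k; apply/smoothP; exact: cphi.1.
move=> x /phir xr.
by rewrite -(addrK h x) (le_trans (ler_normB _ _))// lerD2r.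
Qed.

(** Two applications of the mean value theorem, which give the remainder without the factor 1 /
    2. *)
Lemma taylor2 phi (M : R) j z (t : R) :
  (forall i x, derivable phi x (e_ i)) ->
  (forall i k x, derivable (partial i phi) x (e_ k)) ->
  (forall i x, `|partial i (partial j phi) x| <= M) ->
  `|phi (t *: e_ j + z) - phi z - t * partial j phi z| <= M * t ^+ 2.
Proof.
move=> d1 d2 HM.
have [s st ->] := line_MVT z t (d1 j).
have [u us E] := line_MVT z s (d2 j j).
rewrite -mulrBr E !normrM mulrCA mulrA mulrC.
have M0 : 0 <= M by apply: le_trans (HM j z).
rewrite ler_pM// ?mulr_ge0// ?HM//.
by rewrite -[t ^+ 2]real_normK ?num_real// expr2 ler_wpM2r.
Qed.

(** A quadratic remainder survives integration against f. The lemma therefore replaces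
    differentiation under the integral sign, and it also differentiates the flat functions at 0. *)
Lemma is_derive_quad (V : normedModType R) (f : V -> R) (x v : V) (l C r : R) : 0 < r ->
  (forall t : R, `|t| <= r -> `|f (t *: v + x) - f x - t * l| <= C * t ^+ 2) ->
  is_derive x v f l.
Proof.
move=> r0 H.
have C0 : 0 <= C.
  have := H r; rewrite gtr0_norm// => /(_ (lexx _))/(le_trans (normr_ge0 _)).
  by rewrite pmulr_lge0// exprn_gt0.
have cv : (fun t : R => t^-1 *: ((f \o shift x) (t *: v) - f x)) @ 0^' --> l.
  apply/cvgrPdist_le => e e0; near=> t.
  have t0 : t != 0 by near: t; exact: nbhs_dnbhs_neq.
  have tr : `|t| <= r.
    by apply/ltW; near: t; exact: dnbhs0_lt.
  have tC : `|t| <= e / (C + 1).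
    by apply: ltW; near: t; apply: dnbhs0_lt; rewrite divr_gt0// ltr_wpDl.
  have -> : l - t^-1 *: ((f \o shift x) (t *: v) - f x) =
      - (t^-1 * (f (t *: v + x) - f x - t * l)).
    rewrite [X in l - X](_ : _ = t^-1 * (f (t *: v + x) - f x))//.
    by rewrite [in RHS]mulrBr mulKf// opprB.
  rewrite normrN normrM normfV ler_pdivrMl ?normr_gt0//.
  rewrite (le_trans (H _ tr))// -normr_id -real_normK ?num_real// normr_id expr2 mulrCA.
  rewrite ler_wpM2l//.
  rewrite (@le_trans _ _ (C * (e / (C + 1))))// ?ler_wpM2l//.
  by rewrite mulr_div1D_le// ltW.
split; first by apply/cvg_ex; exists l.
exact/cvg_lim.
Unshelve. all: by end_near. Qed.

Lemma lipschitz_continuous f (x : 'rV[R]_n) (C r : R) : 0 < r ->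
  (forall y, `|y - x| <= r -> `|f y - f x| <= C * `|y - x|) ->
  {for x, continuous f}.
Proof.
move=> r0 H; apply/(@cvgrPdist_le _ _ _ (nbhs x)) => e e0; near=> y.
have yr : `|y - x| <= r.
  rewrite distrC ltW//; near: y; apply: cvgr_dist_lt => //.
have yC : `|y - x| <= e / (`|C| + 1).
  rewrite distrC ltW//; near: y; apply: cvgr_dist_lt => //.
  by rewrite divr_gt0// ltr_wpDl.
rewrite distrC (le_trans (H _ yr))//.
rewrite (@le_trans _ _ (`|C| * (e / (`|C| + 1))))//.
  apply: (@le_trans _ _ (`|C| * `|y - x|)); last by rewrite ler_wpM2l.
  by rewrite ler_wpM2r ?ler_norm.
by rewrite mulr_div1D_le// ltW.
Unshelve. all: by end_near. Qed.

End compact_support.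

(** * Mollification against test functions *)

Section bounded_multiplier.
Context d (T : measurableType d) (R : realType) (mu : {measure set T -> \bar R}).
Implicit Types (f psi : T -> R) (B : set T).
Local Open Scope ereal_scope.

Lemma bounded_mul_integrable f psi B (M : R) : measurable B ->
  measurable_fun setT f -> \int[mu]_(x in B) `|f x|%:E < +oo ->
  measurable_fun setT psi -> (forall x, `|psi x| <= M)%R ->
  (forall x, psi x != 0%R -> B x) ->
  mu.-integrable setT (fun x => (f x * psi x)%:E).
Proof.
move=> mB mf fB mpsi psiM psiB.
have iB : mu.-integrable B (EFin \o f).
  apply/integrableP; split => //; apply/measurable_EFinP.
  exact: measurable_funS mf.
apply: (@le_integrable _ _ _ _ _ _ _ (fun x => M%:E * ((EFin \o (fun x => `|f x|%R)) \_ B) x)) => //.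
- by apply/measurable_EFinP; exact: measurable_funM.
- move=> x _; rewrite /patch; case: ifPn => xB /=.
    rewrite lee_fin normrM mulrC normrM normr_id ler_wpM2r//.
    by rewrite (le_trans (psiM x))// ler_norm.
  have -> : psi x = 0%R by apply/eqP/negPn; apply: contra xB => /psiB; rewrite inE.
  by rewrite !mulr0 normr0.
apply: integrableZl => //.
exact: (iffLR (integrable_mkcond _ mB) (integrable_norm iB)).
Qed.

Lemma bounded_mul_le f psi B (M : R) : measurable B ->
  measurable_fun setT f -> \int[mu]_(x in B) `|f x|%:E < +oo ->
  measurable_fun setT psi -> (forall x, `|psi x| <= M)%R ->
  (forall x, psi x != 0%R -> B x) ->
  (`|\int[mu]_x (f x * psi x)| <= M * fine (\int[mu]_(x in B) `|f x|%:E))%R.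
Proof.
move=> mB mf fB mpsi psiM psiB.
have iF := bounded_mul_integrable mB mf fB mpsi psiM psiB.
have iB : mu.-integrable B (EFin \o f).
  apply/integrableP; split => //; apply/measurable_EFinP.
  exact: measurable_funS mf.
apply: (le_trans (le_normr_Rintegral _ iF)) => //.
have fin : \int[mu]_(x in B) `|f x|%:E \is a fin_num.
  by rewrite ge0_fin_numE// integral_ge0// => x _; rewrite lee_fin.
have E : (\int[mu]_x `|f x * psi x|)%R%:E = \int[mu]_x `|f x * psi x|%:E.
  rewrite /Rintegral fineK//; apply: integrable_fin_num => //.
  exact: (integrable_norm iF).
rewrite -lee_fin E EFinM fineK//.
have mfB : measurable_fun B (fun x => `|f x|%:E).
  apply/measurable_EFinP; apply: measurableT_comp => //.
  exact: measurable_funS mf.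
have M0 : 0 <= M%:E by rewrite lee_fin (le_trans (normr_ge0 (psi point))).
rewrite -ge0_integralZl//.
rewrite [leRHS]integral_mkcond; apply: ge0_le_integral => //=.
- by apply/measurable_EFinP/measurableT_comp => //; exact: measurable_funM.
- by apply/measurable_restrict => //; rewrite setTI; exact: emeasurable_funM.
- move=> x _; rewrite /patch; case: ifPn => xB /=.
    by rewrite -EFinM lee_fin normrM mulrC ler_wpM2r.
  have -> : psi x = 0%R by apply/eqP/negPn; apply: contra xB => /psiB; rewrite inE.
  by rewrite mulr0 normr0.
Qed.

End bounded_multiplier.

Section convolution.
Context {R : realType} {n : nat}.
Implicit Types (f g phi psi : 'rV[R]_n -> R) (x y h : 'rV[R]_n).
Local Notation e_ j := (delta_mx 0 j : 'rV[R]_n).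

Definition normball (r : R) : set (Rn R n) := [set x : 'rV[R]_n | `|x| <= r].

Lemma measurable_normball r : measurable (normball r).
Proof. by apply: compact_measurable_Rn; exact: compact_norm_le. Qed.

(** The convolution of f with the reflected kernel: the values of f that matter are at points y with
    y - x in the support of phi, and a derivative in x falls on phi with a minus sign. *)
Definition mollify f phi x : R := \int[leb]_y (f y * phi (y - x)).

Lemma smooth_measurable phi : smooth phi -> measurable_fun [set: Rn R n] phi.
Proof. by move=> sphi; apply: continuous_measurable_Rn; exact: smooth_continuous. Qed.

Lemma loc_integrable_lty f r : loc_integrable f ->
  (\int[leb]_(x in normball r) `|f x|%:E < +oo)%E.
Proof. by move=> [_]; apply; exact: compact_norm_le. Qed.

Lemma loc_integrable_mul f psi r (M : R) : loc_integrable f ->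
  measurable_fun [set: Rn R n] psi -> (forall x, `|psi x| <= M) ->
  (forall x, psi x != 0 -> `|x| <= r) ->
  (lebesgueRn R n).-integrable setT (fun x => (f x * psi x)%:E).
Proof.
move=> lf mpsi psiM psir.
exact: (bounded_mul_integrable (measurable_normball r) lf.1 (loc_integrable_lty r lf) mpsi psiM).
Qed.

Lemma loc_integrable_Ccoo f phi : loc_integrable f -> Ccoo phi ->
  (lebesgueRn R n).-integrable setT (fun x => (f x * phi x)%:E).
Proof.
move=> lf cphi; have [r _ phir] := Ccoo_supp cphi.
have [M _ phiM] := Ccoo_bounded cphi.
by apply: (loc_integrable_mul lf _ phiM phir); exact: smooth_measurable cphi.1.
Qed.

Lemma loc_integrable_mul_le f psi r (M : R) : loc_integrable f ->
  measurable_fun [set: Rn R n] psi -> (forall x, `|psi x| <= M) ->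
  (forall x, psi x != 0 -> `|x| <= r) ->
  `|\int[leb]_x (f x * psi x)| <= M * fine (\int[leb]_(x in normball r) `|f x|%:E)%E.
Proof.
move=> lf mpsi psiM psir.
exact: (bounded_mul_le (measurable_normball r) lf.1 (loc_integrable_lty r lf) mpsi psiM).
Qed.

Lemma Ccoo_partial_bound phi : Ccoo phi ->
  exists2 M, 0 < M & forall j x, `|partial j phi x| <= M.
Proof.
move=> cphi.
have /choice[M HM] : forall j : 'I_n, exists M, 0 < M /\ forall x, `|partial j phi x| <= M.
  by move=> j; have [M ? ?] := Ccoo_bounded (Ccoo_partial j cphi); exists M.
have S0 : 0 <= \sum_j M j by apply: sumr_ge0 => j _; have [/ltW] := HM j.
exists (\sum_j M j + 1); first by rewrite ltr_wpDl.
move=> j x; rewrite (le_trans ((HM j).2 x))// (bigD1 j)//= -addrA lerDl addr_ge0//.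
by apply: sumr_ge0 => i _; have [/ltW] := HM i.
Qed.

Lemma mollify_continuous f phi : loc_integrable f -> Ccoo phi -> continuous (mollify f phi).
Proof.
move=> lf cphi x.
have [r r0 phir] := Ccoo_supp cphi.
have [M M0 phiM] := Ccoo_partial_bound cphi.
set I := fine (\int[leb]_(y in normball (r + `|x| + 1)) `|f y|%:E)%E.
apply: (@lipschitz_continuous _ _ _ _ (n%:R * M * I) 1) => // z zx.
have mphi h : measurable_fun [set: Rn R n] (fun y => phi (y - h)).
  by apply: smooth_measurable; exact: (Ccoo_shift (- h) cphi).1.
have iphi h : (lebesgueRn R n).-integrable setT (fun y => (f y * phi (y - h))%:E).
  exact: loc_integrable_Ccoo (Ccoo_shift (- h) cphi).
rewrite /mollify -RintegralB//; [|exact: iphi..].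
under eq_Rintegral do rewrite -mulrBr.
rewrite mulrAC; apply: (loc_integrable_mul_le lf).
- exact: measurable_funB.
- move=> y; rewrite -mulrA.
  have := partial_lipschitz (y - z) (y - x) (fun j u => smooth_derivable cphi.1) phiM.
  by rewrite opprB [y - z + _]addrC subrKA (distrC x) mulrA.
- move=> y; apply: contraNle => yr.
  have yx : r < `|y - x|.
    have : `|y| <= `|y - x| + `|x| by rewrite -{1}(subrK x y) ler_normD.
    lra.
  have yz : r < `|y - z|.
    have : `|y| <= `|y - z| + (`|z - x| + `|x|).
      rewrite -{1}(subrK z y) (le_trans (ler_normD _ _))// lerD2l.
      by rewrite -{1}(subrK x z) (le_trans (ler_normD _ _)).
    lra.
  have zero u : r < `|u| -> phi u = 0.
    by move=> ru; apply/eqP/negPn/negP => /phir; rewrite leNgt ru.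
  by rewrite !zero// subrr.
Qed.

(** The second-order remainder of phi is integrated against f. The derivative is written with the
    factor -1 inside the kernel, so that it is again the mollification by a test function and
    smoothness follows by induction. *)
Lemma is_derive_mollify f phi j x : loc_integrable f -> Ccoo phi ->
  is_derive x (e_ j) (mollify f phi) (mollify f (fun z => -1 * partial j phi z) x).
Proof.
move=> lf cphi.
have [r r0 phir] := Ccoo_supp cphi.
have [M M0 phiM] := Ccoo_partial_bound (Ccoo_partial j cphi).
(* For |t| <= 1 this ball contains the supports in y of phi (y - x), of its derivative and of phi (y
   - (t e_j + x)). *)
set I := fine (\int[leb]_(y in normball (r + `|x| + `|e_ j| + 1)) `|f y|%:E)%E.
apply: (@is_derive_quad _ _ _ _ _ _ (M * I) 1) => // t t1.
have cpphi : Ccoo (fun z => -1 * partial j phi z).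
  by apply: CcooM; [exact: smooth_cst|exact: Ccoo_partial].
have mphi psi h : Ccoo psi -> measurable_fun [set: Rn R n] (fun y => psi (y - h)).
  by move=> cpsi; apply: smooth_measurable; exact: (Ccoo_shift (- h) cpsi).1.
have iphi psi h : Ccoo psi ->
    (lebesgueRn R n).-integrable setT (fun y => (f y * psi (y - h))%:E).
  by move=> cpsi; exact: loc_integrable_Ccoo (Ccoo_shift (- h) cpsi).
rewrite /mollify -RintegralB//; [|exact: iphi..].
rewrite -RintegralZl//; last exact: (iphi _ x cpphi).
rewrite -RintegralB//; last 2 first.
- have := integrableB _ (iphi phi (t *: e_ j + x) cphi) (iphi phi x cphi).
  by apply.
- have := integrableZl _ t (iphi _ x cpphi).
  by apply.
have -> : \int[leb]_y (f y * phi (y - (t *: e_ j + x)) - f y * phi (y - x) -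
   t * (f y * (-1 * partial j phi (y - x)))) =
   \int[leb]_y (f y * (phi (y - (t *: e_ j + x)) - phi (y - x) -
     t * (-1 * partial j phi (y - x)))).
  by apply: eq_Rintegral => y _; rewrite !mulrBr mulrCA.
rewrite mulrAC; apply: (loc_integrable_mul_le lf).
- apply: measurable_funB; first by apply: measurable_funB; exact: mphi.
  by apply: measurable_funM; [exact: measurable_cst|exact: (mphi _ x cpphi)].
- move=> y.
  have -> : y - (t *: e_ j + x) = (- t) *: e_ j + (y - x).
    by rewrite opprD scaleNr addrCA.
  have -> : t * (-1 * partial j phi (y - x)) = - t * partial j phi (y - x).
    by rewrite mulrA mulrN1.
  rewrite -[t ^+ 2]sqrrN; apply: taylor2.
  - by move=> i z; exact: smooth_derivable cphi.1.
  - by move=> i k z; apply: smooth_derivable; exact: smooth_partial cphi.1.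
  - by [].
- move=> y; apply: contraNle => yr.
  have yx : r < `|y - x|.
    have : `|y| <= `|y - x| + `|x|.
      by rewrite -{1}(subrK x y) ler_normD.
    have := normr_ge0 (e_ j); lra.
  have yz : r < `|y - (t *: e_ j + x)|.
    have : `|y| <= `|y - (t *: e_ j + x)| + (`|e_ j| + `|x|).
      rewrite -{1}(subrK (t *: e_ j + x) y) (le_trans (ler_normD _ _))// lerD2l.
      by rewrite (le_trans (ler_normD _ _))// lerD2r normrZ ler_piMl.
    lra.
  have zero u : r < `|u| -> phi u = 0.
    by move=> ru; apply/eqP/negPn/negP => /phir; rewrite leNgt ru.
  have zero' u : r < `|u| -> partial j phi u = 0.
    by move=> ru; apply/eqP/negPn/negP => /(partial_supp phir); rewrite leNgt ru.
  by rewrite !zero// zero'// !mulr0 !subrr.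
Qed.

Lemma smooth_mollify f phi : loc_integrable f -> Ccoo phi -> smooth (mollify f phi).
Proof.
move=> lf cphi; apply/smoothP => k.
elim: k phi cphi => [|k IH] phi cphi; first by split => //; exact: mollify_continuous.
split; first exact: mollify_continuous.
move=> j; split=> [x|]; first by have [] := is_derive_mollify j x lf cphi.
have -> : partial j (mollify f phi) = mollify f (fun z => -1 * partial j phi z).
  apply/funext => x; have := is_derive_mollify j x lf cphi.
  by move=> /@derive_val.
by apply: IH; apply: CcooM; [exact: smooth_cst|exact: Ccoo_partial].
Qed.

(** The translate y -> phi (y - x) is a test function, and its derivatives in y are the opposites of
    those in x; the two minus signs cancel. *)
Lemma partial_mollify f g phi j x : loc_integrable f -> is_weak_partial j f g -> Ccoo phi ->
  partial j (mollify f phi) x = mollify g phi x.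
Proof.
move=> lf [lg wg] cphi.
have -> : partial j (mollify f phi) x = mollify f (fun z => -1 * partial j phi z) x.
  by have /@derive_val := is_derive_mollify j x lf cphi.
have -> : mollify g phi x = - \int[leb]_y (f y * partial j (fun z => phi (z - x)) y).
  by rewrite wg ?opprK//; exact: Ccoo_shift.
have iF : (lebesgueRn R n).-integrable setT
    (EFin \o (fun y => f y * partial j (fun z => phi (z - x)) y)).
  apply: loc_integrable_Ccoo => //; apply: Ccoo_partial; exact: Ccoo_shift.
rewrite -[RHS]mulN1r -(RintegralZl (-1) measurableT iF).
apply: eq_Rintegral => y _; rewrite partial_shift; last exact: smooth_derivable cphi.1.
by rewrite mulrCA.
Qed.

Lemma mollify_supp f phi r s x : (forall y, f y != 0 -> `|y| <= r) ->
  (forall y, phi y != 0 -> `|y| <= s) -> mollify f phi x != 0 -> `|x| <= r + s.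
Proof.
move=> fr phis; apply: contraNle => xrs; rewrite /mollify.
have -> : \int[leb]_y (f y * phi (y - x)) = \int[leb]_(y in [set: Rn R n]) (cst 0 y).
  apply: eq_Rintegral => y _; apply/eqP; rewrite mulf_eq0; apply/orP.
  have [fy|] := eqVneq (f y) 0; [by left|move/fr => yr].
  right; apply/negPn/negP => /phis yx.
  have : `|x| <= `|y| + `|y - x| by rewrite -{1}(subKr y x) ler_normB.
  lra.
by rewrite Rintegral_cst// mul0r.
Qed.

End convolution.

(** * Construction of the mollifiers *)

Section flat_function.
Context {R : realType}.
Implicit Types (t : R) (m : nat).

(** The function exp (-1 / t), extended by 0 to t <= 0, together with its multiples by t^-m: a
    family whose derivatives are combinations of its members. *)
Definition flat m t : R := if 0 < t then t ^- m * expR (- t^-1) else 0.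

Lemma flat_ge0 m t : 0 <= flat m t.
Proof.
rewrite /flat; case: ifP => // t0.
by rewrite mulr_ge0 ?expR_ge0// invr_ge0 exprn_ge0// ltW.
Qed.

(** From exp (1 / t) >= (1 / t)^(m+2) / (m+2)!. The square makes the derivative at 0 vanish through
    [is_derive_quad]. *)
Lemma flat_le_sqr m t : flat m t <= (m.+2)`!%:R * t ^+ 2.
Proof.
rewrite /flat; case: ifPn => t0; last by rewrite mulr_ge0// sqr_ge0.
have := @expR_ge1Dxn R t^-1 m.+1; rewrite invr_ge0 ltW// => /(_ erefl) h.
have {}h : t^-1 ^+ m.+2 / (m.+2)`!%:R <= expR t^-1.
  by apply: le_trans h; rewrite lerDr.
rewrite expRN ler_pdivrMr ?expR_gt0// -mulrA mulrC -ler_pdivrMr; last first.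
  by rewrite ltr0n fact_gt0.
rewrite mulrC -ler_pdivrMl ?exprn_gt0//; apply: le_trans h.
by rewrite mulrCA [leRHS]mulrC ler_wpM2l ?invr_ge0// -!exprVn -exprD.
Qed.

Lemma is_derive_flat m t : is_derive t 1 (flat m) (flat m.+2 t - m%:R * flat m.+1 t).
Proof.
have [t0|t0|->] := ltgtP t 0.
- have -> : flat m.+2 t - m%:R * flat m.+1 t = 0.
    by rewrite /flat ltNge (ltW t0)/= mulr0 subr0.
  have D0 : is_derive t 1 (cst (0 : R)) (0 : R) by exact: is_derive_cst.
  apply: near_eq_is_derive D0; near=> s; rewrite /flat ltNge ifF//; apply/negbTE; rewrite negbK ltW//.
  by near: s; exact: lt_nbhsl.
- pose k := (fun s : R => s^-1) : R -> R.
  have dk : is_derive t 1 k (- t ^- 2).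
    have := @is_deriveV R id t 1 1 (lt0r_neq0 t0) (is_derive_id _ _).
    by rewrite /GRing.scale/= mulr1.
  apply: (@near_eq_is_derive _ _ _ (k ^+ m * (expR \o (- k)))).
    near=> s; have s0 : 0 < s by near: s; exact: lt_nbhsr.
    by rewrite /flat s0 /k/= -exprVn; congr (_ * _); elim: (m) => [|i]//; rewrite !exprS => <-.
  apply: is_derive_eq; rewrite /flat t0.
  have -> : (k ^+ m) t = t ^- m by rewrite -exprVn; elim: (m) => [|i]//; rewrite !exprS => <-.
  have -> : (expR \o - k) t = expR (- t^-1) by [].
  have -> : (- k) t = - t^-1 by [].
  rewrite /GRing.scale/= opprK /k.
  case: (m) => [|i]; first by rewrite !mul0r !mulr0 addr0 subr0 expr0 invr1 !mul1r mulrC.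
  rewrite /= !exprVn !exprS; field.
  by rewrite expf_neq0 gt_eqF.
- have -> : flat m.+2 0 - m%:R * flat m.+1 0 = 0 by rewrite /flat ltxx mulr0 subr0.
  apply: (@is_derive_quad R R _ _ _ _ (m.+2)`!%:R 1) => // s _.
  rewrite /flat ltxx mulr0 !subr0 addr0 [s *: 1]mulr1 -/(flat m s).
  by rewrite ger0_norm ?flat_ge0//; exact: flat_le_sqr.
Unshelve. all: by end_near. Qed.

Lemma flat0_le1 t : flat 0 t <= 1.
Proof.
rewrite /flat; case: ifP => // t0.
by rewrite expr0 invr1 mul1r expR_le1 oppr_le0 invr_ge0 ltW.
Qed.

Lemma flat0_ge t (s : R) : 0 < s -> s <= t -> expR (- s^-1) <= flat 0 t.
Proof.
move=> s0 st; have t0 : 0 < t := lt_le_trans s0 st.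
by rewrite /flat t0 expr0 invr1 mul1r ler_expR lerN2 lef_pV2.
Qed.

End flat_function.

Section loc_integrable.
Context {R : realType} {n : nat}.

Lemma lebesgueRn_normball_lty r : (lebesgueRn R n (normball r) < +oo)%E.
Proof.
apply: (@le_lt_trans _ _ (box_vol (const_mx (- (r + 1)) : 'rV[R]_n) (const_mx r))); last exact: ltry.
rewrite -lebesgue_outer_box; apply: le_lebesgue_outer => x /= xr i; rewrite !mxE.
have := le_trans (coord_le_norm x i) xr; rewrite ler_norml; lra.
Qed.

Lemma loc_integrable_bounded (f : 'rV[R]_n -> R) (M : R) :
  measurable_fun [set: Rn R n] f -> (forall x, `|f x| <= M) -> loc_integrable f.
Proof.
move=> mf fM; split => // K cK.
have mK := compact_measurable_Rn cK.
have [N [_ HN]] := compact_bounded cK.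
have KN : K `<=` [set x : 'rV[R]_n | `|x| <= `|N| + 1].
  by move=> x Kx; apply: HN => //; rewrite (le_lt_trans (ler_norm _))// ltrDl.
apply: (@le_lt_trans _ _ (\int[lebesgueRn R n]_(x in (K : set (Rn R n))) M%:E)%E).
  apply: ge0_le_integral => //.
  - apply/measurable_EFinP; apply: measurableT_comp; first exact: normr_measurable.
    exact: measurable_funS mf.
  - by move=> x _; rewrite lee_fin.
rewrite integral_cst//.
have KB : (lebesgueRn R n K <= lebesgueRn R n (normball (`|N| + 1)))%E by exact: le_lebesgue_outer.
have Klt := le_lt_trans KB (lebesgueRn_normball_lty (`|N| + 1)).
by rewrite lte_mul_pinfty// lee_fin (le_trans (normr_ge0 (f 0))).
Qed.

Lemma integrable_Ccoo (phi : 'rV[R]_n -> R) : Ccoo phi ->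
  (lebesgueRn R n).-integrable setT (EFin \o phi).
Proof.
move=> cphi; have l1 : loc_integrable (fun _ : 'rV[R]_n => 1 : R).
  apply: (loc_integrable_bounded (M := 1)); first exact: measurable_cst.
  by move=> x; rewrite normr1.
have := loc_integrable_Ccoo l1 cphi.
by congr (_.-integrable _ _); apply/funext => x /=; rewrite mul1r.
Qed.

Lemma Ccoo_loc_integrable (phi : 'rV[R]_n -> R) : Ccoo phi -> loc_integrable phi.
Proof.
move=> cphi; have [M _ phiM] := Ccoo_bounded cphi.
by apply: (loc_integrable_bounded _ phiM); exact: smooth_measurable cphi.1.
Qed.

End loc_integrable.

Section mollifier.
Context {R : realType} {n : nat}.
Local Notation e_ j := (delta_mx 0 j : 'rV[R]_n).

Lemma is_derive_coord (u : R -> R) (a b du : R) (i j : 'I_n) (x : 'rV[R]_n) :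
  is_derive (a * x 0 i + b) 1 u du ->
  is_derive x (e_ j) (fun y => u (a * y 0 i + b)) ((i == j)%:R * a * du).
Proof.
move=> dudu.
have d1 : is_derive (x 0 i) 1 (u \o (fun s : R => a * s + b)) (du * a).
  apply: is_derive1_comp.
  have := @is_deriveD R R R _ _ (x 0 i) 1 _ _
    (@is_deriveZ R R R id a (x 0 i) 1 1 (is_derive_id _ _)) (is_derive_cst b (x 0 i) 1).
  by rewrite addr0 [a *: 1]mulr1.
have [<-|ij] := eqVneq i j.
  rewrite mul1r mulrC.
  have [d <-] := d1.
  have E : (fun h : R => h^-1 *: (((fun y : 'rV[R]_n => u (a * y 0 i + b)) \o shift x) (h *: e_ i) - u (a * x 0 i + b)))
   = (fun h : R => h^-1 *: (((u \o (fun s : R => a * s + b)) \o shift (x 0 i)) (h *: (1 : R)) - (u \o (fun s : R => a * s + b)) (x 0 i))).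
    by apply/funext => h /=; rewrite !mxE !eqxx.
  by split; rewrite /derivable /derive E.
rewrite !mul0r.
have E : (fun h : R => h^-1 *: (((fun y : 'rV[R]_n => u (a * y 0 i + b)) \o shift x) (h *: e_ j) - u (a * x 0 i + b)))
   = (fun=> 0).
  by apply/funext => h /=; rewrite !mxE eqxx (negbTE ij) mulr0 add0r subrr scaler0.
split; rewrite /derivable /derive E; first exact: is_cvg_cst.
exact: lim_cst.
Qed.

Lemma smooth_flat (a b : R) (i : 'I_n) m :
  smooth (fun x : 'rV[R]_n => flat m (a * x 0 i + b)).
Proof.
have cont k : continuous (fun x : 'rV[R]_n => flat k (a * x 0 i + b)).
  move=> x; apply: (@continuous_comp 'rV[R]_n R R (fun x : 'rV[R]_n => a * x 0 i + b) (flat k)).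
    apply: (@continuousD _ _ _ (fun x : 'rV[R]_n => a * x 0 i) (cst b)); last exact: cst_continuous.
    apply: (@continuousM _ _ (cst a) (fun x : 'rV[R]_n => x 0 i)); first exact: cst_continuous.
    exact: coord_continuous.
  apply/differentiable_continuous/derivable1_diffP.
  by have [] := is_derive_flat k (a * x 0 i + b).
apply/smoothP => k; elim: k m => [|k IH] m; split => //; try exact: cont.
move=> j; split=> [x|].
  by have [] := is_derive_coord j (is_derive_flat m (a * x 0 i + b)).
have -> : partial j (fun x : 'rV[R]_n => flat m (a * x 0 i + b)) =
  (fun x : 'rV[R]_n => (i == j)%:R * a *
     (flat m.+2 (a * x 0 i + b) + - m%:R * flat m.+1 (a * x 0 i + b))).
  apply/funext => x; rewrite mulNr.
  by have /@derive_val := is_derive_coord j (is_derive_flat m (a * x 0 i + b)).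
apply: Ck_mul; first exact: Ck_cst.
apply: Ck_add => //; apply: Ck_mul => //; exact: Ck_cst.
Qed.

(** The support lies on one side of 0 and the height is at most C / e^n with C meant to be
    independent of e, so that mollifying is bounded by averaging over a cube of side comparable to
    e. *)
Definition mollifier (C e : R) (phi : 'rV[R]_n -> R) :=
  [/\ Ccoo phi, forall y, 0 <= phi y,
      forall y, phi y != 0 -> forall i, - e <= y 0 i <= 0,
      \int[leb]_y phi y = 1
    & forall y, phi y <= C / e ^+ n].

(** A product of flat functions is positive on the open cube (-e, 0)^n, is at most 1, and is at
    least [c] on the middle cube of side e / 2. Dividing by its integral, which is at least c (e /
    2)^n, gives the height 2^n / c / e^n. *)
Lemma mollifier_exists : exists2 C : R, 0 < C &
  forall e, 0 < e -> exists phi, mollifier C e phi.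
Proof.
(* On the middle cube both arguments of [flat 0] are at least 1 / 4, where its value is at least exp
   (-4). *)
pose c : R := (expR (- 4) * expR (- 4)) ^+ n.
have c0 : 0 < c by rewrite exprn_gt0// mulr_gt0// expR_gt0.
exists (2 ^+ n / c); first by rewrite divr_gt0// exprn_gt0.
move=> e e0.
pose psi (y : 'rV[R]_n) := \prod_i (flat 0 (- e^-1 * y 0 i + 0) * flat 0 (e^-1 * y 0 i + 1)).
have spsi : smooth psi.
  apply: (@smooth_prod _ _ _ (index_enum 'I_n)) => i; apply: smoothM; exact: smooth_flat.
have psi0 y : 0 <= psi y by apply: prodr_ge0 => i _; rewrite mulr_ge0 ?flat_ge0.
have psisupp y : psi y != 0 -> forall i, - e <= y 0 i <= 0.
  move=> /prodf_neq0 H i; have := H i isT; rewrite mulf_eq0 negb_or /flat addr0.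
  have e1 : 0 < e^-1 by rewrite invr_gt0.
  case: ifPn; last by rewrite eqxx.
  rewrite mulNr oppr_gt0 pmulr_rlt0// => y0; case: ifPn; last by rewrite eqxx andbF.
  have ee : e^-1 * e = 1 by rewrite mulVf// gt_eqF.
  by move=> ye _; apply/andP; split; nra.
have cpsi : Ccoo psi.
  apply: (@Ccoo_ball _ _ _ e) => // y /psisupp ye.
  apply: norm_le_coord; first exact: ltW.
  by move=> i; have := ye i; rewrite ler_norml => /andP[]; lra.
have mpsi := smooth_measurable spsi.
pose B := box (const_mx (- (3 * e / 4)) : 'rV[R]_n) (const_mx (- (e / 4))).
have psiB y : B y -> c <= psi y.
  move=> By; rewrite /c -[X in _ ^+ X](card_ord n) -prodr_const.
  have q4 : (4 : R) = (4^-1)^-1 by rewrite invrK.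
  apply: ler_prod => i _; rewrite mulr_ge0 ?expR_ge0//=.
  have := By i; rewrite !mxE => /andP[y1 y2].
  have ee : e^-1 * e = 1 by rewrite mulVf// gt_eqF.
  have e1 : 0 < e^-1 by rewrite invr_gt0.
  rewrite ler_pM ?expR_ge0// q4 flat0_ge ?invr_gt0//.
    by rewrite addr0; nra.
  by nra.
have ipsi := integrable_Ccoo cpsi.
have Blow : c * (e / 2) ^+ n <= \int[leb]_y psi y.
  rewrite -lee_fin /Rintegral fineK; last by apply: integrable_fin_num.
  have mB : measurable (B : set (Rn R n)) by exact: measurable_box.
  apply: (@le_trans _ _ (\int[lebesgueRn R n]_(y in B) c%:E)%E).
    have BE : lebesgueRn R n B = box_vol (const_mx (- (3 * e / 4))) (const_mx (- (e / 4))) := lebesgue_outer_box _ _.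
    have -> : (\int[lebesgueRn R n]_(y in B) c%:E = c%:E * box_vol (const_mx (- (3 * e / 4))%R) (const_mx (- (e / 4))%R : 'rV[R]_n))%E.
      by rewrite -BE; exact: integral_cst.
    rewrite -EFinM lee_fin ler_wpM2l//.
      exact: ltW.
    rewrite -[X in _ ^+ X](card_ord n) -prodr_const.
    apply: ler_prod => i _; rewrite !mxE; apply/andP; split; first by lra.
    by rewrite /Num.max; case: ifPn; lra.
  apply: (@le_trans _ _ (\int[lebesgueRn R n]_(y in B) (psi y)%:E)%E).
    apply: ge0_le_integral => //.
    - by move=> y _; rewrite lee_fin ltW.
    - by apply/measurable_EFinP; exact: measurable_funS mpsi.
  apply: ge0_subset_integral => //.
  - exact/measurable_EFinP.
  - by move=> y _; rewrite lee_fin.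
have I0 : 0 < \int[leb]_y psi y.
  by apply: lt_le_trans Blow; rewrite mulr_gt0// exprn_gt0// divr_gt0.
exists (fun y => (\int[leb]_y psi y)^-1 * psi y); split.
- by apply: CcooM => //; exact: smooth_cst.
- by move=> y; rewrite mulr_ge0// invr_ge0 ltW.
- by move=> y; rewrite mulf_eq0 negb_or => /andP[_]; exact: psisupp.
- by rewrite (RintegralZl _ measurableT ipsi) mulVf// gt_eqF.
- move=> y.
  apply: (@le_trans _ _ (\int[leb]_y psi y)^-1).
    have p1 : psi y <= 1.
      apply: prodr_ile1 => i _; rewrite mulr_ge0 ?flat_ge0//= -[leRHS]mulr1.
      by rewrite ler_pM ?flat_ge0 ?flat0_le1.
    by rewrite ler_piMr// invr_ge0 ltW.
  have -> : 2 ^+ n / c / e ^+ n = (c * (e / 2) ^+ n)^-1.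
    rewrite expr_div_n; field.
    by rewrite !expf_neq0 ?gt_eqF.
  by rewrite lef_pV2// posrE// mulr_gt0// exprn_gt0// divr_gt0.
Qed.

End mollifier.

Lemma cvge0_near_le (R : realType) (u : nat -> \bar R) (e : R) :
  u k @[k --> \oo] --> 0%E -> 0 < e -> \forall k \near \oo, (u k <= e%:E)%E.
Proof.
move=> u0 e0; have : \forall k \near \oo, (u k < e%:E)%E.
  by apply: (u0 [set x | (x < e%:E)%E]); apply: open_ereal_lt'; rewrite lte_fin.
by apply: filterS => k /ltW.
Qed.

(** * Integrals of variable powers *)

Section nonneg_integral.
Context d (T : measurableType d) (R : realType) (mu : {measure set T -> \bar R}).
Local Open Scope ereal_scope.

(* No measurability is needed: the integral of a nonnegative function is a
   supremum over the simple functions below it. *)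
Lemma ge0_le_integral_lower (D : set T) (f g : T -> \bar R) :
  (forall x, D x -> 0 <= f x) -> (forall x, D x -> f x <= g x) ->
  \int[mu]_(x in D) f x <= \int[mu]_(x in D) g x.
Proof.
move=> f0 fg; rewrite ge0_integralE// ge0_integralE//; last first.
  by move=> x Dx; exact: le_trans (f0 _ Dx) (fg _ Dx).
apply: ge_ereal_sup => _ [h hf <-].
apply: ereal_sup_ubound; exists h => // x; apply: (le_trans (hf x)).
by rewrite /patch; case: ifPn => // /set_mem /fg.
Qed.

End nonneg_integral.

Section integral_EFin.
Context d (T : measurableType d) (R : realType) (mu : {measure set T -> \bar R}).
Implicit Types (f g : T -> R) (D : set T).
Local Open Scope ereal_scope.

Lemma measurable_EFinW D f : measurable_fun setT f ->
  measurable_fun D (fun x => (f x)%:E).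
Proof. by move=> mf; apply/measurable_EFinP; exact: measurable_funS mf. Qed.

Lemma measurable_normf f : measurable_fun setT f ->
  measurable_fun setT (fun x => `|f x|%R).
Proof. by move=> mf; apply: measurableT_comp => //; exact: normr_measurable. Qed.

Lemma integral_EFinZl D (c : R) f : measurable D -> (0 <= c)%R ->
  measurable_fun setT f -> (forall x, 0 <= f x)%R ->
  \int[mu]_(x in D) (c * f x)%:E = c%:E * \int[mu]_(x in D) (f x)%:E.
Proof.
move=> mD c0 mf f0; under eq_integral do rewrite EFinM.
rewrite ge0_integralZl//; first exact: measurable_EFinW.
by move=> x _; rewrite lee_fin.
Qed.

Lemma integral_EFinD D f g : measurable D ->
  measurable_fun setT f -> measurable_fun setT g -> (forall x, 0 <= f x)%R ->
  (forall x, 0 <= g x)%R ->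
  \int[mu]_(x in D) (f x + g x)%:E =
  \int[mu]_(x in D) (f x)%:E + \int[mu]_(x in D) (g x)%:E.
Proof.
move=> mD mf mg f0 g0; under eq_integral do rewrite EFinD.
rewrite ge0_integralD//; first [by move=> x _; rewrite lee_fin|exact: measurable_EFinW].
Qed.

Lemma ae_le_integral_EFin D f g : measurable D ->
  measurable_fun setT f -> measurable_fun setT g -> (forall x, 0 <= f x)%R ->
  (forall x, 0 <= g x)%R -> {ae mu, forall x, D x -> (f x <= g x)%R} ->
  \int[mu]_(x in D) (f x)%:E <= \int[mu]_(x in D) (g x)%:E.
Proof.
move=> mD mf mg f0 g0 fg; apply: ae_ge0_le_integral => //.
- by move=> x _; rewrite lee_fin.
- exact: measurable_EFinW.
- by move=> x _; rewrite lee_fin.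
- exact: measurable_EFinW.
Qed.

Lemma le_integral_EFin D f g : (forall x, D x -> 0 <= f x)%R ->
  (forall x, D x -> f x <= g x)%R ->
  \int[mu]_(x in D) (f x)%:E <= \int[mu]_(x in D) (g x)%:E.
Proof.
by move=> f0 fg; apply: ge0_le_integral_lower => x Dx; rewrite lee_fin ?f0// fg.
Qed.

Lemma subset_integral_EFin D D' f : measurable D -> measurable D' -> D `<=` D' ->
  measurable_fun setT f -> (forall x, 0 <= f x)%R ->
  \int[mu]_(x in D) (f x)%:E <= \int[mu]_(x in D') (f x)%:E.
Proof.
move=> mD mD' DD' mf f0; apply: ge0_subset_integral => //; first exact: measurable_EFinW.
by move=> x _; rewrite lee_fin.
Qed.

Lemma integral_EFin_ge0 D f : (forall x, 0 <= f x)%R ->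
  0 <= \int[mu]_(x in D) (f x)%:E.
Proof. by move=> f0; apply: integral_ge0 => x _; rewrite lee_fin. Qed.

End integral_EFin.

Section powers.
Context {R : realType}.
Implicit Types (a b c q P : R).

Lemma powR_le_powC a q P : 1 <= q -> q <= P -> 0 <= a -> forall c, 1 <= c ->
  (c * a) `^ q <= c `^ P * a `^ q.
Proof.
move=> q1 qP a0 c c1.
rewrite powRM//; last by rewrite (le_trans _ c1).
by rewrite ler_wpM2r ?powR_ge0// ler_powR.
Qed.

(** The sum is at most three times its largest term; the constant depends on the upper bound P only,
    not on the exponent at the point. *)
Lemma powR_add3 a b c q P : 1 <= q -> q <= P -> 0 <= a -> 0 <= b -> 0 <= c ->
  (a + b + c) `^ q <= 3 `^ P * (a `^ q + b `^ q + c `^ q).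
Proof.
move=> q1 qP a0 b0 c0.
have q0 : 0 <= q by lra.
have key m : 0 <= m -> a + b + c <= 3 * m -> m `^ q <= a `^ q + b `^ q + c `^ q ->
    (a + b + c) `^ q <= 3 `^ P * (a `^ q + b `^ q + c `^ q).
  move=> m0 abc mle; apply: (@le_trans _ _ ((3 * m) `^ q)).
    by apply: ge0_ler_powR => //; rewrite nnegrE ?mulr_ge0// !addr_ge0.
  apply: (le_trans (powR_le_powC q1 qP m0 _)); first by lra.
  by rewrite ler_wpM2l ?powR_ge0.
have := powR_ge0 a q; have := powR_ge0 b q; have := powR_ge0 c q => ? ? ?.
have [ab|ab] := leP a b; have [bc|bc] := leP b c; have [ac|ac] := leP a c.
all: (try by apply: (key a) => //; lra);
  (try by apply: (key b) => //; lra); (try by apply: (key c) => //; lra).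
Qed.

Lemma powR_add2 a b q P : 1 <= q -> q <= P -> 0 <= a -> 0 <= b ->
  (a + b) `^ q <= 3 `^ P * (a `^ q + b `^ q).
Proof.
move=> q1 qP a0 b0; have := powR_add3 q1 qP a0 b0 (lexx 0).
by rewrite addr0 powR0 ?addr0//; apply: lt0r_neq0; lra.
Qed.

(* [q / (q - 1)] is the Hoelder conjugate of [q]; the factors [1 / q] are dropped. *)
Lemma young_le a b q : 1 < q -> 0 <= a -> 0 <= b ->
  a * b <= a `^ q + b `^ (q / (q - 1)).
Proof.
move=> q1 a0 b0.
have q0 : 0 < q by lra.
have q10 : 0 < q - 1 by lra.
have e1 : q^-1 + (q / (q - 1))^-1 = 1 by field; rewrite !gt_eqF.
have := conjugate_powR a0 b0 q0 (divr_gt0 q0 q10) e1.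
move=> /le_trans; apply; apply: lerD.
  by rewrite ler_pdivrMr// ler_peMr ?powR_ge0// ltW.
rewrite ler_pdivrMr ?divr_gt0// ler_peMr ?powR_ge0//.
by rewrite ler_pdivlMr//; lra.
Qed.

End powers.

Section measurability.
Context d (T : measurableType d) (R : realType).
Implicit Types (f g : T -> R).

Lemma measurable_powR2 f g : measurable_fun setT f ->
  measurable_fun setT g -> measurable_fun setT (fun x => f x `^ g x).
Proof.
move=> mf mg; rewrite /powR.
apply: measurable_fun_ifT => //=.
- by apply: measurable_fun_eqr => //; exact: measurable_cst.
- have -> : (fun x => (g x == 0)%:R : R) = (fun x => if g x == 0 then 1 else 0).
    by apply/funext => x; case: eqP.
  apply: measurable_fun_ifT => //.
  by apply: measurable_fun_eqr => //; exact: measurable_cst.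
apply: measurableT_comp => //; apply: measurable_funM => //.
exact: measurableT_comp.
Qed.

End measurability.

Section bounded_convergence.
Context d (T : measurableType d) (R : realType) (mu : {measure set T -> \bar R}).
Local Open Scope ereal_scope.

(* Convergence in [L^1] of a bounded sequence gives convergence of the powers
   against any integrable weight: cut the weight at a large height. *)
Lemma integral_pow_weight_small (w : T -> R) (q : T -> R) (P M : R) (B : set T) :
  measurable B -> mu B < +oo -> measurable_fun setT w -> (forall x, 0 <= w x)%R ->
  \int[mu]_(x in B) (w x)%:E < +oo -> measurable_fun setT q ->
  (forall x, 1 <= q x <= P)%R -> (1 <= M)%R ->
  forall e : R, (0 < e)%R -> exists2 t : R, (0 < t)%R &
  forall u : T -> R, measurable_fun setT u -> (forall x, 0 <= u x <= M)%R ->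
    \int[mu]_(x in B) (u x)%:E <= t%:E ->
    \int[mu]_(x in B) (w x * (u x) `^ (q x))%:E <= e%:E.
Proof.
move=> mB muB mw w0 wB mq qP M1 e e0.
have mwB : measurable_fun B w by exact: measurable_funS mw.
have iw : mu.-integrable B (EFin \o w).
  apply/integrableP; split; first exact/measurable_EFinP.
  by under eq_integral do rewrite gee0_abs ?lee_fin//.
pose tail k x := if (k%:R < w x)%R then w x else 0%R.
have mtail k : measurable_fun setT (tail k).
  apply: measurable_fun_ifT => //.
  by apply: measurable_fun_ltr => //; exact: measurable_cst.
have cv : \int[mu]_(x in B) (tail k x)%:E @[k --> \oo] --> \int[mu]_(x in B) (cst 0 x).
  apply: (@dominated_cvg _ _ _ mu B mB (fun k x => (tail k x)%:E) (cst 0) (EFin \o w)) => //.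
  - by move=> k; apply/measurable_EFinP; exact: measurable_funS (mtail k).
  - move=> x Bx; apply: cvg_near_cst; near=> k.
    rewrite /tail ltNge (_ : (w x <= k%:R)%R)//.
    by near: k; exact: nbhs_infty_ger.
  - move=> k x _; rewrite /tail/=; case: ifP => _; rewrite ?normr0 ?lee_fin//.
    by rewrite ger0_norm.
rewrite integral0 in cv.
have MP0 : (0 < M `^ P)%R by apply: powR_gt0; exact: lt_le_trans M1.
have [k tk] : exists k, \int[mu]_(x in B) (tail k x)%:E <= (e / 2 / M `^ P)%:E.
  have e20 : (0 < e / 2 / M `^ P)%R by rewrite !divr_gt0.
  have [k _ /(_ k (leqnn k)) H] := cvge0_near_le cv e20.
  by exists k.
(* The tolerance that makes the second term of the pointwise bound below contribute e / 2; the tail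
   of the weight contributes the other half. *)
pose t := (e / 2 / (k%:R + 1) / M `^ P)%R.
exists t; first by rewrite /t !divr_gt0// ltr_wpDl.
move=> u mu' u0M ut.
(* Where the weight exceeds k, the power is at most M^P. Elsewhere u^q <= M^P u, since q >= 1 and u
   <= M, and the weight is at most k. *)
have le1 x : (w x * u x `^ q x <= M `^ P * tail k x + (k%:R + 1) * M `^ P * u x)%R.
  have /andP[u0 uM] := u0M x; have /andP[q1 qx] := qP x.
  have uq : (u x `^ q x <= M `^ P)%R.
    apply: (@le_trans _ _ (M `^ q x)%R); last by rewrite ler_powR.
    by apply: ge0_ler_powR => //; rewrite ?nnegrE//; lra.
  rewrite /tail; case: ltP => kw.
    rewrite mulrC (@le_trans _ _ (M `^ P * w x)%R)// ?ler_wpM2r//.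
    by rewrite lerDl !mulr_ge0 ?addr_ge0// ltW.
  rewrite mulr0 add0r.
  have uu : (u x `^ q x <= M `^ P * u x)%R.
    have [->|un0] := eqVneq (u x) 0%R.
      by rewrite powR0 ?mulr0//; apply: lt0r_neq0; lra.
    have ug0 : (0 < u x)%R by rewrite lt_neqAle eq_sym un0.
    have -> : q x = (1 + (q x - 1))%R by lra.
    rewrite powRD ?un0 ?implybT// powRr1// mulrC ler_wpM2r//.
    apply: (@le_trans _ _ (M `^ (q x - 1))%R); last by rewrite ler_powR//; lra.
    by apply: ge0_ler_powR => //; rewrite ?nnegrE//; lra.
  rewrite -mulrA ler_pM ?powR_ge0//.
  by rewrite (le_trans kw)// lerDl.
have mU : measurable_fun B (fun x => (u x)%:E).
  by apply/measurable_EFinP; exact: measurable_funS mu'.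
have mT : measurable_fun B (fun x => (tail k x)%:E).
  by apply/measurable_EFinP; exact: measurable_funS (mtail k).
apply: (@le_trans _ _ (\int[mu]_(x in B)
    ((M `^ P)%:E * (tail k x)%:E + ((k%:R + 1) * M `^ P)%:E * (u x)%:E))).
  apply: ge0_le_integral_lower => x Bx; rewrite -?EFinM -?EFinD lee_fin //.
  by rewrite mulr_ge0// powR_ge0.
have tail0 x : (0 <= tail k x)%R by rewrite /tail; case: ifP.
have k0 : (0 <= (k%:R + 1) * M `^ P :> R)%R by rewrite mulr_ge0 ?addr_ge0// ltW.
rewrite ge0_integralD//; last 4 first.
- by move=> x _; rewrite -EFinM lee_fin mulr_ge0// ltW.
- exact: measurable_funeM.
- by move=> x _; rewrite -EFinM lee_fin mulr_ge0//; have /andP[] := u0M x.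
- exact: measurable_funeM.
rewrite ge0_integralZl//; last 2 first.
- by move=> x _; rewrite lee_fin.
- by rewrite lee_fin ltW.
rewrite ge0_integralZl//; last by move=> x _; rewrite lee_fin; have /andP[] := u0M x.
have -> : e%:E = (M `^ P)%:E * (e / 2 / M `^ P)%:E + ((k%:R + 1) * M `^ P)%:E * t%:E.
  rewrite -!EFinM -EFinD; congr EFin; rewrite /t; field.
  by rewrite gt_eqF//= lt0r_neq0// ltr_wpDl.
by apply: leeD; apply: lee_wpmul2l => //; rewrite lee_fin // ltW.
Unshelve. all: by end_near. Qed.

End bounded_convergence.

Lemma ge0_natmul_ereal (R : realType) (y : \bar R) m :
  (0 <= y)%E -> (y *+ m)%R = (m%:R%:E * y)%E.
Proof.
move=> y0; elim: m => [|m IH]; first by rewrite mulr0n mul0e.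
by rewrite mulrSr IH -natr1 EFinD ge0_muleDl ?lee_fin// mul1e.
Qed.

(** * Weak derivatives *)

Section cover.
Context d (T : measurableType d) (R : realType) (mu : {measure set T -> \bar R}).
Context (I : finType) (A B : I -> set T) (D : set T).
Local Open Scope ereal_scope.

(** Adding the local inequalities over the A k counts each point of the right-hand integral as often
    as it lies in some B k, hence at most N times. *)
Lemma cover_integral (g h : T -> \bar R) (c : R) (N M : nat) :
  (forall k, measurable (A k)) -> (forall k, measurable (B k)) -> measurable D ->
  (forall x, D x -> exists k, A k x) ->
  (forall x, (#|[pred k | `[< B k x >]]| <= N)%N) ->
  #|I| = M ->
  measurable_fun setT g -> measurable_fun setT h ->
  (forall x, 0 <= g x) -> (forall x, 0 <= h x) ->
  (forall k, \int[mu]_(x in A k) g x <= \int[mu]_(x in B k) h x + c%:E) ->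
  \int[mu]_(x in D) g x <= N%:R%:E * \int[mu]_x h x + (M%:R * c)%:E.
Proof.
move=> mA mB mD cov cardB cI mg mh g0 h0 H.
apply: (@le_trans _ _ (\sum_k \int[mu]_(x in A k) g x)).
  under eq_bigr do rewrite integral_mkcond.
  rewrite -ge0_integral_sum//; last 2 first.
  - by move=> k; apply/(measurable_restrict _ (mA k) measurableT) => //; rewrite setTI; exact: measurable_funS mg.
  - by move=> k x _; rewrite /patch; case: ifP.
  rewrite [leLHS]integral_mkcond; apply: ge0_le_integral_lower => x _.
    by rewrite /patch; case: ifP.
  rewrite {1}/patch; case: ifPn => [/set_mem/cov[k xk]|_].
    rewrite (bigD1 k)//= {1}/patch mem_set// leeDl//.
    by apply: sume_ge0 => j _; rewrite /patch; case: ifP.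
  by apply: sume_ge0 => j _; rewrite /patch; case: ifP.
apply: (@le_trans _ _ (\sum_k (\int[mu]_(x in B k) h x + c%:E))).
  by apply: lee_sum => k _; exact: H.
rewrite big_split/=; apply: leeD; last first.
  rewrite sumEFin lee_fin sumr_const cI.
  by rewrite -[leLHS]mulr_natl.
under eq_bigr do rewrite integral_mkcond.
rewrite -ge0_integral_sum//; last 2 first.
- by move=> k; apply/(measurable_restrict _ (mB k) measurableT) => //; rewrite setTI; exact: measurable_funS mh.
- by move=> k x _; rewrite /patch; case: ifP.
rewrite -ge0_integralZl//.
apply: ge0_le_integral_lower => x _.
  by apply: sume_ge0 => k _; rewrite /patch; case: ifP.
have -> : \sum_k (h \_ (B k)) x = \sum_(k | `[< B k x >]) h x.
  rewrite [RHS]big_mkcond; apply: eq_bigr => k _.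
  by rewrite /patch; case: asboolP => Bx; [rewrite mem_set|rewrite memNset].
rewrite sumr_const ge0_natmul_ereal// lee_wpmul2r// lee_fin ler_nat.
exact: cardB.
Qed.

End cover.

Section grid.
Context {R : realType} {n : nat}.
Implicit Types (a e t : R) (M : nat).

Lemma card_near M t :
  (#|[pred j : 'I_M | (t - 1 <= (j : nat)%:R <= t + 1)%R]| <= 3)%N.
Proof.
set S := [pred j : 'I_M | _].
have [->//|] := posnP #|S|.
move=> /card_gt0P[j0 Sj0].
(* All indices lie within 2 of the smallest one m, hence among m, m + 1, m + 2. *)
case: (arg_minnP (fun j : 'I_M => j : nat) Sj0) => m Sm minm.
rewrite cardE -(size_map val) -(size_iota m 3).
apply: uniq_leq_size.
  by rewrite map_inj_uniq ?enum_uniq//; exact: val_inj.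
move=> _ /mapP[j + ->]; rewrite mem_enum => Sj.
rewrite mem_iota (minm _ Sj)/= addn3 ltnS -(ler_nat R) -!natr1.
have {}Sm : m \in S by [].
by move: Sj Sm; rewrite !inE => /andP[? ?] /andP[? ?]; lra.
Qed.

Definition cell a e {M} (k : {ffun 'I_n -> 'I_M}) : set (Rn R n) :=
  box (\row_i (a + e * (k i : nat)%:R)) (\row_i (a + e * (k i : nat)%:R + e)).

(** The cell enlarged by e towards its lower corner, the direction in which the kernels reach. It is
    a closed cube, as in the A_p condition, whereas the cells are half-open boxes. *)
Definition cell2 a e {M} (k : {ffun 'I_n -> 'I_M}) : set (Rn R n) :=
  cube (\row_i (a + e * (k i : nat)%:R - e)) (2 * e).

(** In each coordinate the index is within 1 of (y_i - a) / e, and a closed interval of length 2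
    contains at most three integers. *)
Lemma card_cell2 a e M (y : 'rV[R]_n) : 0 < e ->
  (#|[pred k : {ffun 'I_n -> 'I_M} | `[< cell2 a e k y >]]| <= 3 ^ n)%N.
Proof.
move=> e0.
pose F (i : 'I_n) := [pred j : 'I_M | ((y 0 i - a) / e - 1 <= (j : nat)%:R <= (y 0 i - a) / e + 1)%R].
apply: (@leq_trans #|family F|).
  apply: subset_leq_card; apply/fintype.subsetP => k; rewrite !inE => ky.
  apply/familyP => i; rewrite inE; have := ky i; rewrite !mxE => ky'.
  have -> : (y 0 i - a) / e - 1 = (y 0 i - a - e) / e.
    by field; rewrite gt_eqF.
  have -> : (y 0 i - a) / e + 1 = (y 0 i - a + e) / e.
    by field; rewrite gt_eqF.
  by rewrite ler_pdivrMr// ler_pdivlMr//; lra.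
rewrite card_family.
have -> : (3 ^ n = foldr muln 1 [seq 3 | i : 'I_n])%N.
  rewrite foldrE big_map big_enum/= prod_nat_const card_ord.
  by [].
rewrite /image_mem; elim: (enum _) => //= i s IH.
by apply: leq_mul => //; exact: card_near.
Qed.

Lemma cell_cover a e M (x : 'rV[R]_n) : 0 < e ->
  box (const_mx a) (const_mx (a + e * M%:R)) x ->
  exists k : {ffun 'I_n -> 'I_M}, cell a e k x.
Proof.
move=> e0 xab.
have step m t : a < t <= a + e * m%:R ->
    exists2 j, (j < m)%N & a + e * j%:R < t <= a + e * j%:R + e.
  elim: m => [|m IH]; first by rewrite mulr0 addr0 => /andP[? ?]; lra.
  have [tm /andP[t0 _]|tm /andP[_]] := leP t (a + e * m%:R).
    by have [|j jm ?] := IH; [rewrite t0|exists j => //; exact: ltnW].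
  by rewrite -natr1 => ?; exists m => //; rewrite tm/=; lra.
have /choice[k Hk] : forall i : 'I_n, exists j : 'I_M,
    a + e * (j : nat)%:R < x 0 i <= a + e * (j : nat)%:R + e.
  move=> i; have := xab i; rewrite !mxE => /step[j jM ?].
  by exists (Ordinal jM).
by exists [ffun i => k i] => i; rewrite !mxE ffunE.
Qed.

Local Open Scope ereal_scope.

Lemma grid_integral a e M (g h : Rn R n -> \bar R) (c : R) : (0 < e)%R ->
  measurable_fun setT g -> measurable_fun setT h ->
  (forall x, 0 <= g x) -> (forall x, 0 <= h x) ->
  (forall k : {ffun 'I_n -> 'I_M},
    \int[leb]_(x in cell a e k) g x <= \int[leb]_(x in cell2 a e k) h x + c%:E) ->
  \int[leb]_(x in box (const_mx a) (const_mx (a + e * M%:R)%R) : set (Rn R n)) g x <=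
  (3 ^ n)%:R%:E * \int[leb]_x h x + ((M ^ n)%:R * c)%:E.
Proof.
move=> e0 mg mh g0 h0 H.
move: H; apply: (@cover_integral _ _ _ (lebesgueRn R n) {ffun 'I_n -> 'I_M} (cell a e) (cell2 a e)) => //.
- by move=> k; exact: measurable_box.
- by move=> k; exact: measurable_cube.
- by exact: measurable_box.
- by move=> x; exact: cell_cover.
- by move=> x; exact: card_cell2.
- by rewrite card_ffun !card_ord.
Qed.

End grid.

(** * Weak derivatives of test functions and of products *)

Section Ccoo_weak_derivative.
Context {R : realType} {n : nat}.
Implicit Types (f g phi w : 'rV[R]_n -> R).

(** By translation invariance the integral of phi (x + t e_j) - phi (x) is 0. Taylor's formula then
    bounds t times the integral of the derivative by a multiple of t^2, and t tends to 0. *)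
Lemma Rintegral_partial j phi : Ccoo phi -> \int[leb]_x partial j phi x = 0.
Proof.
move=> cphi.
have [r r0 phir] := Ccoo_supp cphi.
have [M M0 phiM] := Ccoo_partial_bound (Ccoo_partial j cphi).
set e_j := delta_mx 0 j : 'rV[R]_n.
have l1 : loc_integrable (fun _ : 'rV[R]_n => 1 : R).
  apply: (loc_integrable_bounded (M := 1)); first exact: measurable_cst.
  by move=> x; rewrite normr1.
pose V := fine (\int[leb]_(x in @normball R n (r + `|e_j|)) `|1 : R|%:E)%E.
have mphi := smooth_measurable cphi.1.
have iphi := integrable_Ccoo cphi.
have key t : `|t| <= 1 -> `|t * \int[leb]_x partial j phi x| <= M * t ^+ 2 * V.
  move=> t1.
  have cs := Ccoo_shift (t *: e_j) cphi.
  have cp := Ccoo_partial j cphi.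
  have E : \int[leb]_x phi (x + t *: e_j) = \int[leb]_x phi x.
    exact: Rintegral_shift.
  have ip := integrable_Ccoo cp.
  have is_ := integrable_Ccoo cs.
  have itp : (lebesgueRn R n).-integrable setT (EFin \o (fun x => t * partial j phi x)).
    by have := integrableZl measurableT t ip.
  have E2 : - (t * \int[leb]_x partial j phi x) =
      \int[leb]_x (1 * (phi (x + t *: e_j) - phi x - t * partial j phi x)).
    under [RHS]eq_Rintegral do rewrite mul1r.
    have isub : (lebesgueRn R n).-integrable setT
        (EFin \o (fun x => phi (x + t *: e_j) - phi x)).
      by have := integrableB measurableT is_ iphi.
    rewrite (RintegralB measurableT isub itp).
    rewrite (RintegralB measurableT is_ iphi) E subrr sub0r.
    by rewrite (RintegralZl t measurableT ip).
  rewrite -normrN E2; apply: (loc_integrable_mul_le l1).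
  - apply: measurable_funB; first by apply: measurable_funB; [exact: smooth_measurable cs.1|].
    by apply: measurable_funM; [exact: measurable_cst|exact: smooth_measurable cp.1].
  - move=> x; rewrite [x + _]addrC; apply: taylor2 => //.
    - by move=> i z; exact: smooth_derivable cphi.1.
    - by move=> i k z; apply: smooth_derivable; exact: smooth_partial cphi.1.
  - move=> x; apply: contraNle => xr.
    have te : `|t *: e_j| <= `|e_j| by rewrite normrZ ler_piMl.
    have xs : r < `|x + t *: e_j|.
      have : `|x| <= `|x + t *: e_j| + `|t *: e_j| by rewrite -{1}(addrK (t *: e_j) x) ler_normB.
      lra.
    have xr' : r < `|x| by have := normr_ge0 e_j; lra.
    have zero u : r < `|u| -> phi u = 0.
      by move=> ru; apply/eqP/negPn/negP => /phir; rewrite leNgt ru.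
    have zero' u : r < `|u| -> partial j phi u = 0.
      by move=> ru; apply/eqP/negPn/negP => /(partial_supp phir); rewrite leNgt ru.
    by rewrite !zero// zero'// mulr0 !subrr.
set I := \int[leb]_x partial j phi x in key *.
have V0 : 0 <= V by rewrite fine_ge0// integral_ge0// => x _; rewrite lee_fin.
apply/eqP; rewrite -normr_eq0; apply/eqP/le_anti; rewrite normr_ge0 andbT.
apply/ler_addgt0Pr => e e0; rewrite add0r.
pose t := Num.min 1 (e / (M * V + 1)).
have MV : 0 < M * V + 1 by rewrite ltr_wpDl// mulr_ge0// ltW.
have t0 : 0 < t by rewrite lt_min ltr01 divr_gt0.
have := key t; rewrite gtr0_norm// ge_min lexx => /(_ isT).
rewrite normrM gtr0_norm// mulrAC expr2 mulrCA ler_pM2l// => /le_trans; apply.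
apply: (@le_trans _ _ (M * V * (e / (M * V + 1)))).
  by rewrite ler_wpM2l ?mulr_ge0// ?ge_min ?lexx ?orbT// ltW.
by apply: mulr_div1D_le; [apply: mulr_ge0 => //; exact: ltW|exact: ltW].
Qed.

(** Integration by parts: the derivative of the product w phi has integral 0. *)
Lemma Ccoo_weak_partial j w : Ccoo w -> is_weak_partial j w (partial j w).
Proof.
move=> cw; split; first exact: Ccoo_loc_integrable (Ccoo_partial j cw).
move=> phi cphi.
have cwphi := CcooM cw.1 cphi.
have i1 : (lebesgueRn R n).-integrable setT (EFin \o (fun x => partial j w x * phi x)).
  by apply: integrable_Ccoo; apply: CcooM => //; exact: smooth_partial cw.1.
have i2 : (lebesgueRn R n).-integrable setT (EFin \o (fun x => w x * partial j phi x)).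
  by apply: integrable_Ccoo; apply: CcooM; [exact: cw.1|exact: Ccoo_partial].
apply/eqP; rewrite -addr_eq0 addrC -(RintegralD measurableT i1 i2).
rewrite -(Rintegral_partial j cwphi); apply/eqP; apply: eq_Rintegral => x _.
by rewrite partialM//; apply: smooth_derivable; [exact: cw.1|exact: cphi.1].
Qed.

(* Test [f] against [eta * phi]. *)
Lemma weak_partialM j f g eta : loc_integrable f -> is_weak_partial j f g ->
  Ccoo eta ->
  is_weak_partial j (fun x => eta x * f x) (fun x => eta x * g x + partial j eta x * f x).
Proof.
move=> lf [lg wg] ceta.
have mulL (h psi : 'rV[R]_n -> R) : loc_integrable h -> Ccoo psi -> loc_integrable (fun x => psi x * h x).
  move=> lh cpsi; split.
    by apply: measurable_funM; [exact: smooth_measurable cpsi.1|exact: lh.1].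
  move=> K cK.
  have mK := compact_measurable_Rn cK.
  have := loc_integrable_Ccoo lh cpsi.
  move=> /(integrableS measurableT mK (@subsetT _ _))/integrableP[_].
  by under eq_integral do rewrite mulrC.
split.
  have l1 := mulL _ _ lg ceta.
  have l2 := mulL _ _ lf (Ccoo_partial j ceta).
  split; first by apply: measurable_funD; [exact: l1.1|exact: l2.1].
  move=> K cK.
  have mK := compact_measurable_Rn cK.
  have i1 := loc_integrable_Ccoo lg ceta.
  have i2 := loc_integrable_Ccoo lf (Ccoo_partial j ceta).
  have := integrableD measurableT i1 i2.
  move=> /(integrableS measurableT mK (@subsetT _ _))/integrableP[_].
  congr (_ < _)%E; apply: eq_integral => x _ /=.
  by rewrite (mulrC (eta x)) (mulrC (partial j eta x)).
move=> phi cphi.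
have cep := CcooM ceta.1 cphi.
have i1 : (lebesgueRn R n).-integrable setT (EFin \o (fun x => f x * partial j (fun x => eta x * phi x) x)).
  by apply: loc_integrable_Ccoo => //; exact: Ccoo_partial.
have i2 : (lebesgueRn R n).-integrable setT (EFin \o (fun x => f x * (partial j eta x * phi x))).
  apply: loc_integrable_Ccoo => //; apply: CcooM => //; exact: smooth_partial ceta.1.
have i3 : (lebesgueRn R n).-integrable setT (EFin \o (fun x => g x * (eta x * phi x))).
  exact: loc_integrable_Ccoo.
have -> : \int[leb]_x (eta x * f x * partial j phi x) =
   \int[leb]_x (f x * partial j (fun x => eta x * phi x) x - f x * (partial j eta x * phi x)).
  apply: eq_Rintegral => x _.
  rewrite partialM; [|exact: smooth_derivable ceta.1|exact: smooth_derivable cphi.1].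
  ring.
rewrite (RintegralB measurableT i1 i2) wg// -opprD -(RintegralD measurableT i3 i2).
by congr (- _); apply: eq_Rintegral => x _; ring.
Qed.

End Ccoo_weak_derivative.

(** * Convergence of mollifications in L^1 *)

Section integrable_induction.
Context d (T : measurableType d) (R : realType) (mu : {measure set T -> \bar R}).
Implicit Types (f g : T -> R).
Local Open Scope ereal_scope.

Import HBSimple.

(** Simple functions are linear combinations of indicators and are dense in L^1. Only indicators of
    sets of finite measure are asked for, which is what covers by boxes can reach. *)
Lemma integrable_ind (P : (T -> R) -> Prop) :
  (forall A, measurable A -> mu A < +oo -> P (\1_A : T -> R)) ->
  (forall f g, P f -> P g -> P (fun x => f x + g x)%R) ->
  (forall f c, P f -> P (fun x => c * f x)%R) ->
  (forall f, mu.-integrable setT (EFin \o f) ->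
    (forall e : R, (0 < e)%R -> exists g, [/\ P g, mu.-integrable setT (EFin \o g) &
      \int[mu]_x `|f x - g x|%:E <= e%:E]) -> P f) ->
  forall f, mu.-integrable setT (EFin \o f) -> P f.
Proof.
move=> PA PD PZ Pcl f intf.
have P0 : P (fun=> 0%R).
  have -> : (fun=> 0%R) = (fun x => 0 * \1_set0 x)%R :> (T -> R).
    by apply/funext => x; rewrite mul0r.
  by apply: PZ; apply: PA => //; rewrite measure0.
have Psf (g : {sfun T >-> R}) : mu.-integrable setT (EFin \o g) -> P g.
  move=> ig.
  have -> : (g : T -> R) = (fun x => \sum_(y <- finmap.enum_fset (fset_set (range g))) y * \1_(g @^-1` [set y]) x)%R.
    by apply/funext => x; rewrite fimfunE fsbig_finite//.
  elim: (finmap.enum_fset _) => [|y s IH].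
    by rewrite (_ : (fun x => _) = fun=> 0%R)//; apply/funext => x; rewrite big_nil.
  rewrite (_ : (fun x => _) = (fun x => y * \1_(g @^-1` [set y]) x +
      \sum_(y <- s) y * \1_(g @^-1` [set y]) x)%R); last first.
    by apply/funext => x; rewrite big_cons.
  apply: PD => //.
  (* The value 0 is set apart because its level set may have infinite measure; any other level set
     has finite measure by integrability. *)
  have [->|y0] := eqVneq y 0%R.
    by rewrite (_ : (fun x => _) = fun=> 0%R)//; apply/funext => x; rewrite mul0r.
  apply: PZ; apply: PA; first exact: measurable_funPTI.
  have mA : measurable (g @^-1` [set y]) by exact: measurable_funPTI.
  have := ig => /integrableP[_].
  move=> /(le_lt_trans _)H.
  have /H : `|y|%:E * mu (g @^-1` [set y]) <= \int[mu]_x `|(EFin \o g) x|.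
    rewrite -integral_cst//.
    apply: (@le_trans _ _ (\int[mu]_(x in g @^-1` [set y]) `|(EFin \o g) x|)).
      by apply: ge0_le_integral_lower => [x _|x /= ->]; rewrite ?lee_fin.
    apply: ge0_subset_integral => //.
    by apply: measurableT_comp => //; exact/measurable_EFinP.
  move=> lt; rewrite ltNge leye_eq; apply/eqP => muy; move: lt.
  by rewrite muy gt0_muley ?ltxx// lte_fin normr_gt0.
apply: (Pcl _ intf) => e e0.
have [g [ig _ gf]] := approximation_sfun_integrable measurableT intf.
have [k _ /(_ k (leqnn k)) ke] := cvge0_near_le gf e0.
by exists (g k); split => //; exact: Psf.
Qed.

End integrable_induction.

Section L1_convergence.
Context {R : realType} {n : nat}.
Implicit Types (f g phi : 'rV[R]_n -> R) (x y : 'rV[R]_n).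

Lemma cube_sub_normball (a : 'rV[R]_n) (l : R) : 0 <= l ->
  cube a l `<=` normball (`|a| + l).
Proof.
move=> l0 x ax; apply: norm_le_coord => [|i]; first by rewrite addr_ge0.
have := ax i; have := coord_le_norm a i; rewrite !ler_norml.
by move=> /andP[? ?] /andP[? ?]; lra.
Qed.

Lemma loc_integrable_cube f (a : 'rV[R]_n) (l : R) : 0 <= l -> loc_integrable f ->
  (\int[leb]_(x in cube a l) `|f x|%:E < +oo)%E.
Proof.
move=> l0 lf; apply: le_lt_trans (loc_integrable_lty (`|a| + l) lf).
apply: ge0_subset_integral; first exact: measurable_cube.
- exact: measurable_normball.
- apply/measurable_EFinP; apply: measurableT_comp; first exact: normr_measurable.
  exact: measurable_funS lf.1.
- by move=> x _; rewrite lee_fin.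
- exact: cube_sub_normball.
Qed.

Lemma mollifier_supp C e phi a M (k : {ffun 'I_n -> 'I_M}) x y : 0 < e ->
  mollifier C e phi -> cell a e k x -> phi (y - x) != 0 -> cell2 a e k y.
Proof.
move=> e0 [_ _ phis _ _] xk /phis yx i.
have := yx i; have := xk i; rewrite !mxE => /andP[? ?] /andP[? ?].
apply/andP; split; lra.
Qed.

Lemma mollify_le_cell f C e phi a M (k : {ffun 'I_n -> 'I_M}) x : 0 < e ->
  loc_integrable f -> mollifier C e phi -> cell a e k x ->
  `|mollify f phi x| <= C / e ^+ n * fine (\int[leb]_(y in cell2 a e k) `|f y|%:E)%E.
Proof.
move=> e0 lf mphi xk.
have [cphi phi0 _ _ phiC] := mphi.
apply: bounded_mul_le.
- exact: measurable_cube.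
- exact: lf.1.
- by apply: loc_integrable_cube => //; rewrite mulr_ge0// ltW.
- exact: smooth_measurable (Ccoo_shift (- x) cphi).1.
- by move=> y; rewrite ger0_norm.
- by move=> y; apply: (mollifier_supp e0 mphi xk).
Qed.

Lemma lebesgueRn_cell a e M (k : {ffun 'I_n -> 'I_M}) : 0 < e ->
  lebesgueRn R n (cell a e k) = (e ^+ n)%:E.
Proof.
move=> e0; rewrite /cell /lebesgueRn lebesgue_outer_box; congr EFin.
rewrite -[X in _ ^+ X](card_ord n) -prodr_const; apply: eq_bigr => i _.
by rewrite !mxE addrC addKr max_l// ltW.
Qed.

(** The corner is at -(r + 1) because boxes are open on the left; one cell more than the truncated
    quotient carries the grid past r + 1. *)
Lemma normball_sub_box r e : 0 < e ->
  normball r `<=` (box (const_mx (- (r + 1))) (const_mx (- (r + 1) + e * (Num.truncn (2 * (r + 1) / e)).+1%:R)) : set 'rV[R]_n).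
Proof.
move=> e0 x xr i; rewrite !mxE.
have := le_trans (coord_le_norm x i) xr; rewrite ler_norml => /andP[x1 x2].
apply/andP; split; first by lra.
have : 2 * (r + 1) / e < (Num.truncn (2 * (r + 1) / e)).+1%:R by exact: truncnS_gt.
by rewrite ltr_pdivrMr// mulrC => ?; lra.
Qed.

Lemma normball_grid_integral r e (g h : Rn R n -> \bar R) (c : R) : 0 < e ->
  measurable_fun setT g -> measurable_fun setT h ->
  (forall x, 0 <= g x)%E -> (forall x, 0 <= h x)%E ->
  forall M, M = (Num.truncn (2 * (r + 1) / e)).+1 ->
  (forall k : {ffun 'I_n -> 'I_M},
    \int[leb]_(x in cell (- (r + 1)) e k) g x <=
    \int[leb]_(x in cell2 (- (r + 1)) e k) h x + c%:E)%E ->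
  (\int[leb]_(x in normball r) g x <=
   (3 ^ n)%:R%:E * \int[leb]_x h x + ((M ^ n)%:R * c)%:E)%E.
Proof.
move=> e0 mg mh g0 h0 M ME H.
apply: le_trans (grid_integral e0 mg mh g0 h0 H).
apply: ge0_subset_integral; first exact: measurable_normball.
- exact: measurable_box.
- exact: measurable_funS mg.
- by move=> x _; exact: g0.
- by rewrite ME; exact: normball_sub_box.
Qed.

Lemma measurable_mollify f phi : loc_integrable f -> Ccoo phi ->
  measurable_fun [set: Rn R n] (mollify f phi).
Proof. by move=> lf cphi; apply: smooth_measurable; exact: smooth_mollify. Qed.

(** On a cell the mollification is at most C / e^n times the integral of |f| over the doubled cell,
    and the cell has volume e^n. Summing over the grid gives a bound independent of e, in place of
    Young's convolution inequality. *)
Lemma mollify_L1_le f C e phi r : 0 < e -> 0 <= C -> loc_integrable f ->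
  mollifier C e phi ->
  (\int[leb]_(x in normball r) `|mollify f phi x|%:E <=
  ((3 ^ n)%:R * C)%:E * \int[leb]_x `|f x|%:E)%E.
Proof.
move=> e0 C0 lf mphi; have [cphi _ _ _ _] := mphi.
have mf : measurable_fun [set: Rn R n] (fun x => `|f x|%:E).
  by apply/measurable_EFinP; apply: measurableT_comp; [exact: normr_measurable|exact: lf.1].
have mcf : measurable_fun [set: Rn R n] (fun x => `|mollify f phi x|%:E).
  by apply/measurable_EFinP; apply: measurableT_comp; [exact: normr_measurable|exact: measurable_mollify].
have g0 x : (0 <= `|mollify f phi x|%:E)%E by rewrite lee_fin.
have h0 x : (0 <= C%:E * `|f x|%:E)%E by rewrite -EFinM lee_fin mulr_ge0.
have mh : measurable_fun [set: Rn R n] (fun x => C%:E * `|f x|%:E)%E by exact: measurable_funeM.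
apply: (le_trans (normball_grid_integral (c := 0) (r := r) e0 mcf mh g0 h0 erefl _)); last first.
  by rewrite mulr0 adde0 EFinM -muleA ge0_integralZl ?lee_fin.
move=> k; rewrite adde0.
have -> : (\int[leb]_(x in cell2 (- (r + 1)) e k) (C%:E * `|f x|%:E) =
    C%:E * \int[leb]_(x in cell2 (- (r + 1)) e k) `|f x|%:E)%E.
  apply: ge0_integralZl; first exact: measurable_cube.
  - exact: measurable_funS mf.
  - by move=> x _; rewrite lee_fin.
  - by rewrite lee_fin.
have If : (\int[leb]_(y in cell2 (- (r + 1)) e k) `|f y|%:E)%E \is a fin_num.
  rewrite ge0_fin_numE; last by apply: integral_ge0 => x _; rewrite lee_fin.
  by apply: loc_integrable_cube => //; rewrite mulr_ge0// ltW.
rewrite -(fineK If) -EFinM.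
set I := fine _.
apply: (@le_trans _ _ (\int[lebesgueRn R n]_(x in cell (- (r + 1)) e k) (C / e ^+ n * I)%:E)%E).
  apply: ge0_le_integral_lower => x xk; first by rewrite lee_fin.
  by rewrite lee_fin; apply: (mollify_le_cell e0 lf mphi xk).
have -> : (\int[lebesgueRn R n]_(x in cell (- (r + 1)) e k) (C / e ^+ n * I)%:E =
    (C / e ^+ n * I)%:E * (e ^+ n)%:E)%E.
  by rewrite -(lebesgueRn_cell (- (r + 1)) k e0); apply: integral_cst; exact: measurable_box.
rewrite -EFinM lee_fin mulrAC divfK//.
by rewrite expf_neq0// gt_eqF.
Qed.

End L1_convergence.

Section integral_norm.
Context d (T : measurableType d) (R : realType) (mu : {measure set T -> \bar R}).
Implicit Types (f g : T -> R).
Local Open Scope ereal_scope.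

Lemma measurable_normE (D : set T) f : measurable_fun setT f ->
  measurable D -> measurable_fun D (fun x => `|f x|%:E).
Proof.
move=> mf mD; apply/measurable_EFinP; apply: measurableT_comp => //.
exact: measurable_funS mf.
Qed.

Lemma le_integral_normD (D : set T) (f g h : T -> R) : measurable D ->
  measurable_fun setT g -> measurable_fun setT h ->
  (forall x, `|f x| <= `|g x| + `|h x|)%R ->
  \int[mu]_(x in D) `|f x|%:E <=
  \int[mu]_(x in D) `|g x|%:E + \int[mu]_(x in D) `|h x|%:E.
Proof.
move=> mD mg mh fgh.
rewrite -ge0_integralD//; [|exact: measurable_normE..].
by apply: ge0_le_integral_lower => x _; rewrite ?lee_fin// -EFinD lee_fin.
Qed.

(* Integrate [|a - s| + a + s <= 2 u], valid since [a, s <= u]. *)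
Lemma integral_distr_le (a s : T -> R) (u : T -> \bar R) (V e : R) :
  measurable_fun setT a -> measurable_fun setT s -> measurable_fun setT u ->
  (forall x, 0 <= a x)%R -> (forall x, 0 <= s x)%R ->
  (forall x, (a x)%:E <= u x) -> (forall x, (s x)%:E <= u x) ->
  \int[mu]_x u x = V%:E ->
  (V - e)%:E <= \int[mu]_x (a x)%:E -> (V - e)%:E <= \int[mu]_x (s x)%:E ->
  \int[mu]_x `|a x - s x|%:E <= (2 * e)%:E.
Proof.
move=> ma ms mu_ a0 s0 au su uV aV sV.
have ma' : measurable_fun setT (EFin \o a) by exact/measurable_EFinP.
have ms' : measurable_fun setT (EFin \o s) by exact/measurable_EFinP.
have md : measurable_fun setT (fun x => `|a x - s x|%:E).
  by apply: measurable_normE => //; exact: measurable_funB.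
have H : \int[mu]_x `|a x - s x|%:E + (\int[mu]_x (a x)%:E + \int[mu]_x (s x)%:E)
    <= (2 * V)%:E.
  rewrite -ge0_integralD//; [|by move=> x _; rewrite lee_fin..].
  rewrite -ge0_integralD//; last 2 first.
  - by move=> x _; rewrite adde_ge0// lee_fin.
  - exact: emeasurable_funD.
  rewrite EFinM -uV -ge0_integralZl//; last first.
    by move=> x _; rewrite (le_trans _ (au x))// lee_fin.
  apply: ge0_le_integral_lower => x _.
    by rewrite -!EFinD lee_fin addr_ge0// addr_ge0.
  have := au x; have := su x; case: (u x) => [v| |]//; last first.
    by move=> _ _; rewrite mulry gtr0_sg// mul1e leey.
  rewrite -!EFinD -EFinM !lee_fin => sv av.
  by case: (ger0P (a x - s x)%R) => ?; lra.
have fa : \int[mu]_x (a x)%:E \is a fin_num.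
  rewrite ge0_fin_numE ?integral_ge0//; last by move=> x _; rewrite lee_fin.
  apply: (@le_lt_trans _ _ (\int[mu]_x u x)); last by rewrite uV ltry.
  by apply: ge0_le_integral_lower => x _; rewrite ?lee_fin.
have fs : \int[mu]_x (s x)%:E \is a fin_num.
  rewrite ge0_fin_numE ?integral_ge0//; last by move=> x _; rewrite lee_fin.
  apply: (@le_lt_trans _ _ (\int[mu]_x u x)); last by rewrite uV ltry.
  by apply: ge0_le_integral_lower => x _; rewrite ?lee_fin.
move: H aV sV; rewrite -(fineK fa) -(fineK fs) -EFinD -leeBrDr// -EFinB !lee_fin.
by move=> /le_trans H ? ?; apply: H; rewrite lee_fin; lra.
Qed.

End integral_norm.

Section box_shift.
Context {R : realType} {n : nat}.
Implicit Types (x y a b : 'rV[R]_n) (e : R).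

Lemma box_in a b x y e : box a b x -> (forall i, e < x 0 i - a 0 i) ->
  (forall i, - e <= (y - x) 0 i <= 0) -> box a b y.
Proof.
move=> xab xe yx i; have := yx i; have := xe i; have := xab i; rewrite !mxE.
by move=> /andP[? ?] ? /andP[? ?]; apply/andP; split; lra.
Qed.

Lemma box_out_le a b x y e i : x 0 i <= a 0 i ->
  (forall i, - e <= (y - x) 0 i <= 0) -> ~ (a 0 i < y 0 i <= b 0 i).
Proof. by move=> xa /(_ i); rewrite !mxE => /andP[? ?] /andP[? ?]; lra. Qed.

Lemma box_out_gt a b x y e i : e < x 0 i - b 0 i ->
  (forall i, - e <= (y - x) 0 i <= 0) -> ~ (a 0 i < y 0 i <= b 0 i).
Proof. by move=> xb /(_ i); rewrite !mxE => /andP[? ?] /andP[? ?]; lra. Qed.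

Lemma integrable_cst_normball (c r : R) :
  (lebesgueRn R n).-integrable (normball r) (cst c%:E).
Proof.
apply/integrableP; split; first exact: measurable_cst.
have -> : (\int[lebesgueRn R n]_(x in normball r) `|cst c%:E x| =
    `|c|%:E * lebesgueRn R n (normball r))%E.
  by apply: (integral_cst _ _ `|c|%:E); exact: measurable_normball.
by rewrite lte_mul_pinfty ?lee_fin//; exact: lebesgueRn_normball_lty.
Qed.

End box_shift.

Section mollify_cvg.
Context {R : realType} {n : nat} (C : R) (phi : nat -> 'rV[R]_n -> R).
Hypothesis C0 : 0 <= C.
Hypothesis phiP : forall k, mollifier C (k.+1%:R^-1) (phi k).
Implicit Types (f g : 'rV[R]_n -> R).
Local Notation Leb := (lebesgueRn R n).

Let Cphi k : Ccoo (phi k). Proof. by have [] := phiP k. Qed.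
Let e0 k : 0 < (k.+1%:R^-1 : R). Proof. by rewrite invr_gt0. Qed.

Lemma integrable_loc_integrable f : Leb.-integrable setT (EFin \o f) -> loc_integrable f.
Proof.
move=> intf; split.
  by apply/measurable_EFinP; exact: measurable_int intf.
move=> K /compact_measurable_Rn mK.
by have /integrableP[] := integrableS measurableT mK (@subsetT _ _) intf.
Qed.

Lemma mollifyD f g (psi : 'rV[R]_n -> R) x : loc_integrable f -> loc_integrable g ->
  Ccoo psi ->
  mollify (fun y => f y + g y) psi x = mollify f psi x + mollify g psi x.
Proof.
move=> lf lg cpsi; have cs := Ccoo_shift (- x) cpsi.
rewrite /mollify -(RintegralD measurableT (loc_integrable_Ccoo lf cs) (loc_integrable_Ccoo lg cs)).
by apply: eq_Rintegral => y _; rewrite mulrDl.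
Qed.

Lemma mollifyZ f (c : R) (psi : 'rV[R]_n -> R) x : loc_integrable f ->
  Ccoo psi -> mollify (fun y => c * f y) psi x = c * mollify f psi x.
Proof.
move=> lf cpsi; have cs := Ccoo_shift (- x) cpsi.
rewrite /mollify -(RintegralZl c measurableT (loc_integrable_Ccoo lf cs)).
by apply: eq_Rintegral => y _; rewrite mulrA.
Qed.

Definition mollify_cvg f := loc_integrable f /\ forall r d : R, 0 < d ->
  \forall k \near \oo,
    (\int[Leb]_(x in normball r) `|mollify f (phi k) x - f x|%:E <= d%:E)%E.

Let mdiff f k : loc_integrable f ->
  measurable_fun [set: Rn R n] (fun x => mollify f (phi k) x - f x).
Proof.
by move=> lf; apply: measurable_funB; [exact: measurable_mollify|exact: lf.1].
Qed.

Lemma loc_integrableD f g : loc_integrable f -> loc_integrable g ->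
  loc_integrable (fun x => f x + g x).
Proof.
move=> [mf lf] [mg lg]; split; first exact: measurable_funD.
move=> K cK; have mK := compact_measurable_Rn cK.
apply: le_lt_trans (lte_add_pinfty (lf _ cK) (lg _ cK)).
by apply: le_integral_normD => // x; exact: ler_normD.
Qed.

Lemma loc_integrableZ f (c : R) : loc_integrable f -> loc_integrable (fun x => c * f x).
Proof.
move=> [mf lf]; split; first by apply: measurable_funM => //; exact: measurable_cst.
move=> K cK; have mK := compact_measurable_Rn cK.
under eq_integral do rewrite normrM.
rewrite (integral_EFinZl _ mK (normr_ge0 c) (measurable_normf mf)) => [|x]; last exact: normr_ge0.
by rewrite lte_mul_pinfty ?lee_fin//; exact: lf.
Qed.

Lemma mollify_cvgD f g : mollify_cvg f -> mollify_cvg g ->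
  mollify_cvg (fun x => f x + g x).
Proof.
move=> [lf cf] [lg cg]; split; first exact: loc_integrableD.
move=> r d d0; have d20 : 0 < d / 2 by rewrite divr_gt0.
near=> k; rewrite [d]splitr EFinD.
apply: le_trans (leeD (_ : \int[Leb]_(x in normball r) `|mollify f (phi k) x - f x|%:E <= _)%E
  (_ : \int[Leb]_(x in normball r) `|mollify g (phi k) x - g x|%:E <= _)%E).
- apply: le_integral_normD; first exact: measurable_normball.
  + exact: mdiff.
  + exact: mdiff.
  + move=> x; rewrite mollifyD// opprD addrACA; exact: ler_normD.
- by near: k; exact: cf.
- by near: k; exact: cg.
Unshelve. all: by end_near. Qed.

Lemma mollify_cvgZ f (c : R) : mollify_cvg f -> mollify_cvg (fun x => c * f x).
Proof.
move=> [lf cf]; split; first exact: loc_integrableZ.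
move=> r d d0; have d20 : 0 < d / (`|c| + 1) by rewrite divr_gt0// ltr_wpDl.
near=> k.
apply: (@le_trans _ _ (`|c|%:E * (d / (`|c| + 1))%:E)%E); last first.
  by rewrite -EFinM lee_fin mulr_div1D_le// ltW.
apply: (@le_trans _ _ (`|c|%:E * \int[Leb]_(x in normball r) `|mollify f (phi k) x - f x|%:E)%E).
  rewrite -(integral_EFinZl _ (measurable_normball r) (normr_ge0 c)
    (measurable_normf (mdiff k lf))) => [|x]; last exact: normr_ge0.
  by apply: le_integral_EFin => x _; [exact: normr_ge0|rewrite mollifyZ// -mulrBr normrM].
by apply: lee_wpmul2l; [rewrite lee_fin|near: k; exact: cf].
Unshelve. all: by end_near. Qed.

Lemma mollify_cvg_closed f : Leb.-integrable setT (EFin \o f) ->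
  (forall e : R, 0 < e -> exists g, [/\ mollify_cvg g,
    Leb.-integrable setT (EFin \o g) & (\int[Leb]_x `|f x - g x|%:E <= e%:E)%E]) ->
  mollify_cvg f.
Proof.
move=> intf H; have lf := integrable_loc_integrable intf; split => // r d d0.
(* The constant (3^n) C bounds the mollification of f - g in L^1, and the 1 accounts for f - g
   itself. *)
pose B : R := (3 ^ n)%:R * C + 1.
have B1 : 0 < B by rewrite ltr_wpDl// mulr_ge0.
have d20 : 0 < d / 2 by rewrite divr_gt0.
have [g [[lg cg] intg fg]] := H _ (divr_gt0 d20 B1).
have lg1 : loc_integrable (fun x => -1 * g x) := loc_integrableZ (-1) lg.
have lh : loc_integrable (fun x => f x + (-1) * g x) := loc_integrableD lf lg1.
have mB := @measurable_normball R n r.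
have mfg : measurable_fun [set: Rn R n] (fun x => f x - g x).
  by apply: measurable_funB; [exact: lf.1|exact: lg.1].
near=> k; rewrite [d]splitr EFinD.
apply: (@le_trans _ _ (\int[Leb]_(x in normball r) `|mollify g (phi k) x - g x|%:E +
  (\int[Leb]_(x in normball r) `|mollify (fun x => f x + (-1) * g x)%R (phi k) x|%:E +
   \int[Leb]_(x in normball r) `|f x - g x|%:E))%E).
  pose h x : R := mollify (fun x => f x + (-1) * g x) (phi k) x - (f x - g x).
  have mh : measurable_fun [set: Rn R n] h.
    apply: measurable_funB; first exact: measurable_mollify.
    by apply: measurable_funB; [exact: lf.1|exact: lg.1].
  apply: (@le_trans _ _ (\int[Leb]_(x in normball r) `|mollify g (phi k) x - g x|%:E +
    \int[Leb]_(x in normball r) `|h x|%:E)%E).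
    apply: (le_integral_normD _ mB (mdiff k lg) mh) => x.
    rewrite /h (mollifyD x lf lg1 (Cphi k)) (mollifyZ (-1) x lg (Cphi k)).
    apply: le_trans (ler_normD _ _).
    by rewrite le_eqVlt; apply/orP; left; apply/eqP; congr `|_|; ring.
  apply: leeD; first exact: lexx.
  apply: (le_integral_normD _ mB (measurable_mollify lh (Cphi k)) mfg) => x.
  exact: ler_normB.
apply: leeD; first by near: k; exact: cg.
apply: (@le_trans _ _ (((3 ^ n)%:R * C)%:E * (d / 2 / B)%:E + (d / 2 / B)%:E)%E).
  apply: leeD.
    apply: (le_trans (mollify_L1_le r (e0 k) C0 lh (phiP k))).
    apply: lee_wpmul2l; first by rewrite lee_fin mulr_ge0.
    by under eq_integral do rewrite mulN1r.
  apply: le_trans fg.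
  apply: ge0_subset_integral; [exact: mB|exact: measurableT| | |exact: subsetT].
    exact: (measurable_normE mfg measurableT).
  by move=> x _; rewrite lee_fin.
rewrite -EFinM -EFinD lee_fin -[X in _ + X]mul1r -mulrDl -/B mulrCA divff ?gt_eqF//.
by rewrite mulr1.
Unshelve. all: by end_near. Qed.

Lemma mollify_normr_le1 f k x : measurable_fun [set: Rn R n] f ->
  (forall y, `|f y| <= 1) -> `|mollify f (phi k) x| <= 1.
Proof.
move=> mf f1; have [cphi phi0 _ phi1 _] := phiP k.
have lf := loc_integrable_bounded mf f1.
have cs := Ccoo_shift (- x) cphi.
have mphi := smooth_measurable cphi.1.
apply: (le_trans (le_normr_Rintegral measurableT (loc_integrable_Ccoo lf cs))).
rewrite -phi1 -(Rintegral_shift (- x) mphi).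
apply: le_Rintegral => //.
- exact: (integrable_norm (loc_integrable_Ccoo lf cs)).
- exact: integrable_Ccoo cs.
- by move=> y _; rewrite normrM (ger0_norm (phi0 _)) ler_piMl.
Qed.

(** At every point the mollified indicator equals the indicator for large k: points y with y - x in
    [-e, 0]^n stay in ]a, b] if x is inside and e is small, stay out if some x_i <= a_i, and stay
    out for small e if some x_i > b_i. Dominated convergence on balls concludes. *)
Lemma mollify_cvg_box (a b : 'rV[R]_n) : mollify_cvg (\1_(box a b) : 'rV[R]_n -> R).
Proof.
set f : 'rV[R]_n -> R := \1_(box a b).
have mf : measurable_fun [set: Rn R n] f.
  by apply: measurable_indic; exact: measurable_box.
have f1 x : `|f x| <= 1.
  by rewrite /f indicE; case: (_ \in _); rewrite ?normr1 ?normr0.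
have lf := loc_integrable_bounded mf f1; split => // r d d0.
have mB := @measurable_normball R n r.
have pt x : \forall k \near \oo, mollify f (phi k) x = f x.
  have [xab|xab] := pselect (box a b x).
    have fx : f x = 1 by rewrite /f indicE mem_set.
    have : \forall k \near \oo, forall i : 'I_n, (k.+1%:R^-1 : R) < x 0 i - a 0 i.
      apply: filter_forall => i.
      have xa : 0 < x 0 i - a 0 i by rewrite subr_gt0; have /andP[] := xab i.
      exact: (near_infty_natSinv_lt (PosNum xa)).
    apply: filterS => k Hk; rewrite fx.
    have [cphi phi0 phis phi1 _] := phiP k.
    rewrite -phi1 -(Rintegral_shift (- x) (smooth_measurable cphi.1)).
    apply: eq_Rintegral => y _.
    have [->|/phis Hy] := eqVneq (phi k (y - x)) 0; first by rewrite mulr0.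
    by rewrite /f indicE mem_set ?mul1r//; exact: box_in xab Hk Hy.
  have fx : f x = 0 by rewrite /f indicE memNset.
  have [i Hi] : exists i, ~ (a 0 i < x 0 i <= b 0 i) by apply/existsNP.
  have out k : (forall y, phi k (y - x) != 0 -> ~ (a 0 i < y 0 i <= b 0 i)) ->
      mollify f (phi k) x = f x.
    move=> H; rewrite fx.
    have -> : mollify f (phi k) x = \int[Leb]_(y in [set: Rn R n]) cst 0 y.
      apply: eq_Rintegral => y _.
      have [->|/H Hy] := eqVneq (phi k (y - x)) 0; first by rewrite mulr0.
      by rewrite /f indicE memNset ?mul0r// => /(_ i).
    by rewrite Rintegral_cst// mul0r.
  have [xa|xa] := leP (x 0 i) (a 0 i).
    apply: nearW => k; apply: out => y.
    have [_ _ phis _ _] := phiP k.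
    by move=> /phis Hy; exact: box_out_le xa Hy.
  have xb : 0 < x 0 i - b 0 i.
    by rewrite subr_gt0 ltNge; apply/negP => xb; apply: Hi; rewrite xa.
  have := near_infty_natSinv_lt (PosNum xb); apply: filterS => k /= Hk.
  apply: out => y; have [_ _ phis _ _] := phiP k.
  by move=> /phis Hy; exact: box_out_gt Hk Hy.
pose F k x : \bar R := `|mollify f (phi k) x - f x|%:E.
have cv : (\int[Leb]_(x in normball r) F k x @[k --> \oo] --> \int[Leb]_(x in normball r) cst 0 x)%E.
  apply: (@dominated_cvg _ _ _ Leb _ mB F (cst 0%E) (fun=> 2%R%:E)).
  - by move=> k; exact: (measurable_normE (mdiff k lf) mB).
  - move=> x _; apply: cvg_near_cst.
    have := pt x; apply: filterS => k E.
    by rewrite /F E subrr normr0.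
  - by [].
  - exact: integrable_cst_normball.
  - move=> k x _; rewrite /F gee0_abs ?lee_fin//.
    rewrite (le_trans (ler_normB _ _))//.
    have := mollify_normr_le1 k x mf f1; have := f1 x; lra.
rewrite integral0 in cv.
exact: cvge0_near_le cv d0.
Qed.

Lemma mollify_cvg_sum (F : nat -> 'rV[R]_n -> R) N : (forall k, mollify_cvg (F k)) ->
  mollify_cvg (fun x => \sum_(k < N) F k x).
Proof.
move=> HF; elim: N => [|N IH].
  have -> : (fun x => \sum_(k < 0) F k x) = (fun x => 0 * F 0%N x).
    by apply/funext => x; rewrite big_ord0 mul0r.
  exact: mollify_cvgZ.
have -> : (fun x => \sum_(k < N.+1) F k x) = (fun x => \sum_(k < N) F k x + F N x).
  by apply/funext => x; rewrite big_ord_recr.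
exact: mollify_cvgD.
Qed.

Lemma measurable_obox o : measurable (@obox R n o : set (Rn R n)).
Proof. by case: o => [ab|]; [exact: measurable_box|exact: measurable0]. Qed.

Lemma lebesgueRn_obox o : Leb (obox o) = obox_vol o.
Proof. by case: o => [ab|]; [exact: lebesgue_outer_box|exact: lebesgue_outer0]. Qed.

Lemma mollify_cvg_obox o : mollify_cvg (\1_(obox o) : 'rV[R]_n -> R).
Proof.
case: o => [ab|]; first exact: mollify_cvg_box.
have -> : \1_(obox None) = (fun x => 0 * \1_(box 0 0) x) :> ('rV[R]_n -> R).
  by apply/funext => x; rewrite mul0r indicE in_set0.
by apply: mollify_cvgZ; exact: mollify_cvg_box.
Qed.

(** A cover by boxes of total volume V < |A| + e / 2 is cut to a finite sum s of indicators with
    integral above V - e / 2. Both s and the indicator of A lie below the full sum u, whose integral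
    is V, so they differ by at most e in L^1. *)
Lemma mollify_cvg_indic (A : set (Rn R n)) : measurable A -> (Leb A < +oo)%E ->
  mollify_cvg (\1_A : 'rV[R]_n -> R).
Proof.
move=> mA Aoo.
have fA : Leb A \is a fin_num by rewrite ge0_fin_numE// measure_ge0.
have intA : Leb.-integrable setT (EFin \o (\1_A : 'rV[R]_n -> R)).
  apply/integrableP; split; first by apply/measurable_EFinP; exact: measurable_indic.
  under eq_integral do rewrite gee0_abs ?lee_fin//.
  by rewrite integral_indic// setIT.
apply: mollify_cvg_closed => // e e_gt0.
have e20 : 0 < e / 2 by rewrite divr_gt0.
have [_ [B AB <-] Vlt] := lb_ereal_inf_adherent e20 fA.
set V := (\sum_(k <oo) obox_vol (B k))%E in Vlt.
have {}Vlt : (V < Leb A + (e / 2)%:E)%E := Vlt.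
have V0 : (0 <= V)%E by apply: nneseries_ge0 => k _ _; exact: obox_vol_ge0.
have fV : V \is a fin_num.
  by rewrite ge0_fin_numE// (lt_trans Vlt)// -(fineK fA) -EFinD ltry.
have cvV : (\sum_(0 <= k < N) obox_vol (B k) @[N --> \oo] --> V)%E.
  by apply: is_cvg_nneseries => k _ _; exact: obox_vol_ge0.
have [N Nlt] : exists N, ((fine V - e / 2)%:E < \sum_(0 <= k < N) obox_vol (B k))%E.
  have : ((fine V - e / 2)%:E < V)%E by rewrite -{2}(fineK fV) lte_fin; lra.
  move=> /open_ereal_gt' /cvV[N _ /(_ N (leqnn N)) ?]; by exists N.
pose s x : R := \sum_(k < N) \1_(obox (B k)) x.
pose u x : \bar R := (\sum_(k <oo) (\1_(obox (B k)) x)%:E)%E.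
have mI k : measurable_fun [set: Rn R n] (\1_(obox (B k)) : 'rV[R]_n -> R).
  by apply: measurable_indic; exact: measurable_obox.
have mI' k : measurable_fun [set: Rn R n] (fun x => (\1_(obox (B k)) x : R)%:E).
  by apply/measurable_EFinP; exact: mI.
have I0 k (x : 'rV[R]_n) : (0 <= (\1_(obox (B k)) x : R)%:E)%E by rewrite lee_fin.
have intI k : (\int[Leb]_x (\1_(obox (B k)) x : R)%:E = obox_vol (B k))%E.
  rewrite -lebesgueRn_obox integral_indic ?setIT//; exact: measurable_obox.
have ms : measurable_fun [set: Rn R n] s by apply: measurable_sum => k; exact: mI.
have sE x : ((s x)%:E = \sum_(0 <= k < N) (\1_(obox (B k)) x : R)%:E)%E.
  by rewrite /s big_mkord sumEFin.
have ints : (\int[Leb]_x (s x)%:E = \sum_(0 <= k < N) obox_vol (B k))%E.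
  under eq_integral do rewrite sE.
  rewrite ge0_integral_sum//.
  by apply: eq_bigr => k _; exact: intI.
exists s; split; first exact: (mollify_cvg_sum N (fun k => mollify_cvg_obox (B k))).
  apply/integrableP; split; first exact/measurable_EFinP.
  under eq_integral do rewrite gee0_abs ?lee_fin ?sumr_ge0//.
  rewrite ints (@le_lt_trans _ _ V)//; last by rewrite ltey_eq fV.
  by apply: nneseries_lim_ge => k _ _; exact: obox_vol_ge0.
have -> : e = 2 * (e / 2) by rewrite mulrCA divff ?mulr1.
apply: (@integral_distr_le _ _ _ Leb _ s u (fine V)) => //.
- by apply: ge0_emeasurable_sum => [k x _ _|k _]; [exact: I0|exact: mI'].
- by move=> x; apply: sumr_ge0.
- move=> x; rewrite indicE; case: (boolP (x \in A)) => [/set_mem Ax|_]; last by apply: nneseries_ge0 => k _ _; exact: I0.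
  have [k _ Bk] := AB _ Ax.
  rewrite /u (@nneseriesD1 _ _ k)//=.
  rewrite indicE mem_set//= leeDl//.
  by apply: nneseries_ge0 => j _ _; exact: I0.
- by move=> x; rewrite sE; apply: nneseries_lim_ge => k _ _; exact: I0.
- rewrite fineK// integral_nneseries//.
  by apply: eq_eseriesr => k _; exact: intI.
- have -> : (\int[Leb]_x (\1_A x : R)%:E = Leb A)%E by rewrite integral_indic// setIT.
  rewrite -(fineK fA) lee_fin; move: Vlt.
  by rewrite -(fineK fA) -EFinD -(fineK fV) lte_fin /=; lra.
- by rewrite ints ltW.
Qed.

Lemma integrable_mollify_cvg f : Leb.-integrable setT (EFin \o f) -> mollify_cvg f.
Proof.
apply: (integrable_ind (mu := Leb)).
- exact: mollify_cvg_indic.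
- exact: mollify_cvgD.
- by move=> g c; exact: mollify_cvgZ.
- exact: mollify_cvg_closed.
Qed.

End mollify_cvg.

Lemma ae_imply d (T : measurableType d) (R : realType)
  (mu : {measure set T -> \bar R}) (P Q : T -> Prop) :
  (forall x, P x -> Q x) -> {ae mu, forall x, P x} -> {ae mu, forall x, Q x}.
Proof. by move=> PQ; apply: filterS. Qed.

(** * Uniqueness of weak derivatives *)

Section weak_uniqueness.
Context {R : realType} {n : nat}.
Implicit Types (f g : 'rV[R]_n -> R).
Local Notation Leb := (lebesgueRn R n).

Lemma mollifier_seq : exists C (phi : nat -> 'rV[R]_n -> R), 0 <= C /\
  forall k, mollifier C (k.+1%:R^-1) (phi k).
Proof.
have [C C0 H] := @mollifier_exists R n.
have [phi phiP] : {phi : nat -> 'rV[R]_n -> R & forall k, mollifier C (k.+1%:R^-1) (phi k)}.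
  apply: (@choice _ _ (fun k phi => mollifier C (k.+1%:R^-1) phi)) => k.
  by apply: H; rewrite invr_gt0.
by exists C, phi; split => //; exact: ltW.
Qed.

Lemma mollifier_norm_le C (phi : 'rV[R]_n -> R) (k : nat) x y :
  mollifier C (k.+1%:R^-1) phi -> phi (y - x) != 0 -> `|y - x| <= 1.
Proof.
move=> [_ _ phis _ _] /phis yx; apply: norm_le_coord => // i.
have := yx i; have : (k.+1%:R^-1 : R) <= 1 by rewrite invf_le1// ler1n.
move: (k.+1%:R^-1 : R) => u ? /andP[? ?]; rewrite ler_norml; apply/andP; split; lra.
Qed.

Lemma eq_mollify f g phi x : (forall y, phi (y - x) != 0 -> f y = g y) ->
  mollify f phi x = mollify g phi x.
Proof.
move=> fg; apply: eq_Rintegral => y _.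
by have [->|/fg ->] := eqVneq (phi (y - x)) 0; rewrite ?mulr0.
Qed.

Lemma loc_mollify_cvg C (phi : nat -> 'rV[R]_n -> R) f : 0 <= C ->
  (forall k, mollifier C (k.+1%:R^-1) (phi k)) -> loc_integrable f ->
  mollify_cvg phi f.
Proof.
move=> C0 phiP lf; split => // r d d0.
(* All kernels reach at most distance 1, so cutting f off outside the ball of radius r + 1 changes
   neither f nor its mollifications on the ball of radius r. *)
pose K := @normball R n (r + 1).
have mK : measurable K := measurable_normball (r + 1).
pose F := (f : Rn R n -> R) \_ K.
have intF : Leb.-integrable setT (EFin \o F).
  have -> : EFin \o F = (EFin \o f) \_ K by rewrite -restrict_comp.
  apply/(integrable_mkcond _ mK); apply/integrableP; split.
    by apply/measurable_EFinP; apply: measurable_funS lf.1.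
  exact: (loc_integrable_lty (r + 1) lf).
have [_ /(_ r _ d0)] := integrable_mollify_cvg C0 phiP intF.
apply: filterS => k; apply: le_trans; rewrite le_eqVlt; apply/orP; left; apply/eqP.
apply: eq_integral => x /set_mem xr.
have inK y : `|y - x| <= 1 -> K y.
  move=> yx; rewrite /K /normball /= -(subrK x y).
  by rewrite (le_trans (ler_normD _ _))// addrC lerD.
have FE y : K y -> F y = f y by move=> Ky; rewrite /F patchE mem_set.
congr (`|_|%:E); congr (_ - _).
  by apply: eq_mollify => y /(mollifier_norm_le (phiP k)) yx; rewrite FE//; exact: inK.
by rewrite FE//; apply: inK; rewrite subrr normr0.
Qed.

(** Each value of a mollification of f is an integral against a test function, hence 0; local L^1
    convergence then forces f to vanish on every ball. *)
Lemma ae_eq0_of_Ccoo f : loc_integrable f ->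
  (forall phi, Ccoo phi -> \int[Leb]_x (f x * phi x) = 0) ->
  {ae Leb, forall x, f x = 0}.
Proof.
move=> lf f0; have [C [phi [C0 phiP]]] := mollifier_seq.
have mf0 k x : mollify f (phi k) x = 0.
  by apply: f0; apply: Ccoo_shift; have [] := phiP k.
have H (r : nat) : {ae Leb, forall x, normball r%:R x -> f x = 0}.
  have mB := @measurable_normball R n r%:R.
  have mEf : measurable_fun (normball r%:R) (EFin \o f : Rn R n -> \bar R).
    by apply/measurable_EFinP; apply: measurable_funS lf.1.
  have : (\int[Leb]_(x in normball r%:R) `|(EFin \o f) x| = 0)%E.
    apply/eqP; rewrite eq_le integral_ge0 ?andbT; last by move=> x _; exact: abse_ge0.
    apply/lee_addgt0Pr => d d0; rewrite add0e.
    have [_ /(_ r%:R d d0) [k _ /(_ k (leqnn k)) /=]] := loc_mollify_cvg C0 phiP lf.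
    apply: le_trans; rewrite le_eqVlt; apply/orP; left; apply/eqP.
    by apply: eq_integral => x _; rewrite mf0 sub0r normrN.
  move=> /(ae_eq_integral_abs _ mB mEf); apply: ae_imply => x Hx xB.
  by have /= := Hx xB => -[].
have := ae_foralln H; apply: ae_imply => x Hx.
apply: (Hx (Num.truncn `|x|).+1); rewrite /normball /=.
by apply: ltW; exact: truncnS_gt.
Qed.

Lemma loc_integrableB f g : loc_integrable f -> loc_integrable g ->
  loc_integrable (fun x => f x - g x).
Proof.
move=> lf lg; have -> : (fun x => f x - g x) = (fun x => f x + -1 * g x).
  by apply/funext => x; rewrite mulN1r.
exact: loc_integrableD lf (loc_integrableZ (-1) lg).
Qed.

Lemma is_weak_partial_unique j f g h : is_weak_partial j f g ->
  is_weak_partial j f h -> {ae Leb, forall x, g x = h x}.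
Proof.
move=> [lg Hg] [lh Hh].
have : {ae Leb, forall x, g x - h x = 0}.
  apply: ae_eq0_of_Ccoo; first exact: loc_integrableB.
  move=> phi cphi.
  have -> : \int[Leb]_x ((g x - h x) * phi x) = \int[Leb]_x (g x * phi x - h x * phi x).
    by apply: eq_Rintegral => x _; rewrite mulrBl.
  rewrite (RintegralB measurableT (loc_integrable_Ccoo lg cphi) (loc_integrable_Ccoo lh cphi)).
  by rewrite -[X in X - _]opprK -Hg// Hh// opprK subrr.
by apply: ae_imply => x /eqP; rewrite subr_eq0 => /eqP.
Qed.

Lemma weak_partialP j f g : is_weak_partial j f g -> is_weak_partial j f (weak_partial j f).
Proof. by move=> fg; rewrite /weak_partial; exact: (xgetI _ fg). Qed.

Lemma weak_partial_ae j f g : is_weak_partial j f g ->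
  {ae Leb, forall x, weak_partial j f x = g x}.
Proof. by move=> fg; exact: is_weak_partial_unique (weak_partialP fg) fg. Qed.

Lemma is_weak_partialB j f1 f2 g1 g2 : loc_integrable f1 -> loc_integrable f2 ->
  is_weak_partial j f1 g1 -> is_weak_partial j f2 g2 ->
  is_weak_partial j (fun x => f1 x - f2 x) (fun x => g1 x - g2 x).
Proof.
move=> lf1 lf2 [lg1 H1] [lg2 H2]; split; first exact: loc_integrableB.
move=> phi cphi; have cpart := Ccoo_partial j cphi.
have BE (a b psi : 'rV[R]_n -> R) : loc_integrable a -> loc_integrable b -> Ccoo psi ->
    \int[Leb]_x ((a x - b x) * psi x) = \int[Leb]_x (a x * psi x) - \int[Leb]_x (b x * psi x).
  move=> la lb cpsi.
  rewrite -(RintegralB measurableT (loc_integrable_Ccoo la cpsi) (loc_integrable_Ccoo lb cpsi)).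
  by apply: eq_Rintegral => x _; rewrite mulrBl.
by rewrite (BE _ _ _ lf1 lf2 cpart) (BE _ _ _ lg1 lg2 cphi) H1// H2// !opprB opprK addrC.
Qed.

End weak_uniqueness.

(** * Matrix norms *)

Section matrix_norms.
Context {R : realType}.

Lemma cauchy_schwarz_sum (I : finType) (a b : I -> R) :
  (\sum_i a i * b i) ^+ 2 <= (\sum_i a i ^+ 2) * (\sum_i b i ^+ 2).
Proof.
have S0 (c : I -> R) : 0 <= \sum_i c i ^+ 2 by apply: sumr_ge0 => i _; exact: sqr_ge0.
set s := \sum_i a i ^+ 2; set t := \sum_i b i ^+ 2; set u := \sum_i a i * b i.
(* The sum of the squares (s b_i - u a_i)^2 equals s (s t - u^2). *)
have H : 0 <= s * (s * t - u ^+ 2).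
  have <- : \sum_i (s * b i - u * a i) ^+ 2 = s * (s * t - u ^+ 2).
    rewrite (eq_bigr (fun i => s ^+ 2 * b i ^+ 2 + (- (2 * s * u) * (a i * b i) +
      u ^+ 2 * a i ^+ 2))); last by move=> i _; ring.
    by rewrite !big_split/= -!mulr_sumr -/s -/t -/u; ring.
  exact: S0.
have [s0|s0] := eqVneq s 0.
  have a0 i : a i = 0.
    have /psumr_eq0P/(_ i isT)/eqP : \sum_i a i ^+ 2 = 0 by [].
    by rewrite sqrf_eq0 => /(_ (fun i _ => sqr_ge0 _))/eqP.
  by rewrite s0 mul0r /u big1 ?expr0n// => i _; rewrite a0 mul0r.
by move: H; rewrite pmulr_rge0 ?subr_ge0// lt0r s0; exact: S0.
Qed.

Implicit Types (m k l : nat).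

Lemma enorm_ge0 m k (A : 'M[R]_(m, k)) : 0 <= enorm A.
Proof. exact: sqrtr_ge0. Qed.

Lemma sqr_enorm m k (A : 'M[R]_(m, k)) : enorm A ^+ 2 = \sum_i \sum_j A i j ^+ 2.
Proof.
by rewrite sqr_sqrtr// sumr_ge0// => i _; rewrite sumr_ge0// => j _; exact: sqr_ge0.
Qed.

Lemma enorm_le m k (A : 'M[R]_(m, k)) (c : R) : 0 <= c ->
  \sum_i \sum_j A i j ^+ 2 <= c ^+ 2 -> enorm A <= c.
Proof.
by move=> c0; rewrite -sqr_enorm => H; rewrite -(ler_pXn2r (_ : (0 < 2)%N))// nnegrE// enorm_ge0.
Qed.

Lemma norm_entry_le m k (A : 'M[R]_(m, k)) i j : `|A i j| <= enorm A.
Proof.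
rewrite -(ler_pXn2r (_ : (0 < 2)%N))// ?nnegrE ?enorm_ge0// sqr_enorm real_normK ?num_real//.
rewrite (bigD1 i)//= (bigD1 j)//= -addrA lerDl addr_ge0// sumr_ge0// => a _.
  exact: sqr_ge0.
by rewrite sumr_ge0// => b _; exact: sqr_ge0.
Qed.

Lemma enorm_le_sum m k (A : 'M[R]_(m, k)) : enorm A <= \sum_i \sum_j `|A i j|.
Proof.
apply: enorm_le; first by apply: sumr_ge0 => i _; exact: sumr_ge0.
have H (I : finType) (c : I -> R) : (forall i, 0 <= c i) ->
    \sum_i c i ^+ 2 <= (\sum_i c i) ^+ 2.
  move=> c0; rewrite expr2 mulr_suml; apply: ler_sum => i _.
  by rewrite expr2 ler_wpM2l// (bigD1 i)//= lerDl sumr_ge0.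
apply: le_trans (H _ _ _) => [|i]; last exact: sumr_ge0.
apply: ler_sum => i _; apply: le_trans (H _ _ _) => [|//].
by apply: ler_sum => j _; rewrite real_normK// num_real.
Qed.

Lemma enorm0 m k : enorm (0 : 'M[R]_(m, k)) = 0.
Proof.
rewrite /enorm big1 ?sqrtr0// => i _; rewrite big1// => j _.
by rewrite mxE expr0n.
Qed.

Lemma enormZ m k c (A : 'M[R]_(m, k)) : enorm (c *: A) = `|c| * enorm A.
Proof.
rewrite /enorm -[`|c|]sqrtr_sqr -sqrtrM ?sqr_ge0//.
congr Num.sqrt; rewrite mulr_sumr; apply: eq_bigr => i _.
by rewrite mulr_sumr; apply: eq_bigr => j _; rewrite mxE exprMn.
Qed.

Lemma enormN m k (A : 'M[R]_(m, k)) : enorm (- A) = enorm A.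
Proof. by rewrite -scaleN1r enormZ normrN1 mul1r. Qed.

Lemma enormD m k (A B : 'M[R]_(m, k)) : enorm (A + B) <= enorm A + enorm B.
Proof.
apply: enorm_le; first by rewrite addr_ge0// enorm_ge0.
have CS : \sum_i \sum_j A i j * B i j <= enorm A * enorm B.
  rewrite pair_big/=; apply: le_trans (ler_norm _) _.
  rewrite -(ler_pXn2r (_ : (0 < 2)%N))// ?nnegrE ?mulr_ge0 ?enorm_ge0//.
  rewrite real_normK ?num_real// exprMn !sqr_enorm !pair_big/=.
  exact: cauchy_schwarz_sum.
rewrite sqrrD !sqr_enorm.
under eq_bigr => i _ do under eq_bigr => j _ do rewrite mxE sqrrD.
under eq_bigr => i _ do rewrite !big_split/= -mulr2n.
by rewrite !big_split/= -mulr2n lerD2r lerD2l lerMn2r CS.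
Qed.

Lemma enormB m k (A B : 'M[R]_(m, k)) : enorm (A - B) <= enorm A + enorm B.
Proof. by apply: le_trans (enormD _ _) _; rewrite enormN. Qed.

Lemma enorm_mulmx m k l (A : 'M[R]_(m, k)) (B : 'M[R]_(k, l)) :
  enorm (A *m B) <= enorm A * enorm B.
Proof.
apply: enorm_le; first by rewrite mulr_ge0// enorm_ge0.
rewrite exprMn !sqr_enorm mulr_suml; apply: ler_sum => i _.
rewrite exchange_big/= mulr_sumr; apply: ler_sum => j _.
by rewrite mxE; exact: cauchy_schwarz_sum.
Qed.

Lemma opnorm_ge m k (A : 'M[R]_(m, k)) (v : 'cV_k) : enorm v <= 1 ->
  enorm (A *m v) <= opnorm A.
Proof.
move=> v1; apply: ub_le_sup; last by exists v.
exists (enorm A) => _ [w w1 <-]; apply: le_trans (enorm_mulmx _ _) _.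
by rewrite ler_piMr// enorm_ge0.
Qed.

Lemma opnorm_ge0 m k (A : 'M[R]_(m, k)) : 0 <= opnorm A.
Proof.
by apply: le_trans (opnorm_ge A (_ : enorm 0 <= 1)); rewrite ?enorm_ge0// enorm0.
Qed.

Lemma opnorm_le_enorm m k (A : 'M[R]_(m, k)) : opnorm A <= enorm A.
Proof.
apply: ge_sup; first by exists (enorm (A *m (0 : 'cV_k))), 0 => //=; rewrite enorm0.
move=> _ [w w1 <-]; apply: le_trans (enorm_mulmx _ _) _.
by rewrite ler_piMr// enorm_ge0.
Qed.

Lemma norm_entry_le_opnorm m k (A : 'M[R]_(m, k)) i j : `|A i j| <= opnorm A.
Proof.
have e1 : enorm (delta_mx j 0 : 'cV[R]_k) <= 1.
  apply: enorm_le => //; rewrite (bigD1 j)//= big_ord1 mxE !eqxx/= big1 ?addr0//.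
  by move=> a aj; rewrite big_ord1 mxE (negbTE aj)/= expr0n.
apply: le_trans (opnorm_ge A e1); rewrite -colE.
by have := norm_entry_le (col j A) i 0; rewrite mxE.
Qed.

Lemma enorm_le_opnorm m k (A : 'M[R]_(m, k)) : enorm A <= (m * k)%:R * opnorm A.
Proof.
apply: le_trans (enorm_le_sum _) _.
apply: (@le_trans _ _ (\sum_(i < m) \sum_(j < k) opnorm A)).
  by apply: ler_sum => i _; apply: ler_sum => j _; exact: norm_entry_le_opnorm.
by rewrite !sumr_const !card_ord -mulrnA mulr_natl mulnC.
Qed.

Lemma enorm_mul_cst m (A : 'M[R]_m) (c : R) : enorm (A *m c%:M) = `|c| * enorm A.
Proof. by rewrite mul_mx_scalar enormZ. Qed.

End matrix_norms.

Section measurable_matrix.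
Context d (T : measurableType d) {R : realType}.
Implicit Types (m k l : nat).

Definition measurable_mx {m k} (A : T -> 'M[R]_(m, k)) :=
  forall i j, measurable_fun [set: T] (fun x => A x i j).

Lemma measurable_sqrtf (f : T -> R) : measurable_fun setT f ->
  (forall x, 0 <= f x) -> measurable_fun setT (fun x => Num.sqrt (f x)).
Proof.
move=> mf f0; have -> : (fun x => Num.sqrt (f x)) = (fun x => f x `^ 2^-1).
  by apply/funext => x; rewrite powR12_sqrt.
exact: (measurableT_comp (measurable_powR _) mf).
Qed.

Lemma measurable_inv (f : T -> R) : measurable_fun setT f ->
  measurable_fun setT (fun x => (f x)^-1).
Proof.
move=> mf.
(* The right-hand side agrees with the inverse also at 0, where both are 0, and real powers are
   known to be measurable. *)
have -> : (fun x => (f x)^-1) = (fun x => f x * (f x ^+ 2) `^ (-1)).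
  apply/funext => x; rewrite powR_inv1 ?sqr_ge0//.
  by have [->|x0] := eqVneq (f x) 0; [rewrite invr0 mul0r|field].
apply: measurable_funM => //.
exact: (measurableT_comp (measurable_powR _) (measurable_funX 2 mf)).
Qed.

Lemma measurable_enorm m k (A : T -> 'M[R]_(m, k)) : measurable_mx A ->
  measurable_fun setT (fun x => enorm (A x)).
Proof.
move=> mA; apply: measurable_sqrtf; last first.
  by move=> x; rewrite -sqr_enorm sqr_ge0.
by apply: measurable_sum => i; apply: measurable_sum => j; exact: measurable_funX.
Qed.

Lemma measurable_mulmx m k l (A : T -> 'M[R]_(m, k)) (B : T -> 'M[R]_(k, l)) :
  measurable_mx A -> measurable_mx B -> measurable_mx (fun x => A x *m B x).
Proof.
move=> mA mB i j.
have -> : (fun x => (A x *m B x) i j) = (fun x => \sum_a A x i a * B x a j).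
  by apply/funext => x; rewrite mxE.
by apply: measurable_sum => a; exact: measurable_funM.
Qed.

Lemma measurable_det m (A : T -> 'M[R]_m) : measurable_mx A ->
  measurable_fun setT (fun x => \det (A x)).
Proof.
move=> mA; rewrite /determinant.
apply: measurable_sum => s; apply: measurable_funM; first exact: measurable_cst.
by apply: measurable_prod => i _; exact: mA.
Qed.

Lemma measurable_mxB m k (A B : T -> 'M[R]_(m, k)) : measurable_mx A ->
  measurable_mx B -> measurable_mx (fun x => A x - B x).
Proof.
move=> mA mB i j; have -> : (fun x => (A x - B x) i j) = (fun x => A x i j - B x i j).
  by apply/funext => x; rewrite !mxE.
exact: measurable_funB.
Qed.

Lemma measurable_mxZ m k (c : T -> R) (A : T -> 'M[R]_(m, k)) :
  measurable_fun setT c -> measurable_mx A -> measurable_mx (fun x => c x *: A x).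
Proof.
move=> mc mA i j; have -> : (fun x => (c x *: A x) i j) = (fun x => c x * A x i j).
  by apply/funext => x; rewrite !mxE.
exact: measurable_funM.
Qed.

Lemma measurable_adj m (A : T -> 'M[R]_m) : measurable_mx A ->
  measurable_mx (fun x => \adj (A x)).
Proof.
move=> mA i j.
have -> : (fun x => (\adj (A x)) i j) =
    (fun x => (-1) ^+ (j + i) * \det (row' j (col' i (A x)))).
  by apply/funext => x; rewrite mxE.
apply: measurable_funM; first exact: measurable_cst.
apply: measurable_det => a b.
have -> : (fun x => (row' j (col' i (A x))) a b) = (fun x => A x (lift j a) (lift i b)).
  by apply/funext => x; rewrite !mxE.
exact: mA.
Qed.

Lemma measurable_mx_cst m k (A : 'M[R]_(m, k)) : measurable_mx (fun _ : T => A).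
Proof. by move=> i j; exact: measurable_cst. Qed.

End measurable_matrix.

Section cramer_inverse.
Context {R : realType} {m : nat}.
Implicit Types A B : 'M[R]_m.

(* Unlike [invmx], it vanishes on singular matrices. *)
Definition crinv A := (\det A)^-1 *: \adj A.

Lemma crinvK A (k : nat) (B : 'M[R]_(m, k)) : \det A != 0 ->
  crinv A *m (A *m B) = B.
Proof.
move=> A0; rewrite mulmxA /crinv -scalemxAl mul_adj_mx -mul_scalar_mx -scalar_mxM.
by rewrite mulVf// mul1mx.
Qed.

(** Where A is singular the left side is 0 whatever [invmx] returns. This bounds a visibly
    measurable kernel by the one of the A_p condition. *)
Lemma enorm_crinv_le A B : enorm (B *m crinv A) <= (m * m)%:R * opnorm (B *m invmx A).
Proof.
have [A0|A0] := eqVneq (\det A) 0.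
  by rewrite /crinv A0 invr0 scale0r mulmx0 enorm0 mulr_ge0// opnorm_ge0.
apply: le_trans (enorm_le_opnorm _) _.
by rewrite /crinv /invmx unitmxE unitfE A0.
Qed.

Lemma measurable_crinv d (T : measurableType d) (A : T -> 'M[R]_m) :
  measurable_mx A -> measurable_mx (fun x => crinv (A x)).
Proof.
move=> mA; apply: measurable_mxZ; last exact: measurable_adj.
by apply: measurable_inv; exact: measurable_det.
Qed.

Lemma pdmx_det A : pdmx A -> \det A != 0.
Proof.
move=> [AT Apos]; apply/negP => /det0P[v v0 vA].
have : 0 < ((v^T)^T *m A *m v^T) 0 0.
  by apply: Apos; rewrite -(inj_eq trmx_inj) trmxK trmx0.
by rewrite trmxK vA mul0mx mxE ltxx.
Qed.

End cramer_inverse.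

(** * The variable exponent modular and the A_p condition *)

Section young_integral.
Context d (T : measurableType d) (R : realType) (mu : {measure set T -> \bar R}).
Implicit Types (k h q : T -> R) (D : set T).
Local Open Scope ereal_scope.

(** Young's inequality at each point where q > 1. Where q = 1 the conjugate modular is a supremum,
    and the hypothesis k <= 1 stands for it. *)
Lemma young_integral D k h q : measurable D -> measurable_fun setT k ->
  measurable_fun setT h -> measurable_fun setT q ->
  (forall x, 0 <= k x)%R -> (forall x, 0 <= h x)%R -> (forall x, 1 <= q x)%R ->
  {ae mu, forall x, D x -> q x = 1%R -> (k x <= 1)%R} ->
  \int[mu]_(x in D) (h x `^ q x)%:E <= 1 ->
  \int[mu]_(x in D) (if q x == 1%R then 0%R else k x `^ (q x / (q x - 1)))%:E <= 1 ->
  \int[mu]_(x in D) (k x * h x)%:E <= 2%:E.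
Proof.
move=> mD mk mh mq k0 h0 q1 k1 H1 H2.
pose G x : R := (if q x == 1 then 0 else k x `^ (q x / (q x - 1)))%R.
have G0 x : (0 <= G x)%R by rewrite /G; case: ifP => // _; exact: powR_ge0.
have mG : measurable_fun setT G.
  apply: measurable_fun_ifT => //.
    by apply: measurable_fun_eqr => //; exact: measurable_cst.
  apply: measurable_powR2 => //; apply: measurable_funM => //.
  by apply: measurable_inv; apply: measurable_funB => //; exact: measurable_cst.
have mE (f : T -> R) : measurable_fun setT f -> measurable_fun D (fun x => (f x)%:E).
  by move=> mf; apply/measurable_EFinP; exact: measurable_funS mf.
apply: (@le_trans _ _ (\int[mu]_(x in D) (h x `^ q x + G x)%:E)).
  apply: ae_ge0_le_integral => //.
  - by move=> x _; rewrite lee_fin mulr_ge0.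
  - by apply: mE; exact: measurable_funM.
  - by move=> x _; rewrite lee_fin addr_ge0// powR_ge0.
  - by apply: mE; apply: measurable_funD => //; exact: measurable_powR2.
  apply: ae_imply k1 => x k1 Dx; rewrite lee_fin /G.
  have [qx|qx] := eqVneq (q x) 1%R.
    by rewrite qx powRr1// addr0 ler_piMl// k1.
  by rewrite mulrC young_le// lt_neqAle eq_sym qx q1.
under eq_integral do rewrite EFinD.
rewrite ge0_integralD//.
- by rewrite -[2%R]/(1 + 1)%R EFinD leeD.
- by move=> x _; rewrite lee_fin powR_ge0.
- by apply: mE; exact: measurable_powR2.
- by move=> x _; rewrite lee_fin.
- exact: mE.
Qed.

Lemma integral_powR_scale D (f q : T -> R) (P c : R) : measurable D ->
  measurable_fun setT f -> measurable_fun setT q -> (forall x, 0 <= f x)%R ->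
  (forall x, 1 <= q x <= P)%R -> (1 <= c)%R ->
  \int[mu]_(x in D) ((c * f x) `^ q x)%:E <= (c `^ P)%:E * \int[mu]_(x in D) (f x `^ q x)%:E.
Proof.
move=> mD mf mq f0 qP c1.
rewrite -ge0_integralZl//; last 3 first.
- by apply/measurable_EFinP; apply: measurable_funS (measurable_powR2 mf mq).
- by move=> x _; rewrite lee_fin powR_ge0.
- by rewrite lee_fin powR_ge0.
apply: ge0_le_integral_lower => x _; first by rewrite lee_fin powR_ge0.
by have /andP[? ?] := qP x; rewrite -EFinM lee_fin powR_le_powC.
Qed.

End young_integral.

Section poweR_monotone.
Context {R : realType}.

Lemma le_poweR (x y : \bar R) (r : R) : 0 <= r -> (0 <= x)%E -> (x <= y)%E ->
  (x `^ r <= y `^ r)%E.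
Proof.
move=> r0 x0 xy; apply: gt0_ler_poweR => //.
  by rewrite in_itv/= x0 leey.
by rewrite in_itv/= leey andbT (le_trans x0).
Qed.

End poweR_monotone.

Section modular.
Context {R : realType} {n : nat}.
Local Notation Leb := (lebesgueRn R n).
Implicit Types (p : 'rV[R]_n -> \bar R) (q : 'rV[R]_n -> R).

Lemma cube_sub_box (a : 'rV[R]_n) l : 0 < l ->
  cube a l `<=` (box (a - const_mx l) (a + const_mx l) : set (Rn R n)).
Proof. by move=> l0 x ax i; have := ax i; rewrite !mxE => /andP[? ?]; apply/andP; split; lra. Qed.

Lemma box_sub_cube (a : 'rV[R]_n) l :
  (box a (a + const_mx l) : set (Rn R n)) `<=` cube a l.
Proof. by move=> x ax i; have := ax i; rewrite !mxE => /andP[? ?]; apply/andP; split; lra. Qed.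

Lemma box_volE (a b : 'rV[R]_n) (l : R) : 0 <= l ->
  (forall i, b 0 i - a 0 i = l) -> box_vol a b = (l ^+ n)%:E.
Proof.
move=> l0 ab; congr EFin; rewrite -[X in _ ^+ X](card_ord n) -prodr_const.
by apply: eq_bigr => i _; rewrite ab; apply/max_idPl.
Qed.

(** The closed cube is squeezed between half-open boxes of sides l and 2 l; the factor 2^n is
    absorbed in later constants. *)
Lemma lebesgueRn_cube (a : 'rV[R]_n) l : 0 < l ->
  ((l ^+ n)%:E <= Leb (cube a l) <= ((2 * l) ^+ n)%:E)%E.
Proof.
move=> l0; apply/andP; split.
  rewrite -(@box_volE a (a + const_mx l)) ?(ltW l0)//; last first.
    by move=> i; rewrite !mxE addrC addrK.
  rewrite -lebesgue_outer_box; apply: le_lebesgue_outer; exact: box_sub_cube.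
rewrite -(@box_volE (a - const_mx l) (a + const_mx l)) ?mulr_ge0 ?(ltW l0)//; last first.
  by move=> i; rewrite !mxE; lra.
by rewrite -lebesgue_outer_box; apply: le_lebesgue_outer; exact: cube_sub_box.
Qed.

Lemma lebesgueRn_setT_gt0 : (0 < Leb setT)%E.
Proof.
have /andP[H _] := @lebesgueRn_cube 0 1 ltr01.
apply: (@lt_le_trans _ _ (Leb (cube 0 1))).
  by apply: lt_le_trans H; rewrite expr1n.
exact: le_lebesgue_outer.
Qed.

(** The condition at infinity makes p finite at every point and bounded by poo + |Coo|, since log (e
    + |x|) >= 1. Afterwards only the real exponent q, its bound P and the local modulus of
    continuity are carried along. *)
Lemma log_hoelder_real p : exponent p -> log_hoelder p ->
  exists (q : 'rV[R]_n -> R) (P C : R), [/\ p = EFin \o q, measurable_fun [set: Rn R n] q,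
    (forall x, 1 <= q x <= P), 0 <= C &
    forall x y, 0 < enorm (x - y) < 1 / 2 ->
      `|q x - q y| <= C / - ln (enorm (x - y))].
Proof.
move=> [mp p1] [C0 [Coo [poo [H0 Hoo]]]].
have fp x : p x \is a fin_num.
  have := Hoo x; have := p1 x; case: (p x) => [r| |]//.
pose q x := fine (p x).
have pq : p = EFin \o q by apply/funext => x; rewrite /= /q fineK.
exists q, (poo + `|Coo|), `|C0|; split => //.
- by apply: measurableT_comp mp; exact: fine_measurable.
- move=> x; have := p1 x; have := Hoo x; rewrite pq /= => H; rewrite lee_fin => q1; rewrite q1.
  move: H; rewrite lee_fin /= => H.
  have e1 : 1 <= ln (expR 1 + enorm x).
    rewrite -[X in X <= _](expRK 1) ler_ln ?posrE ?expR_gt0//.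
      by rewrite lerDl enorm_ge0.
    by rewrite ltr_pwDl ?expR_gt0// enorm_ge0.
  rewrite -lerBlDl (le_trans (ler_norm _))// (le_trans H)// (le_trans (ler_norm _))//.
  rewrite normrM normfV ler_pdivrMr ?normr_gt0; last by rewrite gt_eqF// (lt_le_trans _ e1).
  by rewrite ler_peMr// (le_trans e1)// ler_norm.
- move=> x y xy; have := H0 _ _ xy.
  rewrite pq /= lee_fin => /le_trans; apply.
  rewrite ler_wpM2r ?ler_norm// invr_ge0 oppr_ge0 ln_le0//.
  by case/andP: xy => _ /ltW/le_trans; apply; lra.
Qed.

Lemma modularE q (f : 'rV[R]_n -> \bar R) :
  modular (EFin \o q) f = (\int[Leb]_x (`|f x| `^ q x))%E.
Proof.
rewrite /modular.
have -> : [set x : Rn R n | ((EFin \o q) x < +oo)%E] = setT.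
  by apply/seteqP; split => // x _ /=; rewrite ltry.
have -> : (fun x : Rn R n => `|f x|%E) \_ [set x | (EFin \o q) x = +oo%E] = cst 0%E.
  by apply/funext => x; rewrite patchE memNset.
by rewrite ess_sup_cst ?adde0//; exact: lebesgueRn_setT_gt0.
Qed.

Lemma modular_real q (g : 'rV[R]_n -> R) (l : R) :
  (modular (EFin \o q) (fun x => (l^-1)%:E * (g x)%:E) =
  \int[Leb]_x ((`|l^-1 * g x| `^ q x)%:E))%E.
Proof. by rewrite modularE; apply: eq_integral => x _; rewrite -EFinM abse_EFin poweR_EFin. Qed.

Lemma lpnorm_le p f l : 0 < l -> (modular p (fun x => (l^-1)%:E * f x) <= 1)%E ->
  (lpnorm p f <= l%:E)%E.
Proof. by move=> l0 H; apply: ereal_inf_lbound; exists l. Qed.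

Lemma lpnorm_lt p f x : (lpnorm p f < x)%E -> exists l, [/\ 0 < l, (l%:E < x)%E &
  (modular p (fun x => (l^-1)%:E * f x) <= 1)%E].
Proof. by move=> /ereal_inf_lt[_ [l [l0 H] <-] lx]; exists l. Qed.

Lemma lpnorm_ge0 p f : (0 <= lpnorm p f)%E.
Proof. by apply: le_ereal_inf_tmp => _ [l [l0 _] <-]; rewrite lee_fin ltW. Qed.

Context (q : 'rV[R]_n -> R) (P : R).
Hypothesis mq : measurable_fun [set: Rn R n] q.
Hypothesis qP : forall x, 1 <= q x <= P.

Let q0 x : 0 <= q x. Proof. by have /andP[] := qP x; lra. Qed.

Lemma integral_powR_lty (D : set (Rn R n)) (g : 'rV[R]_n -> R) (l : R) : measurable D ->
  measurable_fun [set: Rn R n] g -> (forall x, 0 <= g x) -> 0 < l ->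
  (\int[Leb]_(x in D) ((l^-1 * g x) `^ q x)%:E < +oo)%E ->
  (\int[Leb]_(x in D) ((g x) `^ q x)%:E < +oo)%E.
Proof.
move=> mD mg g0 l0 H.
pose c := Num.max 1 l; have c1 : 1 <= c by rewrite le_max lexx.
have c0 : 0 < c by lra.
have mlg : measurable_fun [set: Rn R n] (fun x => l^-1 * g x).
  by apply: measurable_funM => //; exact: measurable_cst.
have lg0 x : 0 <= l^-1 * g x by rewrite mulr_ge0// invr_ge0 ltW.
apply: le_lt_trans (_ : ((c `^ P)%:E * \int[Leb]_(x in D) ((l^-1 * g x) `^ q x)%:E < +oo)%E); last first.
  by rewrite lte_mul_pinfty// lee_fin powR_ge0.
apply: (le_trans _ (integral_powR_scale Leb mD mlg mq lg0 qP c1)).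
apply: ge0_le_integral_lower => x _; first by rewrite lee_fin powR_ge0.
rewrite lee_fin ge0_ler_powR// ?nnegrE//; first by rewrite mulr_ge0// ltW.
by rewrite mulrA ler_peMl// ler_pdivlMr// mul1r le_max lexx orbT.
Qed.

Lemma lpnorm_lty_int (f g : 'rV[R]_n -> R) c : measurable_fun [set: Rn R n] g -> 0 <= c ->
  (forall x, 0 <= g x) -> (forall x, g x <= c * `|f x|) ->
  (lpnorm (EFin \o q) (EFin \o f) < +oo)%E ->
  (\int[Leb]_x ((g x) `^ q x)%:E < +oo)%E.
Proof.
move=> mg c0 g0 gf /lpnorm_lt[l [l0 _]]; rewrite modular_real => H.
have c1 : 0 < c + 1 by lra.
apply: (integral_powR_lty measurableT mg g0 (mulr_gt0 c1 l0)).
apply: le_lt_trans (ltry 1); apply: le_trans H.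
apply: ge0_le_integral_lower => x _; first by rewrite lee_fin powR_ge0.
rewrite lee_fin ge0_ler_powR// ?nnegrE//.
  by rewrite mulr_ge0// invr_ge0 mulr_ge0 ?ltW.
rewrite normrM (gtr0_norm (_ : 0 < l^-1)) ?invr_gt0//.
rewrite invfM -mulrA mulrCA ler_pM2l ?invr_gt0// ler_pdivrMl//.
by apply: (le_trans (gf x)); rewrite ler_wpM2r//; lra.
Qed.

(** For a bounded exponent, small modular implies small norm; the measurable majorant g stands in
    for the possibly unmeasured operator norm. *)
Lemma lpnorm_small (e : R) : 0 < e -> exists2 t : R, 0 < t &
  forall f g : 'rV[R]_n -> R, measurable_fun [set: Rn R n] g ->
  (forall x, `|f x| <= g x) -> (\int[Leb]_x ((g x) `^ q x)%:E <= t%:E)%E ->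
  (lpnorm (EFin \o q) (EFin \o f) <= e%:E)%E.
Proof.
(* Dividing by e multiplies the modular by at most c^P, whence the threshold c^-P. *)
move=> e0; pose c := Num.max 1 e^-1; have c1 : 1 <= c by rewrite le_max lexx.
have cP : 0 < c `^ P by rewrite powR_gt0; lra.
exists (c `^ P)^-1; first by rewrite invr_gt0.
move=> f g mg fg Ht; apply: lpnorm_le => //; rewrite modular_real.
have g0 x : 0 <= g x := le_trans (normr_ge0 _) (fg x).
apply: (@le_trans _ _ ((c `^ P)%:E * (c `^ P)^-1%:E)%E); last first.
  by rewrite -EFinM divff// gt_eqF.
apply: le_trans (lee_wpmul2l _ Ht); last by rewrite lee_fin ltW.
apply: (le_trans _ (integral_powR_scale Leb measurableT mg mq g0 qP c1)).
apply: ge0_le_integral_lower => x _; first by rewrite lee_fin powR_ge0.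
rewrite lee_fin ge0_ler_powR// ?nnegrE//; first by rewrite mulr_ge0//; lra.
rewrite normrM ler_pM// gtr0_norm ?invr_gt0//.
by rewrite le_max lexx orbT.
Qed.

Lemma lpnorm_lty (f g : 'rV[R]_n -> R) : measurable_fun [set: Rn R n] g ->
  (forall x, `|f x| <= g x) -> (\int[Leb]_x ((g x) `^ q x)%:E < +oo)%E ->
  (lpnorm (EFin \o q) (EFin \o f) < +oo)%E.
Proof.
move=> mg fg; have g0 x : 0 <= g x := le_trans (normr_ge0 _) (fg x).
set I := (\int[Leb]_x _)%E => Ioo.
have I0 : (0 <= I)%E by apply: integral_ge0 => x _; rewrite lee_fin powR_ge0.
have fI : I \is a fin_num by rewrite ge0_fin_numE.
(* As l >= 1 and q >= 1, dividing the function by l divides the modular by at least l. *)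
pose l := Num.max 1 (fine I); have l1 : 1 <= l by rewrite le_max lexx.
have l0 : 0 < l by lra.
apply: le_lt_trans (ltry l); apply: lpnorm_le => //; rewrite modular_real.
have lI : (l^-1%:E * I <= 1)%E.
  by rewrite -(fineK fI) -EFinM lee_fin ler_pdivrMl// mulr1 le_max lexx orbT.
have li0 : 0 <= l^-1 by rewrite invr_ge0 ltW.
apply: le_trans lI; rewrite -(integral_EFinZl _ measurableT li0 (measurable_powR2 mg mq)); last first.
  by move=> x; exact: powR_ge0.
apply: le_integral_EFin => x _; first exact: powR_ge0.
rewrite normrM powRM// ?normr_ge0//.
apply: ler_pM; rewrite ?powR_ge0//; last by rewrite ge0_ler_powR// nnegrE.
rewrite gtr0_norm ?invr_gt0// -[leRHS]powRr1 ?invr_ge0 ?(ltW l0)//.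
rewrite ger_powR ?invr_gt0 ?l0 ?invf_le1//.
by have /andP[] := qP x.
Qed.

End modular.

(** * Hoelder's inequality and averaging under the A_p condition *)

Section kernel_hoelder.
Context {R : realType} {n : nat}.
Local Notation Leb := (lebesgueRn R n).
Context (q : 'rV[R]_n -> R) (P : R).
Hypothesis mq : measurable_fun [set: Rn R n] q.
Hypothesis qP : forall x, 1 <= q x <= P.

Let p' (y : 'rV[R]_n) : \bar R := hoelder_conjugate (q y)%:E.

Lemma hoelder_conjugate_gt1 (r : R) : 1 < r ->
  hoelder_conjugate r%:E = (r / (r - 1))%:E.
Proof.
move=> r1; rewrite /hoelder_conjugate /= eqe gt_eqF//; last by lra.
by rewrite -EFinB inver subr_eq0 gt_eqF// -EFinM.
Qed.

(** Here [o] is the kernel of the A_p condition and [k] a measurable kernel below it. For every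
    level l admissible in the norm of [o], Young's inequality for k / l and h gives at most 2; the
    infimum over l yields the claim. *)
Lemma kernel_hoelder (Q : set (Rn R n)) (k o h : 'rV[R]_n -> R) : measurable Q ->
  measurable_fun [set: Rn R n] k -> measurable_fun [set: Rn R n] h ->
  (forall y, 0 <= k y <= o y) -> (forall y, 0 <= h y) ->
  (\int[Leb]_(y in Q) (h y `^ q y)%:E <= 1)%E ->
  (\int[Leb]_(y in Q) (2^-1 * (k y * h y))%:E <= lpnorm p' (fun y => (o y * \1_Q y)%:E))%E.
Proof.
move=> mQ mk mh ko h0 hq; apply: le_ereal_inf_tmp => _ [l [l0 H] <-].
have k0 y : 0 <= k y by have /andP[] := ko y.
have o0 y : 0 <= o y by have /andP[? ?] := ko y; lra.
have li0 : 0 <= l^-1 by rewrite invr_ge0 ltW.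
rewrite /modular in H; set I := (\int[Leb]_(x in _) _)%E in H.
set S := ess_sup _ _ in H.
have I0 : (0 <= I)%E by apply: integral_ge0 => x _; exact: poweR_ge0.
have S0 : (0 <= S)%E.
  apply: ess_sup_gee; first exact: lebesgueRn_setT_gt0.
  by apply: aeW => x; rewrite patchE; case: ifP.
have I1 : (I <= 1)%E by apply: le_trans H; rewrite leeDl.
have S1 : (S <= 1)%E by apply: le_trans H; rewrite leeDr.
have mlk : measurable_fun [set: Rn R n] (fun y => l^-1 * k y).
  by apply: measurable_funM => //; exact: measurable_cst.
have lk0 y : 0 <= l^-1 * k y by rewrite mulr_ge0.
have Y : (\int[Leb]_(y in Q) ((l^-1 * k y) * h y)%:E <= 2%:E)%E.
  apply: (young_integral mQ mlk mh mq lk0 h0 _ _ hq) => [x||].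
  - by have /andP[] := qP x.
  (* Where q = 1 the conjugate exponent is infinite, and the essential supremum in the modular
     supplies the bound by 1. *)
  - move/ess_supP: S1; apply: ae_imply => x + Qx qx.
    have p'x : p' x = +oo%E by rewrite /p' qx hoelder_conjugate1.
    rewrite patchE mem_set// indicE mem_set// mulr1 -EFinM abse_EFin lee_fin.
    apply: le_trans; apply: le_trans (ler_norm _).
    by rewrite ler_wpM2l//; have /andP[] := ko x.
  - apply: le_trans I1; rewrite /I integral_mkcond [leRHS]integral_mkcond.
    apply: ge0_le_integral_lower => x _.
      by rewrite patchE; case: ifP => // _; rewrite lee_fin; case: ifP => // _; exact: powR_ge0.
    rewrite !patchE; case: (boolP (x \in Q)) => [/set_mem Qx|_]; last first.
      by case: ifP => // _; exact: poweR_ge0.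
    have [qx|qx] := eqVneq (q x) 1.
      by case: ifP => // _; exact: poweR_ge0.
    have q1 : 1 < q x by rewrite lt_neqAle eq_sym qx; have /andP[] := qP x.
    have p'x : p' x = (q x / (q x - 1))%:E := hoelder_conjugate_gt1 q1.
    rewrite ifT; last by rewrite mem_set//= p'x ltry.
    rewrite p'x indicE mem_set// mulr1 -EFinM abse_EFin poweR_EFin lee_fin.
    rewrite ge0_ler_powR ?nnegrE// ?divr_ge0//; try lra.
    by apply: le_trans (ler_norm _); rewrite ler_wpM2l//; have /andP[] := ko x.
have -> : (\int[Leb]_(y in Q) (2^-1 * (k y * h y))%:E =
    \int[Leb]_(y in Q) (l / 2 * ((l^-1 * k y) * h y))%:E)%E.
  by apply: eq_integral => y _; congr EFin; field; rewrite gt_eqF.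
have l20 : 0 <= l / 2 by rewrite divr_ge0// ltW.
rewrite (integral_EFinZl _ mQ l20 (measurable_funM mlk mh)); last first.
  by move=> y; rewrite mulr_ge0.
apply: le_trans (lee_wpmul2l _ Y) _; first by rewrite lee_fin divr_ge0// ltW.
by rewrite -EFinM lee_fin divfK.
Qed.

End kernel_hoelder.

Section Ap_averaging.
Context {R : realType} {n m : nat}.
Local Notation Leb := (lebesgueRn R n).
Context (q : 'rV[R]_n -> R) (P : R) (W : 'rV[R]_n -> 'M[R]_m).
Hypothesis mq : measurable_fun [set: Rn R n] q.
Hypothesis qP : forall x, 1 <= q x <= P.
Hypothesis mW : measurable_mx (W : Rn R n -> 'M[R]_m).

(** A measurable substitute for |W(x) W(y)^-1|: Frobenius norm for operator norm, Cramer's formula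
    for [invmx]. *)
Definition Ap_kernel (x y : 'rV[R]_n) : R := enorm (W x *m crinv (W y)).

Definition Ap_inner (Q : set (Rn R n)) (x : 'rV[R]_n) : \bar R :=
  lpnorm (fun y => hoelder_conjugate (q y)%:E)
    (fun y => (opnorm (W x *m invmx (W y)) * \1_Q y)%:E).

(** The A_p condition with |Q| replaced by l^n. The inequality is strict so that the infimum
    defining the norm has an admissible level below A l^n. *)
Definition Ap_bound (A : R) := 0 < A /\ forall a l, 0 < l ->
  (lpnorm (EFin \o q) (fun x => Ap_inner (cube a l) x * (\1_(cube a l) x)%:E)
    < (A * l ^+ n)%:E)%E.

Lemma Ap_bound_exists : (Ap_const (EFin \o q) W < +oo)%E -> exists A, Ap_bound A.
Proof.
set S := Ap_const _ _ => Soo.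
pose A0 : R := Num.max (fine S) 0 + 1.
have A0_gt0 : 0 < A0 by rewrite ltr_wpDl// le_max lexx orbT.
have SA : (S <= A0%:E)%E.
  move: Soo; rewrite /A0; case: (S) => [s| |]// _; last exact: leNye.
  by rewrite lee_fin/= ler_wpDr// le_max lexx.
(* The factor 2^n comes from |Q| <= (2 l)^n, and the 1 makes the inequality strict. *)
exists (A0 * 2 ^+ n + 1); split; first by rewrite ltr_wpDl// mulr_ge0 ?ltW// exprn_gt0.
move=> a l l0.
have /andP[v1 v2] := lebesgueRn_cube a l0.
set Q := cube a l in v1 v2 *.
have fv : Leb Q \is a fin_num.
  by rewrite ge0_fin_numE ?measure_ge0// (le_lt_trans v2)// ltry.
pose v := fine (Leb Q).
have vE : Leb Q = v%:E by rewrite fineK.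
move: v1 v2; rewrite vE !lee_fin => v1 v2.
have l_n : 0 < l ^+ n by rewrite exprn_gt0.
have v0 : 0 < v by lra.
set N := lpnorm _ _.
have : ((Leb Q)^-1 * N <= S)%E by apply: ereal_sup_ubound; exists Q => //; exists a => //; exists l.
have N0 : (0 <= N)%E := lpnorm_ge0 _ _.
move=> /le_trans/(_ SA); rewrite vE inver gt_eqF//.
case: N N0 => [r r0| _|//]; last by rewrite gt0_muley ?lte_fin ?invr_gt0// leye_eq.
rewrite -EFinM lee_fin lte_fin ler_pdivrMl// => H.
apply: (le_lt_trans H).
apply: (@le_lt_trans _ _ ((A0 * 2 ^+ n) * l ^+ n)); last by rewrite ltr_pM2r// ltrDl.
by rewrite mulrC -mulrA ler_pM2l// -exprMn.
Qed.

Context (A : R).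
Hypothesis AP : Ap_bound A.
(** The constant of [enorm_crinv_le], increased by 1 so that it is positive for every m. *)
Let D : R := (m * m)%:R + 1.

Let D0 : 0 < D. Proof. by rewrite ltr_wpDl. Qed.

Lemma measurable_Ap_kernel x : measurable_fun [set: Rn R n] (Ap_kernel x).
Proof.
apply: measurable_enorm; apply: measurable_mulmx; first exact: measurable_mx_cst.
exact: measurable_crinv.
Qed.

(** At each x of Q0 the Hoelder inequality for the kernel bounds g(x) / (2 c D lam) by the inner
    norm of the A_p condition; the outer norm of that function is below A l^n, so the modular is at
    most 1. The set Q0 may be smaller than the cube, because a cell is estimated by its doubled
    cell. *)
Lemma Ap_averaging (Q0 : set (Rn R n)) a l (c lam : R) (g h : 'rV[R]_n -> R) :
  0 < l -> 0 < c -> 0 < lam -> measurable_fun [set: Rn R n] h ->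
  (forall y, 0 <= h y) -> (forall x, 0 <= g x) -> Q0 `<=` cube a l ->
  (\int[Leb]_(y in cube a l) ((lam^-1 * h y) `^ q y)%:E <= 1)%E ->
  (forall x, Q0 x -> ((g x)%:E <= c%:E * \int[Leb]_(y in cube a l) (Ap_kernel x y * h y)%:E)%E) ->
  (\int[Leb]_(x in Q0) (((2 * c * D * lam * (A * l ^+ n))^-1 * g x) `^ q x)%:E <= 1)%E.
Proof.
move=> l0 c0 lam0 mh h0 g0 Q0Q Hh Hg.
have [A0 HA] := AP; have [mu [mu0 mulA Hmu]] := lpnorm_lt (HA a l l0).
move: Hmu; rewrite modularE; apply: le_trans.
rewrite integral_mkcond; apply: ge0_le_integral_lower => x _.
  by rewrite patchE; case: ifP => // _; rewrite lee_fin powR_ge0.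
rewrite patchE; case: (boolP (x \in Q0)) => [/set_mem Q0x|_]; last exact: poweR_ge0.
have Qx := Q0Q _ Q0x.
rewrite indicE mem_set// mule1.
set kap := Ap_inner _ _.
have kap0 : (0 <= kap)%E := lpnorm_ge0 _ _.
rewrite gee0_abs; last by rewrite mule_ge0// lee_fin invr_ge0 ltW.
have mQ : measurable (cube a l : set (Rn R n)) := measurable_cube a l.
have E0 : 0 < 2 * c * D * lam by rewrite !mulr_gt0.
have Ln : 0 < A * l ^+ n by rewrite mulr_gt0// exprn_gt0.
have key : (((2 * c * D * lam)^-1 * g x)%:E <= kap)%E.
  have Hk : (\int[Leb]_(y in cube a l) (2^-1 * ((D^-1 * Ap_kernel x y) * (lam^-1 * h y)))%:E <= kap)%E.
    apply: (kernel_hoelder mq qP mQ _ _ _ _ Hh).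
    - by apply: measurable_funM (measurable_Ap_kernel x); exact: measurable_cst.
    - by apply: measurable_funM mh; exact: measurable_cst.
    - move=> y; rewrite mulr_ge0 ?enorm_ge0 ?invr_ge0 ?(ltW D0)//= ler_pdivrMl//.
      by apply: (le_trans (enorm_crinv_le _ _)); rewrite ler_wpM2r ?opnorm_ge0// lerDl.
    - by move=> y; rewrite mulr_ge0// invr_ge0 ltW.
  apply: le_trans Hk.
  have -> : (\int[Leb]_(y in cube a l) (2^-1 * ((D^-1 * Ap_kernel x y) * (lam^-1 * h y)))%:E =
      \int[Leb]_(y in cube a l) ((2 * D * lam)^-1 * (Ap_kernel x y * h y))%:E)%E.
    by apply: eq_integral => y _; congr EFin; field; rewrite !gt_eqF.
  have Dl0 : 0 <= (2 * D * lam)^-1 by rewrite invr_ge0 !mulr_ge0 ?(ltW D0) ?(ltW lam0).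
  rewrite (integral_EFinZl _ mQ Dl0 (measurable_funM (measurable_Ap_kernel x) mh)); last first.
    by move=> y; rewrite mulr_ge0// enorm_ge0.
  have -> : (2 * c * D * lam)^-1 = (2 * D * lam)^-1 * c^-1 by field; rewrite !gt_eqF.
  rewrite -mulrA EFinM lee_wpmul2l ?lee_fin ?invr_ge0 ?mulr_ge0 ?(ltW D0) ?(ltW lam0)//.
  apply: (@le_trans _ _ (c^-1%:E * (c%:E * \int[Leb]_(y in cube a l) (Ap_kernel x y * h y)%:E))%E).
    by rewrite EFinM lee_wpmul2l ?Hg// lee_fin invr_ge0 ltW.
  by rewrite muleA -EFinM mulVf ?mul1e// gt_eqF.
have [q1 _] := andP (qP x).
rewrite -poweR_EFin; apply: le_poweR.
- by rewrite (le_trans _ q1).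
- by rewrite lee_fin mulr_ge0// invr_ge0 mulr_ge0 ?ltW.
apply: (@le_trans _ _ ((mu^-1)%:E * ((2 * c * D * lam)^-1 * g x)%:E)%E); last first.
  by rewrite lee_wpmul2l// lee_fin invr_ge0 ltW.
rewrite -EFinM lee_fin [leRHS]mulrA; apply: ler_wpM2r => //.
rewrite (invfM (2 * c * D * lam)) mulrC; apply: ler_wpM2r; first by rewrite invr_ge0 ltW.
by rewrite lef_pV2 ?posrE// ltW.
Qed.

End Ap_averaging.

Section powers.
Context {R : realType}.

(* The logarithmic modulus of continuity makes [rho `^ delta] bounded below. *)
Lemma powR_log_bound (rho e s C0 : R) (N : nat) : 0 < e < 1 -> 0 <= C0 ->
  e ^+ N <= rho <= 1 -> 1 <= s ->
  rho `^ (- (2 * (2 * C0 / - ln e)) / s) <= expR (4 * N%:R * C0).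
Proof.
move=> /andP[e0 e1] C00 /andP[eN r1] s1.
have le0 : 0 < - ln e by rewrite oppr_gt0 ln_lt0// e0.
have r0 : 0 < rho by apply: lt_le_trans eN; rewrite exprn_gt0.
rewrite /powR gt_eqF// ler_expR.
(* The lower bound e^N for rho makes log (1 / rho) at most N log (1 / e), which cancels the
   logarithm in the oscillation of the exponent. *)
have lr : - ln rho <= N%:R * - ln e.
  rewrite mulrN lerN2 mulr_natl -lnXn// ler_ln// posrE// exprn_gt0//.
have lr0 : 0 <= - ln rho by rewrite oppr_ge0 ln_le0.
have -> : - (2 * (2 * C0 / - ln e)) / s * ln rho =
    (4 * C0) * ((- ln rho) / (- ln e)) * s^-1 by field; lra.
have d0 : 0 <= (- ln rho) / (- ln e) by rewrite divr_ge0// ltW.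
have dN : (- ln rho) / (- ln e) <= N%:R by rewrite ler_pdivrMr.
have C4 : 0 <= 4 * C0 by lra.
apply: (@le_trans _ _ (4 * C0 * ((- ln rho) / (- ln e)))).
  by apply: ler_piMr; [exact: mulr_ge0|rewrite invf_le1; lra].
by rewrite [leRHS]mulrAC; apply: ler_wpM2l.
Qed.

End powers.

(** * Mollification in the weighted space *)

Section power_trick.
Context d (T : measurableType d) (R : realType) (mu : {measure set T -> \bar R}).
Context (q : T -> R) (P : R).
Hypothesis mq : measurable_fun setT q.
Hypothesis qP : forall x, 1 <= q x <= P.

(* The normalised inequality for the modular, at level [rho `^ s^-1], implies an
   unnormalised one as soon as [q] has small oscillation. *)
Lemma denormalize (D D2 : set T) (g h : T -> R) (s dl rho K G : R) :
  measurable D -> measurable D2 -> measurable_fun setT g -> measurable_fun setT h ->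
  (forall x, 0 <= g x) -> (forall x, 0 <= h x) -> 0 < rho <= 1 -> 1 <= s -> 0 < G ->
  (forall x, D2 x -> q x <= s) -> (forall x, D x -> s - dl <= q x) ->
  rho `^ (- dl / s) <= K ->
  (\int[mu]_(x in D2) (h x `^ q x)%:E <= rho%:E)%E ->
  (forall l, 0 < l -> (\int[mu]_(x in D2) ((l^-1 * h x) `^ q x)%:E <= 1)%E ->
    (\int[mu]_(x in D) (((G * l)^-1 * g x) `^ q x)%:E <= 1)%E) ->
  (\int[mu]_(x in D) (g x `^ q x)%:E <= ((Num.max 1 G) `^ P * K * rho)%:E)%E.
Proof.
move=> mD mD2 mg mh g0 h0 /andP[r0 r1] s1 G0 qs sq HK Hh avg.
have s0 : 0 < s by lra.
have q0 x : 0 <= q x by have /andP[] := qP x; lra.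
(* With l^s = rho and l <= 1, any q <= s satisfies l^-q <= 1 / rho, so dividing h by l brings its
   modular down to 1. *)
have [l ldef] : exists l, l = rho `^ s^-1 by exists (rho `^ s^-1).
have l0 : 0 < l by rewrite ldef powR_gt0.
have l1 : l <= 1.
  rewrite ldef.
  have -> : 1 = 1 `^ s^-1 :> R by rewrite powR1.
  by rewrite ge0_ler_powR// ?nnegrE ?invr_ge0 ?ltW.
have ls : l `^ s = rho by rewrite ldef -powRrM mulVf ?gt_eqF// powRr1// ltW.
have lV b : l^-1 `^ b = l `^ (- b) by rewrite -powR_inv1 ?(ltW l0)// -powRrM mulN1r.
have lmono a b : a <= b -> l `^ b <= l `^ a.
  by move=> ab; apply: ger_powR => //; rewrite l0 l1.
have H1 : (\int[mu]_(x in D2) ((l^-1 * h x) `^ q x)%:E <= 1)%E.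
  apply: (@le_trans _ _ (rho^-1%:E * \int[mu]_(x in D2) (h x `^ q x)%:E)%E); last first.
    rewrite -[leRHS](_ : (rho^-1%:E * rho%:E)%E = _); last by rewrite -EFinM mulVf ?gt_eqF.
    by apply: lee_wpmul2l => //; rewrite lee_fin invr_ge0 ltW.
  rewrite -ge0_integralZl//; last 3 first.
  - by apply/measurable_EFinP; apply: measurable_funS (measurable_powR2 mh mq).
  - by move=> x _; rewrite lee_fin powR_ge0.
  - by rewrite lee_fin invr_ge0 ltW.
  apply: ge0_le_integral_lower => x Dx; first by rewrite lee_fin powR_ge0.
  rewrite -EFinM lee_fin powRM ?invr_ge0 ?(ltW l0)//; apply: ler_wpM2r; first exact: powR_ge0.
  by rewrite -ls -powRN lV; apply: lmono; rewrite lerN2 qs.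
have := avg _ l0 H1; set I := (\int[mu]_(x in D) _)%E => I1.
have M0 : 0 <= Num.max 1 G `^ P * K * rho.
  by rewrite !mulr_ge0 ?powR_ge0 ?(ltW r0)//; apply: le_trans HK; exact: powR_ge0.
apply: (@le_trans _ _ ((Num.max 1 G `^ P * K * rho)%:E * I)%E); last first.
  by rewrite -[leRHS]mule1; apply: lee_wpmul2l.
rewrite -ge0_integralZl//; last 2 first.
- apply/measurable_EFinP; apply: measurable_funS (measurable_powR2 _ mq) => //.
  by apply: measurable_funM mg; exact: measurable_cst.
- by move=> x _; rewrite lee_fin powR_ge0.
apply: ge0_le_integral_lower => x Dx; first by rewrite lee_fin powR_ge0.
rewrite -EFinM lee_fin.
have Gl0 : 0 < G * l by rewrite mulr_gt0.
have [q1 qP'] := andP (qP x).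
rewrite -[X in X `^ _ <= _](mulVKf (lt0r_neq0 Gl0)) powRM; last 2 first.
- by rewrite ltW.
- by rewrite mulr_ge0// invr_ge0 ltW.
apply: ler_wpM2r; first exact: powR_ge0.
rewrite powRM ?(ltW G0) ?(ltW l0)// -mulrA; apply: ler_pM; rewrite ?powR_ge0//.
  apply: (@le_trans _ _ (Num.max 1 G `^ q x)).
    by rewrite ge0_ler_powR// ?nnegrE ?le_max ?lexx ?orbT// ?ler01// (ltW G0).
  by rewrite ler_powR// le_max lexx.
(* Undoing the normalisation costs l^q <= l^(s - dl) = rho rho^(-dl / s), hence at most K rho. *)
apply: (le_trans (lmono _ _ (sq x Dx))).
rewrite powRD ?(gt_eqF l0) ?implybT// ls mulrC ler_wpM2r ?(ltW r0)//.
by rewrite ldef -powRrM mulrC.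
Qed.

End power_trick.

Section mollify_kernel.
Context {R : realType} {n m k : nat}.
Local Notation Leb := (lebesgueRn R n).
Implicit Types (F : 'rV[R]_n -> 'M[R]_(m, k)) (phi : 'rV[R]_n -> R).

Definition loc_integrable_mx {m k} (F : 'rV[R]_n -> 'M[R]_(m, k)) :=
  forall i j, loc_integrable (fun y => F y i j).

Definition mollify_mx {m k} (F : 'rV[R]_n -> 'M[R]_(m, k)) phi x : 'M[R]_(m, k) :=
  \matrix_(i, j) mollify (fun y => F y i j) phi x.

Lemma loc_integrable0 : loc_integrable (fun _ : 'rV[R]_n => 0 : R).
Proof.
apply: (@loc_integrable_bounded _ _ _ 1); first exact: measurable_cst.
by move=> x; rewrite normr0.
Qed.

Lemma loc_integrable_sum (I : Type) (s : seq I) (f : I -> 'rV[R]_n -> R) :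
  (forall i, loc_integrable (f i)) -> loc_integrable (fun x => \sum_(i <- s) f i x).
Proof.
move=> lf; elim: s => [|i s IH].
  have -> : (fun x => \sum_(i <- [::]) f i x) = (fun=> 0).
    by apply/funext => x; rewrite big_nil.
  exact: loc_integrable0.
have -> : (fun x => \sum_(j <- i :: s) f j x) = (fun x => f i x + \sum_(j <- s) f j x).
  by apply/funext => x; rewrite big_cons.
exact: loc_integrableD.
Qed.

Lemma mollify_sum (I : Type) (s : seq I) (f : I -> 'rV[R]_n -> R) phi x :
  (forall i, loc_integrable (f i)) -> Ccoo phi ->
  mollify (fun x => \sum_(i <- s) f i x) phi x = \sum_(i <- s) mollify (f i) phi x.
Proof.
move=> lf cphi; elim: s => [|i s IH].
  rewrite big_nil /mollify.
  under eq_Rintegral do rewrite big_nil mul0r.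
  by rewrite Rintegral_cst// mul0r.
have -> : (fun x => \sum_(j <- i :: s) f j x) = (fun x => f i x + \sum_(j <- s) f j x).
  by apply/funext => y; rewrite big_cons.
by rewrite big_cons (mollifyD x (lf i) (loc_integrable_sum s lf) cphi) IH.
Qed.

Lemma mulmx_mollify (A : 'M[R]_m) F phi x i j : loc_integrable_mx F -> Ccoo phi ->
  (A *m mollify_mx F phi x) i j = mollify (fun y => (A *m F y) i j) phi x.
Proof.
move=> lF cphi; rewrite mxE.
have -> : (fun y => (A *m F y) i j) = (fun y => \sum_a A i a * F y a j).
  by apply/funext => y; rewrite mxE.
rewrite (mollify_sum _ _ (fun a => loc_integrableZ (A i a) (lF a j)) cphi).
by apply: eq_bigr => a _; rewrite mxE -(mollifyZ _ _ (lF a j) cphi).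
Qed.

Lemma loc_integrable_mulmx (A : 'M[R]_m) F i j : loc_integrable_mx F ->
  loc_integrable (fun y => (A *m F y) i j).
Proof.
move=> lF; have -> : (fun y => (A *m F y) i j) = (fun y => \sum_a A i a * F y a j).
  by apply/funext => y; rewrite mxE.
by apply: loc_integrable_sum => a; exact: loc_integrableZ.
Qed.

Lemma loc_integrable_mx_measurable F : loc_integrable_mx F ->
  measurable_mx (F : Rn R n -> 'M[R]_(m, k)).
Proof. by move=> lF i j; exact: (lF i j).1. Qed.

Context (W : 'rV[R]_n -> 'M[R]_m).
Hypothesis mW : measurable_mx (W : Rn R n -> 'M[R]_m).
Hypothesis detW : {ae Leb, forall x, \det (W x) != 0}.

Lemma Ap_kernel_le (l : nat) x y (B : 'M[R]_(m, l)) : \det (W y) != 0 ->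
  enorm (W x *m B) <= Ap_kernel W x y * enorm (W y *m B).
Proof.
move=> Wy; rewrite -{1}(crinvK B Wy) (mulmxA (W x)).
exact: enorm_mulmx.
Qed.

(** For fixed x the matrix W(x) is constant and enters the mollification, whose entries are then
    bounded by the cell estimate. Inserting W(y)^-1 W(y), legitimate for almost every y, separates
    the kernel from |W F|. The factor m k comes from summing entries. *)
Lemma mollify_kernel F C e phi a M (c : {ffun 'I_n -> 'I_M}) x : 0 < e -> 0 <= C ->
  loc_integrable_mx F -> mollifier C e phi -> cell a e c x ->
  ((enorm (W x *m mollify_mx F phi x))%:E <= ((m * k)%:R * (C / e ^+ n))%:E *
    \int[Leb]_(y in cell2 a e c) (Ap_kernel W x y * enorm (W y *m F y))%:E)%E.
Proof.
move=> e0 C0 lF mphi xc; have [cphi _ _ _ _] := mphi.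
have mQ : measurable (cell2 a e c) by exact: measurable_cube.
have mF := loc_integrable_mx_measurable lF.
set J := (\int[Leb]_(y in _) _)%E.
have J0 : (0 <= J)%E by apply: integral_ge0 => y _; rewrite lee_fin mulr_ge0// enorm_ge0.
have Ce : 0 <= C / e ^+ n by rewrite divr_ge0// exprn_ge0// ltW.
have entry i j : (`|(W x *m mollify_mx F phi x) i j|%:E <= (C / e ^+ n)%:E * J)%E.
  have lH := loc_integrable_mulmx (W x) i j lF.
  rewrite (mulmx_mollify _ _ _ _ lF cphi).
  have := mollify_le_cell e0 lH mphi xc; rewrite -lee_fin => /le_trans; apply.
  rewrite EFinM; apply: lee_wpmul2l; first by rewrite lee_fin.
  rewrite fineK; last first.
    rewrite ge0_fin_numE; last by apply: integral_ge0 => y _; rewrite lee_fin.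
    by apply: loc_integrable_cube => //; rewrite mulr_ge0// ltW.
  have mh : measurable_fun [set: Rn R n] (fun y => enorm (W y *m F y)).
    by apply: measurable_enorm; exact: (measurable_mulmx mW mF).
  apply: (ae_le_integral_EFin (mu := Leb) mQ).
  - exact: (measurable_normf lH.1).
  - exact: (measurable_funM (measurable_Ap_kernel mW x) mh).
  - by move=> y; exact: normr_ge0.
  - by move=> y; rewrite mulr_ge0// enorm_ge0.
  apply: ae_imply detW => y Wy _.
  exact: le_trans (norm_entry_le _ _ _) (Ap_kernel_le _ _ Wy).
apply: (@le_trans _ _ (\sum_(i < m) \sum_(j < k) `|(W x *m mollify_mx F phi x) i j|)%:E).
  by rewrite lee_fin enorm_le_sum.
have -> : (((m * k)%:R * (C / e ^+ n))%:E * J = \sum_(i < m) \sum_(j < k) ((C / e ^+ n)%:E * J))%E.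
  rewrite !sumr_const !card_ord.
  rewrite EFinM -muleA -mulrnA mulnC.
  by rewrite -[RHS]mule_natl.
rewrite -sumEFin; apply: lee_sum => i _.
by rewrite -sumEFin; apply: lee_sum => j _.
Qed.

End mollify_kernel.

(** * The modular estimate for mollifications *)

Section main_estimate.
Context {R : realType} {n : nat}.
Local Notation Leb := (lebesgueRn R n).
Hypothesis n_gt0 : (0 < n)%N.
Context (q : 'rV[R]_n -> R) (P C0 : R).
Hypothesis mq : measurable_fun [set: Rn R n] q.
Hypothesis qP : forall x, 1 <= q x <= P.
Hypothesis C00 : 0 <= C0.
Hypothesis LH : forall x y : 'rV[R]_n, 0 < enorm (x - y) < 1 / 2 ->
  `|q x - q y| <= C0 / - ln (enorm (x - y)).

Lemma enorm_eq0 (x : 'rV[R]_n) : enorm x = 0 -> x = 0.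
Proof.
move=> x0; apply/matrixP => i j; rewrite mxE.
by apply/eqP; rewrite -normr_eq0 eq_le normr_ge0 andbT -x0 norm_entry_le.
Qed.

(** Points of the cube are at Euclidean distance at most 2 n e, which the smallness of e keeps below
    1 / 2. Coinciding points are set apart, as the modulus of continuity is only given for distinct
    ones. *)
Lemma cube_oscillation (a x y : 'rV[R]_n) e : 0 < e -> 16 * n%:R ^+ 2 * e <= 1 ->
  cube a (2 * e) x -> cube a (2 * e) y -> `|q x - q y| <= 2 * C0 / - ln e.
Proof.
move=> e0 en ax ay.
have n1 : 1 <= n%:R :> R by rewrite ler1n.
have n2 : 1 <= n%:R ^+ 2 :> R by rewrite exprn_ege1.
have e16 : e <= 1 / 16.
  by rewrite ler_pdivlMr// mulrC (le_trans _ en)// -mulrA ler_pM2l// ler_peMl// ltW.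
have le0 : 0 < - ln e by rewrite oppr_gt0 ln_lt0// e0; lra.
set dd := enorm (x - y).
have d0 : 0 <= dd by exact: enorm_ge0.
have [dz|dz] := eqVneq dd 0.
  have -> : x = y by apply/eqP; rewrite -subr_eq0 (enorm_eq0 dz).
  by rewrite subrr normr0 divr_ge0 ?mulr_ge0// ltW.
have dn : dd <= 2 * n%:R * e.
  apply: (le_trans (enorm_le_sum _)); rewrite big_ord1.
  apply: (@le_trans _ _ (\sum_(i < n) (2 * e))).
    apply: ler_sum => i _; have := ax i; have := ay i; rewrite !mxE => /andP[? ?] /andP[? ?].
    by rewrite ler_norml; apply/andP; split; lra.
  by rewrite sumr_const card_ord -[_ *+ _]mulr_natr mulrAC.
have ne : n%:R * e <= 1 / 16.
  rewrite ler_pdivlMr// mulrC (le_trans _ en)// -mulrA ler_pM2l// ler_pM2r//.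
  by rewrite expr2 ler_peMr//; lra.
have dpos : 0 < dd by rewrite lt0r dz.
have d2 : dd < 1 / 2 by apply: (le_lt_trans dn); rewrite -mulrA; lra.
(* Since (2 n e)^2 <= e, the logarithm of 1 / distance is at least half of log (1 / e); this is the
   factor 2 in the bound. *)
have ld : - ln e <= 2 * - ln dd.
  rewrite mulrN lerN2 mulr_natl -lnXn// ler_ln ?posrE ?exprn_gt0//.
  apply: (@le_trans _ _ ((2 * n%:R * e) ^+ 2)); first by rewrite lerXn2r// nnegrE ?mulr_ge0// ltW.
  have -> : (2 * n%:R * e) ^+ 2 = (16 * n%:R ^+ 2 * e) * (e / 4) by field.
  apply: (@le_trans _ _ (1 * (e / 4))); last by rewrite mul1r; lra.
  by rewrite ler_wpM2r//; lra.
have ld0 : 0 < - ln dd by lra.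
have xy : 0 < dd < 1 / 2 by rewrite dpos d2.
apply: (le_trans (LH xy)).
rewrite ler_pdivrMr// mulrAC ler_pdivlMr// -mulrA mulrCA.
by apply: ler_wpM2l.
Qed.

Context {m : nat} (W : 'rV[R]_n -> 'M[R]_m) (A : R).
Hypothesis mW : measurable_mx (W : Rn R n -> 'M[R]_m).
Hypothesis detW : {ae Leb, forall x, \det (W x) != 0}.
Hypothesis AP : Ap_bound q W A.

Section mollified.
Context {k : nat} (C : R).
Hypothesis C_gt0 : 0 < C.

(** In the maximum, 2 comes from Young's inequality, m k and C from the mollification, m m from the
    change of kernel, and A 2^n from the A_p condition on a cube of side 2 e; the powers of e
    cancel. The exponential is the price of the oscillation of q for rho >= e^(n+1). *)
Definition mollify_bound : R :=
  (Num.max 1 (2 * ((m * k)%:R + 1) * C * ((m * m)%:R + 1) * A * 2 ^+ n)) `^ P *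
    expR (4 * n.+1%:R * C0).

Lemma mollify_bound_ge0 : 0 <= mollify_bound.
Proof. by rewrite mulr_ge0 ?powR_ge0 ?expR_ge0. Qed.

Context (F : 'rV[R]_n -> 'M[R]_(m, k)).
Hypothesis lF : loc_integrable_mx F.

Let h (x : 'rV[R]_n) := enorm (W x *m F x).

Let h0 x : 0 <= h x. Proof. exact: enorm_ge0. Qed.

Lemma measurable_enorm_mul : measurable_fun [set: Rn R n] h.
Proof.
apply: measurable_enorm; apply: (measurable_mulmx mW).
exact: loc_integrable_mx_measurable.
Qed.

Lemma measurable_mollify_mx phi : Ccoo phi ->
  measurable_mx (mollify_mx F phi : Rn R n -> 'M[R]_(m, k)).
Proof.
move=> cphi i j.
have -> : (fun x => mollify_mx F phi x i j) = mollify (fun y => F y i j) phi.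
  by apply/funext => x; rewrite mxE.
exact: measurable_mollify (lF i j) cphi.
Qed.

Let mh := measurable_enorm_mul.

Hypothesis Fle1 : (\int[Leb]_x (h x `^ q x)%:E <= 1)%E.

Lemma mollify_cell e phi a M (c : {ffun 'I_n -> 'I_M}) : 0 < e ->
  16 * n%:R ^+ 2 * e <= 1 -> mollifier C e phi ->
  (\int[Leb]_(x in cell a e c) (enorm (W x *m mollify_mx F phi x) `^ q x)%:E <=
   \int[Leb]_(x in cell2 a e c) (mollify_bound * h x `^ q x)%:E +
   (mollify_bound * e ^+ n.+1)%:E)%E.
Proof.
move=> e0 en mphi; have [cphi _ _ _ _] := mphi.
have n2 : 1 <= n%:R ^+ 2 :> R by rewrite exprn_ege1// ler1n.
have e16 : e <= 1 / 16.
  by rewrite ler_pdivlMr// mulrC (le_trans _ en)// -mulrA ler_pM2l// ler_peMl// ltW.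
have mD : measurable (cell a e c) by exact: measurable_box.
have mD2 : measurable (cell2 a e c) by exact: measurable_cube.
have mhq : measurable_fun [set: Rn R n] (fun x => h x `^ q x) := measurable_powR2 mh mq.
have hq0 x : 0 <= h x `^ q x := powR_ge0 _ _.
set g := fun x => enorm (W x *m mollify_mx F phi x).
have mg : measurable_fun [set: Rn R n] g.
  apply: measurable_enorm; apply: (measurable_mulmx mW).
  exact: measurable_mollify_mx.
have g0 x : 0 <= g x := enorm_ge0 _.
set I := (\int[Leb]_(x in cell2 a e c) (h x `^ q x)%:E)%E.
have I0 : (0 <= I)%E by apply: integral_EFin_ge0 => x; exact: hq0.
have I1 : (I <= 1)%E.
  apply: le_trans Fle1; apply: (subset_integral_EFin Leb mD2 measurableT _ mhq) => [x //|x].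
  exact: hq0.
have fI : I \is a fin_num by rewrite ge0_fin_numE// (le_lt_trans I1)// ltry.
(* The floor keeps rho positive and its logarithm comparable to that of e. *)
pose rho := Num.max (fine I) (e ^+ n.+1).
have en0 : 0 < e ^+ n.+1 by rewrite exprn_gt0.
have e1 : e <= 1 by lra.
have en1 : e ^+ n.+1 <= 1 by rewrite exprn_ile1// ltW.
have rho01 : 0 < rho <= 1.
  rewrite lt_max en0 orbT/= ge_max en1 andbT.
  by move: I1; rewrite -{1}(fineK fI) lee_fin.
have rhoe : e ^+ n.+1 <= rho <= 1.
  by have /andP[_ ->] := rho01; rewrite le_max lexx orbT.
have Irho : (I <= rho%:E)%E by rewrite -(fineK fI) lee_fin le_max lexx.
set dlt := 2 * C0 / - ln e.
have dlt0 : 0 <= dlt.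
  by rewrite divr_ge0 ?mulr_ge0// oppr_ge0 ln_le0.
set x0 : 'rV[R]_n := \row_i (a + e * (c i : nat)%:R - e).
have x0in : cell2 a e c x0 by move=> i; apply/andP; split; lra.
have sub : cell a e c `<=` cell2 a e c.
  by move=> x xc i; have := xc i; rewrite !mxE => /andP[? ?]; apply/andP; split; lra.
have osc x : cell2 a e c x -> `|q x - q x0| <= dlt.
  by move=> xc; exact: (cube_oscillation e0 en xc x0in).
(* With this reference exponent, s - 2 dlt <= q <= s on the whole doubled cell. *)
pose s := q x0 + dlt.
have s1 : 1 <= s by have /andP[? _] := qP x0; rewrite /s; lra.
pose G := 2 * ((m * k)%:R + 1) * C * ((m * m)%:R + 1) * A * 2 ^+ n.
have [A0 _] := AP.
have c0 : 0 < ((m * k)%:R + 1) * (C / e ^+ n).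
  by rewrite mulr_gt0 ?divr_gt0 ?exprn_gt0// ltr_wpDl.
have Gpos : 0 < G by rewrite !mulr_gt0 ?exprn_gt0// ltr_wpDl.
have avg l : 0 < l -> (\int[Leb]_(x in cell2 a e c) ((l^-1 * h x) `^ q x)%:E <= 1)%E ->
    (\int[Leb]_(x in cell a e c) (((G * l)^-1 * g x) `^ q x)%:E <= 1)%E.
  move=> l0 Hl.
  have -> : G * l = 2 * (((m * k)%:R + 1) * (C / e ^+ n)) * ((m * m)%:R + 1) * l *
      (A * (2 * e) ^+ n).
    by rewrite exprMn /G; field; rewrite expf_neq0// lt0r_neq0.
  have e20 : 0 < 2 * e by rewrite mulr_gt0.
  apply: (Ap_averaging mq qP mW AP e20 c0 l0 mh h0 g0 sub Hl) => x xc.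
  apply: (le_trans (mollify_kernel mW detW e0 (ltW C_gt0) lF mphi xc)).
  apply: lee_wpmul2r.
    by apply: integral_EFin_ge0 => y; rewrite mulr_ge0// enorm_ge0.
  by rewrite lee_fin ler_wpM2r ?lerDl// divr_ge0 ?exprn_ge0 ?(ltW C_gt0) ?(ltW e0).
have HK : rho `^ (- (2 * dlt) / s) <= expR (4 * n.+1%:R * C0).
  by apply: powR_log_bound => //; rewrite e0; lra.
have qs x : cell2 a e c x -> q x <= s.
  by move=> /osc; rewrite ler_norml => /andP[_ ?]; rewrite /s; lra.
have sq x : cell a e c x -> s - 2 * dlt <= q x.
  by move=> /sub/osc; rewrite ler_norml => /andP[? _]; rewrite /s; lra.
apply: (le_trans (denormalize mq qP mD mD2 mg mh g0 h0 rho01 s1 Gpos qs sq HK Irho avg)).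
rewrite -/mollify_bound (integral_EFinZl _ mD2 mollify_bound_ge0 mhq hq0).
rewrite -/I -(fineK fI) -EFinM -EFinD lee_fin -mulrDr; apply: ler_wpM2l; first exact: mollify_bound_ge0.
rewrite ge_max; apply/andP; split; first by rewrite lerDl ltW.
by rewrite lerDr fine_ge0.
Qed.

Lemma mollify_estimate e phi r : 0 < e -> 16 * n%:R ^+ 2 * e <= 1 ->
  mollifier C e phi -> 0 <= r ->
  (\int[Leb]_(x in normball r) (enorm (W x *m mollify_mx F phi x) `^ q x)%:E <=
   ((3 ^ n)%:R * mollify_bound)%:E * \int[Leb]_x (h x `^ q x)%:E +
   (mollify_bound * ((2 * r + 3) ^+ n * e))%:E)%E.
Proof.
move=> e0 en mphi r0; have [cphi _ _ _ _] := mphi.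
have n2 : 1 <= n%:R ^+ 2 :> R by rewrite exprn_ege1// ler1n.
have e16 : e <= 1 / 16.
  by rewrite ler_pdivlMr// mulrC (le_trans _ en)// -mulrA ler_pM2l// ler_peMl// ltW.
have mhq : measurable_fun [set: Rn R n] (fun x => h x `^ q x) := measurable_powR2 mh mq.
have hq0 x : 0 <= h x `^ q x := powR_ge0 _ _.
have mgq : measurable_fun [set: Rn R n] (fun x => enorm (W x *m mollify_mx F phi x) `^ q x).
  apply: measurable_powR2 mq; apply: measurable_enorm; apply: (measurable_mulmx mW).
  exact: measurable_mollify_mx.
have mKh : measurable_fun [set: Rn R n] (fun x => mollify_bound * h x `^ q x).
  by apply: measurable_funM mhq; exact: measurable_cst.
have gq0 x : (0 <= (enorm (W x *m mollify_mx F phi x) `^ q x)%:E)%E by rewrite lee_fin powR_ge0.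
have Kh0 x : (0 <= (mollify_bound * h x `^ q x)%:E)%E by rewrite lee_fin mulr_ge0// mollify_bound_ge0.
set M := (Num.truncn (2 * (r + 1) / e)).+1.
apply: (le_trans (normball_grid_integral (c := mollify_bound * e ^+ n.+1) e0
  (measurable_EFinW mgq) (measurable_EFinW mKh) gq0 Kh0 (erefl M) _)).
  by move=> c; exact: mollify_cell.
rewrite (integral_EFinZl _ measurableT mollify_bound_ge0 mhq hq0).
set J := (\int[Leb]_x _)%E.
have -> : (((3 ^ n)%:R * mollify_bound)%:E * J = (3 ^ n)%:R%:E * (mollify_bound%:E * J))%E.
  by rewrite EFinM muleA.
apply: leeD; first exact: lexx.
rewrite lee_fin mulrCA; apply: ler_wpM2l; first exact: mollify_bound_ge0.
rewrite exprSr mulrA; apply: ler_wpM2r; first exact: ltW.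
(* With M cells per side, M e <= 2 (r + 1) + e <= 2 r + 3, so that M^n floors e^(n+1) add up to at
   most (2 r + 3)^n e. *)
rewrite natrX -exprMn; apply: lerXn2r; rewrite ?nnegrE ?mulr_ge0 ?(ltW e0)//; first by lra.
have : (Num.truncn (2 * (r + 1) / e))%:R <= 2 * (r + 1) / e.
  by rewrite truncn_le// divr_ge0 ?(ltW e0)//; lra.
rewrite ler_pdivlMr// /M -natr1 mulrDl mul1r => ?; lra.
Qed.

End mollified.
End main_estimate.

Section tails.
Context d (T : measurableType d) (R : realType) (mu : {measure set T -> \bar R}).

Lemma integral_EFin_gt0 (D : set T) (f : T -> R) : measurable D -> (0 < mu D)%E ->
  measurable_fun setT f -> (forall x, 0 < f x) -> (0 < \int[mu]_(x in D) (f x)%:E)%E.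
Proof.
move=> mD D0 mf f0; have I0 : (0 <= \int[mu]_(x in D) (f x)%:E)%E.
  by apply: integral_EFin_ge0 => x; exact: ltW.
rewrite lt_neqAle I0 andbT; apply/negP => /eqP/esym E.
have : (\int[mu]_(x in D) `|(f x)%:E| = 0)%E.
  by rewrite -[RHS]E; apply: eq_integral => x _; rewrite gee0_abs// lee_fin ltW.
move=> /(ae_eq_integral_abs _ mD (measurable_EFinW mf))[N [mN N0 DN]].
have : (mu D <= mu N)%E.
  apply: le_measure; rewrite ?inE// => x Dx; apply: DN => /= /(_ Dx) [fx].
  by have := f0 x; rewrite fx ltxx.
by rewrite leNgt N0 D0.
Qed.

Lemma tail_integral_small (f : T -> R) (S : nat -> set T) : measurable_fun setT f ->
  (forall x, 0 <= f x) -> (\int[mu]_x (f x)%:E < +oo)%E ->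
  (forall k, measurable (S k)) -> (forall x, \forall k \near \oo, ~ S k x) ->
  forall e : R, 0 < e -> \forall k \near \oo, (\int[mu]_(x in S k) (f x)%:E <= e%:E)%E.
Proof.
move=> mf f0 foo mS S0 e e0.
have mEf : measurable_fun [set: T] (fun x => (f x)%:E) := measurable_EFinW mf.
have cv : (\int[mu]_x ((fun x => (f x)%:E) \_ (S k)) x @[k --> \oo] -->
    \int[mu]_x cst 0 x)%E.
  apply: (@dominated_cvg _ _ _ mu _ measurableT (fun k => (fun x => (f x)%:E) \_ (S k))
    (cst 0%E) (fun x => (f x)%:E)).
  - move=> k; apply/(measurable_restrictT _ (mS k)); exact: measurable_EFinW.
  - move=> x _; apply: cvg_near_cst; have := S0 x; apply: filterS => k Sx.
    by rewrite patchE memNset.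
  - by [].
  - apply/integrableP; split => //.
    by under eq_integral do rewrite gee0_abs ?lee_fin//.
  - move=> k x _; rewrite patchE; case: ifP => _; first by rewrite gee0_abs ?lee_fin.
    by rewrite abse0 lee_fin.
rewrite integral0 in cv; have := cvge0_near_le cv e0; apply: filterS => k.
by rewrite -integral_mkcond.
Qed.

End tails.

(** * Local integrability of the weight *)

Section weight_local.
Context {R : realType} {n m : nat}.
Local Notation Leb := (lebesgueRn R n).
Context (q : 'rV[R]_n -> R) (P : R) (W : 'rV[R]_n -> 'M[R]_m) (A : R).
Hypothesis mq : measurable_fun [set: Rn R n] q.
Hypothesis qP : forall x, 1 <= q x <= P.
Hypothesis mW : measurable_mx (W : Rn R n -> 'M[R]_m).
Hypothesis detW : {ae Leb, forall x, \det (W x) != 0}.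
Hypothesis AP : Ap_bound q W A.

Lemma normball_sub_cube (r : R) :
  normball r `<=` cube (const_mx (- (`|r| + 1)) : 'rV[R]_n) (2 * (`|r| + 1)).
Proof.
move=> x xr i; have := le_trans (coord_le_norm x i) xr.
rewrite ler_norml !mxE => /andP[? ?].
by have := ler_norm r; have := ler_norm (- r); rewrite normrN => ? ?; apply/andP; split; lra.
Qed.

(* The averaging inequality is applied to [h = 1], with
   [|W x| \int_Q (1 + |W|)^-1 <= \int_Q |W x W^-1|]. *)
Lemma weight_loc_powR r :
  (\int[Leb]_(x in normball r) (enorm (W x) `^ q x)%:E < +oo)%E.
Proof.
set l := 2 * (`|r| + 1); set a : 'rV[R]_n := const_mx (- (`|r| + 1)).
have l0 : 0 < l by rewrite mulr_gt0// ltr_wpDl.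
set Q := cube a l; have mQ : measurable Q := measurable_cube a l.
have mW' : measurable_fun [set: Rn R n] (fun x => enorm (W x)) := measurable_enorm mW.
have mWq : measurable_fun [set: Rn R n] (fun x => enorm (W x) `^ q x) := measurable_powR2 mW' mq.
have /andP[v1 v2] := lebesgueRn_cube a l0.
have Q0 : (0 < Leb Q)%E by apply: lt_le_trans v1; rewrite lte_fin exprn_gt0.
have fQ : Leb Q \is a fin_num.
  by rewrite ge0_fin_numE ?ltW// (le_lt_trans v2)// ltry.
(* A bounded positive substitute for 1 / |W|, hence with a finite positive integral over the
   cube. *)
pose f (x : 'rV[R]_n) : R := (1 + enorm (W x))^-1.
have f0 x : 0 < f x by rewrite invr_gt0 ltr_pwDl// enorm_ge0.
have f1 x : f x <= 1 by rewrite invf_le1 ?lerDl ?enorm_ge0// ltr_pwDl// enorm_ge0.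
have mf : measurable_fun [set: Rn R n] f.
  by apply: measurable_inv; apply: measurable_funD mW'; exact: measurable_cst.
set t := (\int[Leb]_(x in Q) (f x)%:E)%E.
have t0 : (0 < t)%E := integral_EFin_gt0 mQ Q0 mf f0.
have t1 : (t <= Leb Q)%E.
  rewrite -[leRHS]mul1e -(integral_cst Leb mQ 1%E).
  by apply: (ge0_le_integral_lower Leb) => x _; rewrite lee_fin ?f1 ?ltW.
have ft : t \is a fin_num by rewrite ge0_fin_numE ?(ltW t0)// (le_lt_trans t1)// ltey_eq fQ.
have t0' : 0 < fine t by rewrite fine_gt0// t0/= ltey_eq ft.
(* As lam >= 1 and q >= 1, the modular of 1 / lam over Q is at most |Q| / lam <= 1. *)
pose lam := Num.max 1 (fine (Leb Q)).
have lam1 : 1 <= lam by rewrite le_max lexx.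
have lam0 : 0 < lam by lra.
have li1 : lam^-1 <= 1 by rewrite invf_le1.
have Hlam : (\int[Leb]_(y in Q) ((lam^-1 * (cst 1 : _ -> R) y) `^ q y)%:E <= 1)%E.
  apply: (@le_trans _ _ (lam^-1%:E * Leb Q)%E); last first.
    by rewrite -(fineK fQ) -EFinM lee_fin ler_pdivrMl// mulr1 le_max lexx orbT.
  rewrite -(integral_cst Leb mQ (lam^-1)%:E).
  apply: (ge0_le_integral_lower Leb) => y _; first by rewrite lee_fin powR_ge0.
  rewrite lee_fin mulr1 -[leRHS]powRr1 ?invr_ge0 ?(ltW lam0)//.
  by apply: ger_powR; [rewrite invr_gt0 lam0 li1|have /andP[] := qP y].
have ti0 : 0 < (fine t)^-1 by rewrite invr_gt0.
have W0 x : 0 <= enorm (W x) := enorm_ge0 _.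
have m1 : measurable_fun [set: Rn R n] (cst 1 : Rn R n -> R) by exact: measurable_cst.
have key x : Q x -> ((enorm (W x))%:E <= (fine t)^-1%:E *
    \int[Leb]_(y in Q) (Ap_kernel W x y * (cst 1 : _ -> R) y)%:E)%E.
  move=> Qx.
  have H : ((enorm (W x))%:E * t <= \int[Leb]_(y in Q) (Ap_kernel W x y * (cst 1 : _ -> R) y)%:E)%E.
    rewrite -(integral_EFinZl _ mQ (W0 x) mf (fun y => ltW (f0 y))).
    apply: (ae_le_integral_EFin mQ).
    - by apply: measurable_funM mf; exact: measurable_cst.
    - exact: (measurable_funM (measurable_Ap_kernel mW x) m1).
    - by move=> y; exact: (mulr_ge0 (W0 x) (ltW (f0 y))).
    - by move=> y; rewrite mulr1 enorm_ge0.
    apply: ae_imply detW => y Wy _; rewrite mulr1 ler_pdivrMr ?ltr_pwDl//.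
    have := Ap_kernel_le x 1%:M Wy; rewrite !mulmx1 => /le_trans; apply.
    by rewrite ler_wpM2l ?enorm_ge0// lerDr.
  apply: (@le_trans _ _ ((fine t)^-1%:E * ((enorm (W x))%:E * t))%E).
    rewrite -{2}(fineK ft) -!EFinM lee_fin mulrCA mulVf ?mulr1//.
    exact: lt0r_neq0.
  by apply: lee_wpmul2l => //; rewrite lee_fin ltW.
have := Ap_averaging mq qP mW AP l0 ti0 lam0 m1 (fun=> ler01) W0 (@subset_refl _ Q) Hlam key.
set G := (_ * (A * l ^+ n)) => HG.
have G0 : 0 < G.
  have [A0 _] := AP.
  by rewrite !mulr_gt0 ?exprn_gt0// ltr_wpDl.
apply: (@le_lt_trans _ _ (\int[Leb]_(x in Q) (enorm (W x) `^ q x)%:E)%E).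
  apply: (subset_integral_EFin Leb (measurable_normball r) mQ _ mWq) => [|x].
    exact: normball_sub_cube.
  exact: powR_ge0.
apply: (integral_powR_lty mq qP mQ mW' W0 G0).
exact: le_lt_trans HG (ltry 1).
Qed.

End weight_local.

Section integral_sums.
Context d (T : measurableType d) (R : realType) (mu : {measure set T -> \bar R}).

Lemma integral_enorm_le (D : set T) m k (u : T -> 'M[R]_(m, k)) (t : R) : measurable D ->
  measurable_mx u ->
  (forall i j, \int[mu]_(x in D) `|u x i j|%:E <= t%:E)%E ->
  (\int[mu]_(x in D) (enorm (u x))%:E <= ((m * k)%:R * t)%:E)%E.
Proof.
move=> mD mu' H.
have mn i j : measurable_fun [set: T] (fun x => `|u x i j|) := measurable_normf (mu' i j).
apply: (@le_trans _ _ (\int[mu]_(x in D) (\sum_(i < m) \sum_(j < k) `|u x i j|)%:E)%E).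
  by apply: le_integral_EFin => x _; [exact: enorm_ge0|exact: enorm_le_sum].
under eq_integral do rewrite -sumEFin.
rewrite ge0_integral_sum//; last 2 first.
- by move=> i; apply: measurable_EFinW; apply: measurable_sum.
- by move=> i x _; rewrite lee_fin sumr_ge0.
apply: (@le_trans _ _ (\sum_(i < m) \sum_(j < k) t%:E)%E); last first.
  by under eq_bigr do rewrite sumEFin; rewrite sumEFin !sumr_const !card_ord -mulrnA mulnC mulr_natl.
apply: lee_sum => i _; under eq_integral do rewrite -sumEFin.
rewrite ge0_integral_sum//; first exact: lee_sum.
by move=> j; exact: measurable_EFinW.
Qed.

Lemma measurable_gt_set (f : T -> R) (c : R) : measurable_fun setT f ->
  measurable [set x | c < f x].
Proof.
move=> mf; have -> : [set x | c < f x] = setT `&` f @^-1` `]c, +oo[%classic.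
  by apply/seteqP; split=> x /=; rewrite in_itv/= andbT// => -[].
exact: mf.
Qed.

Lemma integral_setT_supp (D : set T) (f : T -> R) : (forall x, 0 <= f x) ->
  (forall x, ~ D x -> f x = 0) ->
  (\int[mu]_x (f x)%:E = \int[mu]_(x in D) (f x)%:E)%E.
Proof.
move=> f0 fD; rewrite [RHS]integral_mkcond; apply: eq_integral => x _.
rewrite patchE; case: (boolP (x \in D)) => // xD.
by rewrite fD//; move=> Dx; rewrite mem_set in xD.
Qed.

End integral_sums.

Section mollify_density.
Context {R : realType} {n : nat}.
Local Notation Leb := (lebesgueRn R n).
Hypothesis n_gt0 : (0 < n)%N.
Context (q : 'rV[R]_n -> R) (P C0 : R).
Hypothesis mq : measurable_fun [set: Rn R n] q.
Hypothesis qP : forall x, 1 <= q x <= P.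
Hypothesis C00 : 0 <= C0.
Hypothesis LH : forall x y : 'rV[R]_n, 0 < enorm (x - y) < 1 / 2 ->
  `|q x - q y| <= C0 / - ln (enorm (x - y)).
Context {m k : nat} (W : 'rV[R]_n -> 'M[R]_m) (A : R).
Hypothesis mW : measurable_mx (W : Rn R n -> 'M[R]_m).
Hypothesis detW : {ae Leb, forall x, \det (W x) != 0}.
Hypothesis AP : Ap_bound q W A.
Context (C : R) (phi : nat -> 'rV[R]_n -> R).
Hypothesis C_gt0 : 0 < C.
Hypothesis phiP : forall l, mollifier C (l.+1%:R^-1) (phi l).

Lemma loc_integrable_le (f g : 'rV[R]_n -> R) : measurable_fun [set: Rn R n] f ->
  (forall x, `|f x| <= `|g x|) -> loc_integrable g -> loc_integrable f.
Proof.
move=> mf fg [mg lg]; split => // K cK; apply: le_lt_trans (lg _ cK).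
by apply: le_integral_EFin => x _; [exact: normr_ge0|exact: fg].
Qed.

Lemma mollify_normr_le (f : 'rV[R]_n -> R) (M : R) l x : 0 < M ->
  measurable_fun [set: Rn R n] f -> (forall y, `|f y| <= M) ->
  `|mollify f (phi l) x| <= M.
Proof.
move=> M0 mf fM; have [cphi _ _ _ _] := phiP l.
pose g y := M^-1 * f y.
have mg : measurable_fun [set: Rn R n] g.
  by apply: measurable_funM mf; exact: measurable_cst.
have g1 y : `|g y| <= 1.
  by rewrite normrM gtr0_norm ?invr_gt0// ler_pdivrMl// mulr1.
have fE : f = fun y => M * g y.
  by apply/funext => y; rewrite mulVKf// lt0r_neq0.
rewrite fE (mollifyZ M x (loc_integrable_bounded mg g1) cphi) normrM gtr0_norm//.
by rewrite ler_piMr ?(ltW M0)//; exact: (mollify_normr_le1 phiP).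
Qed.

Lemma mollify_cst0 (psi : 'rV[R]_n -> R) x : mollify (fun=> 0) psi x = 0.
Proof.
rewrite /mollify; under eq_Rintegral do rewrite mul0r.
by rewrite Rintegral_cst// mul0r.
Qed.

Lemma mollify_eq0 (f : 'rV[R]_n -> R) r l x : (forall y, r < `|y| -> f y = 0) ->
  r + 1 < `|x| -> mollify f (phi l) x = 0.
Proof.
move=> fr rx; rewrite -(mollify_cst0 (phi l) x); apply: eq_mollify => y.
move=> /(mollifier_norm_le (phiP l)) yx; apply: fr.
have : `|x| <= `|y - x| + `|y|.
  by rewrite -[X in `|X| <= _](subrK y) distrC; apply: ler_normD.
by lra.
Qed.

(** With F split at height M, the error is the mollification of the large part, plus the error of
    the bounded part, minus the large part. The modular estimate serves the first term, L^1
    convergence against the weight |W|^q the second, and smallness of a tail the third. *)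
Lemma mollify_density (F : 'rV[R]_n -> 'M[R]_(m, k)) r : 0 <= r ->
  loc_integrable_mx F -> (forall x, r < `|x| -> F x = 0) ->
  (\int[Leb]_x (enorm (W x *m F x) `^ q x)%:E < +oo)%E ->
  forall e : R, 0 < e -> \forall l \near \oo,
    (\int[Leb]_x (enorm (W x *m (mollify_mx F (phi l) x - F x)) `^ q x)%:E <= e%:E)%E.
Proof.
move=> r0 lF Fr Foo e e0.
have mF := loc_integrable_mx_measurable lF.
pose K := @mollify_bound R n P C0 m A k C.
have K0 : 0 <= K by exact: mollify_bound_ge0.
pose c3 : R := 3 `^ P.
have c30 : 0 < c3 by rewrite powR_gt0.
pose K1 := (3 ^ n)%:R * K; have K10 : 0 <= K1 by rewrite mulr_ge0.
(* The three terms will contribute (K1 + 1) t, t and t, multiplied by [c3] when the power of the sum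
   is expanded. The cap t <= 1 is what the modular estimate requires of the large part. *)
pose t := Num.min 1 (e / (c3 * (K1 + 3))).
have cK0 : 0 < c3 * (K1 + 3) by rewrite mulr_gt0//; lra.
have t0 : 0 < t by rewrite lt_min ltr01 divr_gt0.
have t1 : t <= 1 by rewrite ge_min lexx.
have te : c3 * (K1 + 3) * t <= e.
  by rewrite mulrC -ler_pdivlMr// ge_min lexx orbT.
pose S (M : nat) : set (Rn R n) := [set x | M%:R < enorm (F x)].
have meF : measurable_fun [set: Rn R n] (fun x => enorm (F x)) := measurable_enorm mF.
have mWF : measurable_mx (fun x : Rn R n => W x *m F x) := measurable_mulmx mW mF.
have mh : measurable_fun [set: Rn R n] (fun x => enorm (W x *m F x)) := measurable_enorm mWF.
have mhq : measurable_fun [set: Rn R n] (fun x => enorm (W x *m F x) `^ q x) := measurable_powR2 mh mq.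
have mS M : measurable (S M) := measurable_gt_set _ meF.
have hq0 x : 0 <= enorm (W x *m F x) `^ q x := powR_ge0 _ _.
have S0 x : \forall M \near \oo, ~ S M x.
  exists (Num.truncn (enorm (F x))).+1 => // M /= HM; apply/negP; rewrite -leNgt.
  by apply: ltW; apply: lt_le_trans (truncnS_gt _) _; rewrite ler_nat.
have [M _ /(_ M (leqnn M)) HM] := tail_integral_small mhq hq0 Foo mS S0 t0.
(* The height M is such that the modular of W F over the set where |F| > M is at most t; it is F
   that is cut, not W F, so that the bounded part is bounded independently of W. *)
pose big (x : 'rV[R]_n) := if M%:R < enorm (F x) then F x else 0.
pose tr (x : 'rV[R]_n) := if M%:R < enorm (F x) then 0 else F x.
have Fbt x : F x = big x + tr x by rewrite /big /tr; case: ifP; rewrite ?addr0 ?add0r.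
have mif : measurable_fun [set: Rn R n] (fun x => M%:R < enorm (F x)).
  by apply: measurable_fun_ltr => //; exact: measurable_cst.
have lbig : loc_integrable_mx big.
  move=> i j; apply: loc_integrable_le (lF i j).
    have -> : (fun y => big y i j) = (fun y => if M%:R < enorm (F y) then F y i j else 0).
      by apply/funext => y; rewrite /big; case: ifP => // _; rewrite mxE.
    by apply: measurable_fun_ifT.
  by move=> y; rewrite /big; case: ifP => // _; rewrite mxE normr0.
have mtr : measurable_mx (tr : Rn R n -> _).
  move=> i j.
  have -> : (fun y => tr y i j) = (fun y => if M%:R < enorm (F y) then 0 else F y i j).
    by apply/funext => y; rewrite /tr; case: ifP => // _; rewrite mxE.
  by apply: measurable_fun_ifT.
pose M1 : R := M%:R + 1; have M10 : 0 < M1 by rewrite ltr_wpDl.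
have trM i j y : `|tr y i j| <= M1.
  rewrite /tr; case: ltP => [_|FM]; first by rewrite mxE normr0 ltW.
  by apply: le_trans (norm_entry_le _ _ _) _; apply: (le_trans FM); rewrite lerDl.
have ltr i j : loc_integrable (fun y => tr y i j) := loc_integrable_bounded (mtr i j) (trM i j).
have Hbig : (\int[Leb]_x (enorm (W x *m big x) `^ q x)%:E <= t%:E)%E.
  apply: le_trans HM; rewrite [leRHS]integral_mkcond.
  apply: (ge0_le_integral_lower Leb) => x _; first by rewrite lee_fin powR_ge0.
  rewrite patchE /big; case: ifPn => Fx; first by rewrite mem_set.
  have [q1 _] := andP (qP x).
  rewrite mulmx0 enorm0 powR0; last by rewrite gt_eqF// (lt_le_trans ltr01).
  by case: ifP => // _; rewrite lee_fin hq0.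
have big1 : (\int[Leb]_x (enorm (W x *m big x) `^ q x)%:E <= 1)%E.
  by apply: (le_trans Hbig); rewrite lee_fin.
have mbig : measurable_mx (big : Rn R n -> _) := loc_integrable_mx_measurable lbig.
pose B := @normball R n (r + 1).
have mB : measurable B := measurable_normball (r + 1).
have Boo : (Leb B < +oo)%E := lebesgueRn_normball_lty (r + 1).
pose w (x : 'rV[R]_n) := enorm (W x) `^ q x.
have mw : measurable_fun [set: Rn R n] w := measurable_powR2 (measurable_enorm mW) mq.
have w0 x : 0 <= w x := powR_ge0 _ _.
have woo : (\int[Leb]_(x in B) (w x)%:E < +oo)%E := weight_loc_powR mq qP mW detW AP (r + 1).
(* A uniform bound for the error of the bounded part, whose entries are at most 2 M1; the summand 1
   ensures that it is at least 1. *)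
pose Mu : R := 1 + (m * k)%:R * (2 * M1).
have Mu1 : 1 <= Mu by rewrite lerDl mulr_ge0// mulr_ge0// ltW.
have [t' t'0 Ht'] := integral_pow_weight_small mB Boo mw w0 woo mq qP Mu1 t0.
pose t2 := t' / ((m * k)%:R + 1).
have t20 : 0 < t2 by rewrite divr_gt0// ltr_wpDl.
have cvg_tr : \forall l \near \oo, forall i j,
    (\int[Leb]_(x in B) `|mollify (fun y => tr y i j) (phi l) x - tr x i j|%:E <= t2%:E)%E.
  apply: filter_forall => i; apply: filter_forall => j.
  have [_ H] := loc_mollify_cvg (ltW C_gt0) phiP (ltr i j).
  exact: H.
pose K2 := K * (2 * (r + 1) + 3) ^+ n.
have K20 : 0 <= K2 by rewrite mulr_ge0// exprn_ge0//; lra.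
(* The first bound makes e small enough for the oscillation estimate, and the second makes the error
   term K2 e at most t. *)
pose d0 := Num.min (16 * n%:R ^+ 2)^-1 (t / (K2 + 1)).
have n2 : 0 < 16 * n%:R ^+ 2 :> R by rewrite mulr_gt0// exprn_gt0// ltr0n.
have d00 : 0 < d0 by rewrite lt_min invr_gt0 n2 divr_gt0// ltr_wpDl.
have cvg_e : \forall l \near \oo, (l.+1%:R^-1 : R) < d0 := near_infty_natSinv_lt (PosNum d00).
apply: filterS2 cvg_tr cvg_e => l Htr; set el := l.+1%:R^-1; move=> Hel.
have el0 : 0 < el by rewrite invr_gt0.
have [Hel1 Hel2] : el < (16 * n%:R ^+ 2)^-1 /\ el < t / (K2 + 1).
  by move: Hel; rewrite lt_min => /andP.
have [cphi _ _ _ _] := phiP l.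
have en : 16 * n%:R ^+ 2 * el <= 1.
  by rewrite -ler_pdivlMl// mulr1 ltW.
have r10 : 0 <= r + 1 by rewrite addr_ge0.
have := mollify_estimate n_gt0 mq qP C00 LH mW detW AP C_gt0 lbig big1 el0 en (phiP l) r10.
rewrite -/K => Hmain.
pose a (x : 'rV[R]_n) := enorm (W x *m mollify_mx big (phi l) x).
pose u (x : 'rV[R]_n) := enorm (mollify_mx tr (phi l) x - tr x).
pose c (x : 'rV[R]_n) := enorm (W x *m big x).
have a0 x : 0 <= a x := enorm_ge0 _.
have u0 x : 0 <= u x := enorm_ge0 _.
have c0 x : 0 <= c x := enorm_ge0 _.
have mmbig := measurable_mollify_mx lbig cphi.
have mmtr := measurable_mollify_mx ltr cphi.
have maq : measurable_fun [set: Rn R n] (fun x => a x `^ q x).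
  by apply: measurable_powR2 mq; apply: measurable_enorm; exact: measurable_mulmx.
have mcq : measurable_fun [set: Rn R n] (fun x => c x `^ q x).
  by apply: measurable_powR2 mq; apply: measurable_enorm; exact: measurable_mulmx.
have mut := measurable_mxB mmtr mtr.
have mu : measurable_fun [set: Rn R n] u := measurable_enorm mut.
have mwu : measurable_fun [set: Rn R n] (fun x => w x * u x `^ q x).
  exact: (measurable_funM mw (measurable_powR2 mu mq)).
have Ha : (\int[Leb]_(x in B) (a x `^ q x)%:E <= (K1 * t + t)%:E)%E.
  apply: (le_trans Hmain); rewrite EFinD; apply: leeD.
    by rewrite [leRHS]EFinM; apply: lee_wpmul2l; rewrite ?lee_fin.
  rewrite lee_fin mulrA -/K2.
  apply: (@le_trans _ _ ((K2 + 1) * el)); first by rewrite ler_wpM2r ?ltW// ltrDl.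
  by rewrite mulrC -ler_pdivlMr ?ltW// ltr_wpDl.
have Hc : (\int[Leb]_(x in B) (c x `^ q x)%:E <= t%:E)%E.
  apply: le_trans Hbig; apply: (subset_integral_EFin Leb mB measurableT _ mcq) => [x //|x].
  exact: powR_ge0.
have uM x : 0 <= u x <= Mu.
  rewrite u0/=; apply: (le_trans (enorm_le_sum _)).
  apply: (@le_trans _ _ (\sum_(i < m) \sum_(j < k) (2 * M1))).
    apply: ler_sum => i _; apply: ler_sum => j _; rewrite !mxE.
    apply: (le_trans (ler_normB _ _)); rewrite mulr_natl mulr2n; apply: lerD => //.
    exact: (mollify_normr_le _ _ M10 (mtr i j) (trM i j)).
  by rewrite !sumr_const !card_ord -mulrnA mulnC -[_ *+ (m * k)]mulr_natl /Mu lerDr.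
have Hu : (\int[Leb]_(x in B) (u x)%:E <= t'%:E)%E.
  apply: (le_trans (integral_enorm_le mB mut (t := t2) _)).
    move=> i j; apply: le_trans (Htr i j).
    by apply: le_integral_EFin => x _; rewrite ?normr_ge0// !mxE.
  by rewrite lee_fin /t2 mulr_div1D_le// ltW.
have Hwu := Ht' _ mu uM Hu.
have wuq0 x : 0 <= w x * u x `^ q x by rewrite mulr_ge0 ?powR_ge0.
have aq0 x : 0 <= a x `^ q x := powR_ge0 _ _.
have cq0 x : 0 <= c x `^ q x := powR_ge0 _ _.
rewrite (@integral_setT_supp _ _ _ Leb B); last 2 first.
- by move=> x; exact: powR_ge0.
- move=> x /negP; rewrite -ltNge => rx.
  have Fx : F x = 0 by apply: Fr; apply: lt_trans rx; rewrite ltrDl.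
  have -> : mollify_mx F (phi l) x = 0.
    apply/matrixP => i j; rewrite !mxE; apply: (mollify_eq0 _ _ rx) => y ry.
    by rewrite Fr// mxE.
  have [q1 _] := andP (qP x).
  by rewrite Fx subrr mulmx0 enorm0 powR0// gt_eqF// (lt_le_trans ltr01).
apply: (@le_trans _ _ (\int[Leb]_(x in B)
    (c3 * (a x `^ q x + w x * u x `^ q x + c x `^ q x))%:E)%E).
  apply: le_integral_EFin => x _; first exact: powR_ge0.
  have [q1 q2] := andP (qP x).
  have -> : mollify_mx F (phi l) x - F x =
      mollify_mx big (phi l) x + (mollify_mx tr (phi l) x - tr x) - big x.
    have -> : mollify_mx F (phi l) x = mollify_mx big (phi l) x + mollify_mx tr (phi l) x.
      apply/matrixP => i j; rewrite !mxE -(mollifyD x (lbig i j) (ltr i j) cphi).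
      by congr mollify; apply/funext => y; rewrite Fbt mxE.
    by rewrite Fbt [big x + _]addrC opprD !addrA.
  apply: (@le_trans _ _ ((a x + enorm (W x) * u x + c x) `^ q x)).
    rewrite ge0_ler_powR ?nnegrE ?addr_ge0 ?mulr_ge0 ?enorm_ge0//; first by lra.
    rewrite mulmxBr mulmxDr; apply: (le_trans (enormB _ _)); apply: lerD => //.
    apply: (le_trans (enormD _ _)); apply: lerD => //.
    exact: enorm_mulmx.
  apply: (le_trans (powR_add3 q1 q2 _ _ _)) => //; first by rewrite mulr_ge0// enorm_ge0.
  by rewrite /w (powRM _ (enorm_ge0 _) (u0 x)).
rewrite (integral_EFinZl _ mB (ltW c30)); last 2 first.
- exact: (measurable_funD (measurable_funD maq mwu) mcq).
- by move=> x; rewrite !addr_ge0.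
rewrite (integral_EFinD _ mB (measurable_funD maq mwu) mcq _ cq0); last first.
  by move=> x; exact: addr_ge0.
rewrite (integral_EFinD _ mB maq mwu aq0 wuq0).
apply: (@le_trans _ _ (c3%:E * (((K1 * t + t)%:E + t%:E) + t%:E))%E).
  by apply: lee_wpmul2l; [rewrite lee_fin ltW|rewrite !leeD].
rewrite -!EFinD -EFinM lee_fin; apply: le_trans te.
by rewrite le_eqVlt; apply/orP; left; apply/eqP; ring.
Qed.

End mollify_density.

(** * Density *)

Section cutoff.
Context {R : realType} {n : nat}.
Local Notation Leb := (lebesgueRn R n).
Implicit Types (f eta : 'rV[R]_n -> R).

Lemma mollify_le_Rintegral f (psi : 'rV[R]_n -> R) x : measurable_fun [set: Rn R n] f ->
  (forall y, `|f y| <= 1) -> Ccoo psi -> `|mollify f psi x| <= \int[Leb]_y `|psi y|.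
Proof.
move=> mf f1 cpsi; have lf := loc_integrable_bounded mf f1.
have cs := Ccoo_shift (- x) cpsi.
have mpsi := smooth_measurable cpsi.1.
apply: (le_trans (le_normr_Rintegral measurableT (loc_integrable_Ccoo lf cs))).
rewrite -(Rintegral_shift (- x) (measurable_normf mpsi)).
apply: le_Rintegral => //.
- exact: (integrable_norm (loc_integrable_Ccoo lf cs)).
- exact: (integrable_norm (integrable_Ccoo cs)).
- by move=> y _; rewrite normrM ler_piMl.
Qed.

Lemma mollify_cst1 (psi : 'rV[R]_n -> R) x : measurable_fun [set: Rn R n] psi ->
  mollify (fun=> 1) psi x = \int[Leb]_y psi y.
Proof.
move=> mpsi; rewrite -(Rintegral_shift (- x) mpsi).
by apply: eq_Rintegral => y _; rewrite mul1r.
Qed.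

(** The indicator of a large box is mollified at the fixed scale 1, so the derivatives are bounded
    by the L^1 norms of those of the kernel, independently of k. *)
Lemma cutoff_exists : exists2 K : R, 0 <= K & forall k : nat, exists eta : 'rV[R]_n -> R,
  [/\ Ccoo eta, forall x, `|1 - eta x| <= 2, forall x, `|x| <= k%:R -> eta x = 1,
    forall j x, `|x| <= k%:R -> partial j eta x = 0 & forall j x, `|partial j eta x| <= K].
Proof.
have [C [phi [C0 phiP]]] := @mollifier_seq R n.
pose psi := phi 0%N; have mpsi : mollifier C (1%:R^-1) psi := phiP 0%N.
have [cpsi _ _ psi1 _] := mpsi.
have Kj0 j : 0 <= \int[Leb]_y `|-1 * partial j psi y|.
  by apply: Rintegral_ge0 => y _.
exists (\sum_j \int[Leb]_y `|-1 * partial j psi y|); first exact: sumr_ge0.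
(* For |x| <= k the kernel reaches points of norm at most k + 1; half-side k + 2 keeps them off the
   open face of the box. *)
move=> k; pose a : 'rV[R]_n := const_mx (k%:R + 2).
pose f : 'rV[R]_n -> R := \1_(box (- a) a).
have mf : measurable_fun [set: Rn R n] f.
  by apply: measurable_indic; exact: measurable_box.
have f1 x : `|f x| <= 1.
  by rewrite /f indicE; case: (_ \in _); rewrite ?normr1 ?normr0.
have lf := loc_integrable_bounded mf f1.
have psis y : psi y != 0 -> `|y| <= 1.
  by move=> py; rewrite -(subr0 y); apply: (mollifier_norm_le mpsi); rewrite subr0.
have in_box x y : `|x| <= k%:R -> `|y - x| <= 1 -> f y = 1.
  move=> xk yx; rewrite /f indicE mem_set// => i; rewrite !mxE.
  have : `|y 0 i| <= k%:R + 1.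
    apply: le_trans (coord_le_norm y i) _; rewrite -(subrK x y).
    by apply: (le_trans (ler_normD _ _)); rewrite addrC lerD.
  by rewrite ler_norml => /andP[? ?]; apply/andP; split; lra.
have cd j : Ccoo (fun z => -1 * partial j psi z).
  by apply: CcooM; [exact: smooth_cst|exact: Ccoo_partial].
have dE j x : partial j (mollify f psi) x = mollify f (fun z => -1 * partial j psi z) x.
  by have [_ <-] := is_derive_mollify j x lf cpsi.
exists (mollify f psi); split.
- apply: (@Ccoo_ball _ _ _ (k%:R + 2 + 1)); first exact: smooth_mollify.
  move=> x; apply: mollify_supp => // y.
  rewrite /f indicE; case: (boolP (y \in _)) => [/set_mem yb _|_]; last by rewrite eqxx.
  apply: norm_le_coord => [|i]; first by rewrite addr_ge0.
  by have := yb i; rewrite !mxE ler_norml => /andP[? ?]; apply/andP; split; lra.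
- move=> x; apply: (le_trans (ler_normB _ _)); rewrite normr1.
  by have := mollify_normr_le1 phiP 0%N x mf f1; rewrite -/psi; lra.
- move=> x xk; rewrite -psi1 -(mollify_cst1 x (smooth_measurable cpsi.1)).
  by apply: eq_mollify => y /psis; exact: in_box.
(* Within distance k the indicator may be replaced by the constant 1, and the derivative of the
   kernel has integral 0. *)
- move=> j x xk; rewrite dE.
  rewrite (@eq_mollify _ _ f (fun=> 1)); last first.
    move=> y; rewrite mulN1r oppr_eq0 => /(partial_supp psis); exact: in_box.
  rewrite (mollify_cst1 x (smooth_measurable (cd j).1)).
  rewrite (RintegralZl _ measurableT (integrable_Ccoo (Ccoo_partial j cpsi))).
  by rewrite (Rintegral_partial j cpsi) mulr0.
- move=> j x; rewrite dE; apply: (le_trans (mollify_le_Rintegral x mf f1 (cd j))).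
  by rewrite (bigD1 j)//= lerDl sumr_ge0.
Qed.

Lemma loc_integrable_mulCcoo f (psi : 'rV[R]_n -> R) : loc_integrable f -> Ccoo psi ->
  loc_integrable (fun x => psi x * f x).
Proof.
move=> lf cpsi; have [M M0 psiM] := Ccoo_bounded cpsi.
apply: (@loc_integrable_le _ _ _ (fun x => M * f x)).
- exact: (measurable_funM (smooth_measurable cpsi.1) lf.1).
- by move=> x; rewrite !normrM (gtr0_norm M0) ler_wpM2r.
- exact: loc_integrableZ.
Qed.

End cutoff.

Section smooth_approx.
Context {R : realType} {n : nat}.
Local Notation Leb := (lebesgueRn R n).
Hypothesis n_gt0 : (0 < n)%N.
Context (q : 'rV[R]_n -> R) (P C0 : R).
Hypothesis mq : measurable_fun [set: Rn R n] q.
Hypothesis qP : forall x, 1 <= q x <= P.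
Hypothesis C00 : 0 <= C0.
Hypothesis LH : forall x y : 'rV[R]_n, 0 < enorm (x - y) < 1 / 2 ->
  `|q x - q y| <= C0 / - ln (enorm (x - y)).
Context {m : nat} (W : 'rV[R]_n -> 'M[R]_m) (A : R).
Hypothesis mW : measurable_mx (W : Rn R n -> 'M[R]_m).
Hypothesis detW : {ae Leb, forall x, \det (W x) != 0}.
Hypothesis AP : Ap_bound q W A.

(** With this matrix the product rule takes the form eta F_1 + F_0 (partial_mx eta) in both
    applications: a row of partial derivatives when F_0 is a column, a column when F_0 is a scalar
    matrix. *)
Definition partial_mx {k0 k1} (idx : 'I_k0 -> 'I_k1 -> 'I_n) (eta : 'rV[R]_n -> R) x :
  'M[R]_(k0, k1) := \matrix_(a, b) partial (idx a b) eta x.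

Lemma powR_int_add (f g : 'rV[R]_n -> R) : measurable_fun [set: Rn R n] f ->
  measurable_fun [set: Rn R n] g -> (forall x, 0 <= f x) -> (forall x, 0 <= g x) ->
  (\int[Leb]_x ((f x + g x) `^ q x)%:E <=
  (3 `^ P)%:E * (\int[Leb]_x (f x `^ q x)%:E + \int[Leb]_x (g x `^ q x)%:E))%E.
Proof.
move=> mf mg f0 g0.
have mfq : measurable_fun [set: Rn R n] (fun x => f x `^ q x) := measurable_powR2 mf mq.
have mgq : measurable_fun [set: Rn R n] (fun x => g x `^ q x) := measurable_powR2 mg mq.
rewrite -(integral_EFinD _ measurableT mfq mgq); last 2 first.
- by move=> x; exact: powR_ge0.
- by move=> x; exact: powR_ge0.
rewrite -(integral_EFinZl _ measurableT (powR_ge0 _ _) (measurable_funD mfq mgq)); last first.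
  by move=> x; rewrite addr_ge0// powR_ge0.
apply: le_integral_EFin => x _; first exact: powR_ge0.
by have /andP[? ?] := qP x; exact: powR_add2.
Qed.

(** The same cutoff and the same kernel serve F_0 and F_1, so that the approximations are again a
    function and its derivative. That F_1 is the derivative of F_0 enters only when the lemma is
    applied. *)
Lemma smooth_approx {k0 k1 : nat} (F0 : 'rV[R]_n -> 'M[R]_(m, k0))
    (F1 : 'rV[R]_n -> 'M[R]_(m, k1)) (idx : 'I_k0 -> 'I_k1 -> 'I_n) :
  loc_integrable_mx F0 -> loc_integrable_mx F1 ->
  (\int[Leb]_x (enorm (W x *m F0 x) `^ q x)%:E < +oo)%E ->
  (\int[Leb]_x (enorm (W x *m F1 x) `^ q x)%:E < +oo)%E ->
  forall t : R, 0 < t -> exists eta psi, [/\ Ccoo eta, Ccoo psi,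
    (\int[Leb]_x (enorm (W x *m
      (F0 x - mollify_mx (fun y => eta y *: F0 y) psi x)) `^ q x)%:E <= t%:E)%E &
    (\int[Leb]_x (enorm (W x *m
      (F1 x - mollify_mx (fun y => eta y *: F1 y + F0 y *m partial_mx idx eta y) psi x))
      `^ q x)%:E <= t%:E)%E].
Proof.
move=> lF0 lF1 F0oo F1oo t t0.
pose c3 : R := 3 `^ P; have c30 : 0 < c3 by rewrite powR_gt0.
pose t1 := t / (c3 * 2); have t10 : 0 < t1 by rewrite divr_gt0// mulr_gt0.
have [K K0 cut] := @cutoff_exists R n.
(* Here 2 bounds |1 - eta|, and k0 k1 K bounds the norm of the matrix of derivatives of eta,
   uniformly in the radius of the cutoff; both cutoff errors are then at most c (|W F_0| + |W
   F_1|). *)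
pose c : R := 2 + (k0 * k1)%:R * K.
have kK : 0 <= (k0 * k1)%:R * K by rewrite mulr_ge0.
have c1 : 1 <= c by rewrite /c; lra.
have c0 : 0 <= c by lra.
have mF0 := loc_integrable_mx_measurable lF0.
have mF1 := loc_integrable_mx_measurable lF1.
have meWF (l : nat) (F : Rn R n -> 'M[R]_(m, l)) : measurable_mx F ->
    measurable_fun [set: Rn R n] (fun x => enorm (W x *m F x)).
  by move=> mF; apply: measurable_enorm; exact: measurable_mulmx.
pose u (x : 'rV[R]_n) := enorm (W x *m F0 x) + enorm (W x *m F1 x).
have u0 x : 0 <= u x by rewrite addr_ge0// enorm_ge0.
have mu : measurable_fun [set: Rn R n] u := measurable_funD (meWF _ _ mF0) (meWF _ _ mF1).
have uoo : (\int[Leb]_x (u x `^ q x)%:E < +oo)%E.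
  apply: (le_lt_trans (powR_int_add (meWF _ _ mF0) (meWF _ _ mF1) _ _)) => [x|x|].
  - exact: enorm_ge0.
  - exact: enorm_ge0.
  - by apply: lte_mul_pinfty; [rewrite lee_fin powR_ge0|by []|exact: (lte_add_pinfty F0oo F1oo)].
have cuoo (b : R) : 1 <= b -> (\int[Leb]_x ((b * u x) `^ q x)%:E < +oo)%E.
  move=> b1; apply: (le_lt_trans (integral_powR_scale Leb measurableT mu mq u0 qP b1)).
  by rewrite lte_mul_pinfty ?lee_fin ?powR_ge0.
pose S (l : nat) : set (Rn R n) := ~` normball l%:R.
have mS l : measurable (S l) by apply: measurableC; exact: measurable_normball.
have S0 x : \forall l \near \oo, ~ S l x.
  exists (Num.truncn `|x|).+1 => // l /= Hl; apply; rewrite /normball /=.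
  by apply: ltW; apply: lt_le_trans (truncnS_gt _) _; rewrite ler_nat.
have mcu : measurable_fun [set: Rn R n] (fun x => (c * u x) `^ q x).
  by apply: measurable_powR2 mq; apply: measurable_funM mu; exact: measurable_cst.
have [k _ /(_ k (leqnn k)) Hk] :=
  tail_integral_small mcu (fun x => powR_ge0 _ _) (cuoo c c1) mS S0 t10.
have [eta [ceta eta2 eta1 deta0 detaK]] := cut k.
have [re _ etas] := Ccoo_supp ceta.
pose G0 (y : 'rV[R]_n) := eta y *: F0 y.
pose G1 (y : 'rV[R]_n) := eta y *: F1 y + F0 y *m partial_mx idx eta y.
have lZ (l : nat) (F : 'rV[R]_n -> 'M[R]_(m, l)) : loc_integrable_mx F ->
    loc_integrable_mx (fun y => eta y *: F y).
  move=> lF i j; have -> : (fun y => (eta y *: F y) i j) = (fun y => eta y * F y i j).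
    by apply/funext => y; rewrite mxE.
  exact: loc_integrable_mulCcoo.
have lG0 : loc_integrable_mx G0 := lZ _ _ lF0.
have lG1 : loc_integrable_mx G1.
  move=> i j.
  have -> : (fun y => G1 y i j) = (fun y => (eta y *: F1 y) i j +
      \sum_a partial (idx a j) eta y * F0 y i a).
    apply/funext => y; rewrite /G1 mxE [X in _ + X]mxE; congr (_ + _).
    by apply: eq_bigr => a _; rewrite mxE mulrC.
  apply: loc_integrableD; first exact: lZ.
  apply: loc_integrable_sum => a; apply: loc_integrable_mulCcoo => //.
  exact: Ccoo_partial.
have mG0 := loc_integrable_mx_measurable lG0.
have mG1 := loc_integrable_mx_measurable lG1.
have etaz x : re < `|x| -> eta x = 0.
  by move=> rx; apply/eqP; apply: contraTT rx => /etas; rewrite leNgt.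
have Dz x : re < `|x| -> partial_mx idx eta x = 0.
  move=> rx; apply/matrixP => a b; rewrite !mxE; apply/eqP.
  by apply: contraTT rx => /(partial_supp etas); rewrite leNgt.
pose r : R := Num.max 0 re; have r0 : 0 <= r by rewrite le_max lexx.
have rre x : r < `|x| -> re < `|x| by apply: le_lt_trans; rewrite le_max lexx orbT.
have G0z x : r < `|x| -> G0 x = 0 by move=> /rre rx; rewrite /G0 etaz// scale0r.
have G1z x : r < `|x| -> G1 x = 0.
  by move=> /rre rx; rewrite /G1 etaz// scale0r Dz// mulmx0 addr0.
have DK x : enorm (partial_mx idx eta x) <= (k0 * k1)%:R * K.
  apply: (le_trans (enorm_le_sum _)).
  apply: (@le_trans _ _ (\sum_(a < k0) \sum_(b < k1) K)).
    by apply: ler_sum => a _; apply: ler_sum => b _; rewrite mxE.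
  by rewrite !sumr_const !card_ord -mulrnA mulnC mulr_natl.
have D0 x : `|x| <= k%:R -> F0 x - G0 x = 0.
  by move=> xk; rewrite /G0 eta1// scale1r subrr.
have D1 x : `|x| <= k%:R -> F1 x - G1 x = 0.
  move=> xk; rewrite /G1 eta1// scale1r.
  have -> : partial_mx idx eta x = 0 by apply/matrixP => a b; rewrite !mxE deta0.
  by rewrite mulmx0 addr0 subrr.
have B0 x : enorm (W x *m (F0 x - G0 x)) <= c * u x.
  rewrite /G0 -[X in X - _]scale1r -scalerBl -scalemxAr enormZ.
  apply: ler_pM => //; first exact: enorm_ge0.
    by apply: (le_trans (eta2 x)); rewrite /c lerDl.
  by rewrite lerDl enorm_ge0.
have B1 x : enorm (W x *m (F1 x - G1 x)) <= c * u x.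
  rewrite /G1 opprD addrA -[X in X - _ - _]scale1r -scalerBl mulmxBr -scalemxAr mulmxA.
  apply: (le_trans (enormB _ _)).
  rewrite enormZ /u mulrDr addrC; apply: lerD.
    apply: (le_trans (enorm_mulmx _ _)); rewrite mulrC ler_wpM2r ?enorm_ge0//.
    by apply: (le_trans (DK x)); rewrite /c lerDr.
  rewrite ler_wpM2r ?enorm_ge0//; apply: (le_trans (eta2 x)).
  by rewrite /c lerDl.
have tail (l : nat) (F G : 'rV[R]_n -> 'M[R]_(m, l)) :
    (forall x, `|x| <= k%:R -> F x - G x = 0) ->
    (forall x, enorm (W x *m (F x - G x)) <= c * u x) ->
    (\int[Leb]_x (enorm (W x *m (F x - G x)) `^ q x)%:E <= t1%:E)%E.
  move=> FG0 FGu; rewrite (@integral_setT_supp _ _ _ Leb (S k)); last 2 first.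
  - by move=> x; exact: powR_ge0.
  - move=> x /contrapT xk; have [q1 _] := andP (qP x).
    by rewrite (FG0 x xk) mulmx0 enorm0 powR0// gt_eqF// (lt_le_trans ltr01).
  apply: le_trans Hk; apply: le_integral_EFin => x _; first exact: powR_ge0.
  have [q1 _] := andP (qP x).
  by rewrite ge0_ler_powR ?nnegrE ?enorm_ge0 ?mulr_ge0// (le_trans ler01).
(* Writing G = F - (F - G) bounds |W G| by (1 + c) u. *)
have G_oo (l : nat) (F G : 'rV[R]_n -> 'M[R]_(m, l)) :
    (forall x, enorm (W x *m F x) <= u x) ->
    (forall x, enorm (W x *m (F x - G x)) <= c * u x) ->
    (\int[Leb]_x (enorm (W x *m G x) `^ q x)%:E < +oo)%E.
  move=> Fu FGu; apply: le_lt_trans (cuoo (1 + c) _); last by rewrite lerDl.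
  apply: le_integral_EFin => x _; first exact: powR_ge0.
  have [q1 _] := andP (qP x).
  apply: ge0_ler_powR; rewrite ?nnegrE ?enorm_ge0 ?(le_trans ler01 q1)//.
    by rewrite mulr_ge0// addr_ge0.
  have -> : G x = F x - (F x - G x) by rewrite opprB addrC subrK.
  rewrite mulrDl mul1r mulmxBr.
  by apply: (le_trans (enormB _ _)); apply: lerD.
have [C [phi [C_ge0 phiP0]]] := @mollifier_seq R n.
(* The sequence comes with C >= 0, while the modular estimate asks for a positive constant. *)
have C_gt0 : 0 < C + 1 by lra.
have phiP l : mollifier (C + 1) (l.+1%:R^-1) (phi l).
  have [? ? ? ? H] := phiP0 l; split => // y; apply: (le_trans (H y)).
  by rewrite ler_wpM2r ?lerDl// invr_ge0 exprn_ge0.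
have G0oo := G_oo _ F0 G0 (fun x => ltac:(by rewrite lerDl enorm_ge0)) B0.
have G1oo := G_oo _ F1 G1 (fun x => ltac:(by rewrite lerDr enorm_ge0)) B1.
have N0 := mollify_density n_gt0 mq qP C00 LH mW detW AP C_gt0 phiP r0 lG0 G0z G0oo t10.
have N1 := mollify_density n_gt0 mq qP C00 LH mW detW AP C_gt0 phiP r0 lG1 G1z G1oo t10.
have [la _ Hla] := N0; have [lb _ Hlb] := N1.
pose l0 := maxn la lb.
have H0 := Hla l0 (leq_maxl _ _); have H1 := Hlb l0 (leq_maxr _ _).
have [cpsi _ _ _ _] := phiP l0.
have final (l : nat) (F G : 'rV[R]_n -> 'M[R]_(m, l)) : loc_integrable_mx F ->
    loc_integrable_mx G ->
    (\int[Leb]_x (enorm (W x *m (F x - G x)) `^ q x)%:E <= t1%:E)%E ->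
    (\int[Leb]_x (enorm (W x *m (mollify_mx G (phi l0) x - G x)) `^ q x)%:E <= t1%:E)%E ->
    (\int[Leb]_x (enorm (W x *m (F x - mollify_mx G (phi l0) x)) `^ q x)%:E <= t%:E)%E.
  move=> lF lG HF HG.
  have mF := loc_integrable_mx_measurable lF.
  have mG := loc_integrable_mx_measurable lG.
  have mmG := measurable_mollify_mx lG cpsi.
  apply: (@le_trans _ _ (\int[Leb]_x ((enorm (W x *m (F x - G x)) +
      enorm (W x *m (mollify_mx G (phi l0) x - G x))) `^ q x)%:E)%E).
    apply: le_integral_EFin => x _; first exact: powR_ge0.
    have [q1 _] := andP (qP x).
    rewrite ge0_ler_powR ?nnegrE ?enorm_ge0 ?addr_ge0 ?enorm_ge0 ?(le_trans ler01)//.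
    have -> : F x - mollify_mx G (phi l0) x =
        (F x - G x) - (mollify_mx G (phi l0) x - G x) by rewrite opprB addrA subrK.
    by rewrite mulmxBr; exact: enormB.
  apply: (le_trans (powR_int_add (meWF _ _ (measurable_mxB mF mG))
    (meWF _ _ (measurable_mxB mmG mG)) _ _)) => [x|x|].
  - exact: enorm_ge0.
  - exact: enorm_ge0.
  - apply: (@le_trans _ _ (c3%:E * (t1%:E + t1%:E))%E).
      apply: (lee_wpmul2l _ (leeD HF HG)); rewrite lee_fin; exact: powR_ge0.
    rewrite -EFinD -EFinM lee_fin /t1 le_eqVlt; apply/orP; left; apply/eqP.
    by field; rewrite lt0r_neq0.
exists eta, (phi l0); split; [exact: ceta|exact: cpsi| |].
- exact: (final _ F0 G0 lF0 lG0 (tail _ F0 G0 D0 B0) H0).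
- exact: (final _ F1 G1 lF1 lG1 (tail _ F1 G1 D1 B1) H1).
Qed.

End smooth_approx.

Section finite_bounds.
Context {R : realType}.

Lemma finite_uniform (I : finType) (Q : I -> R -> Prop) :
  (forall i, exists r, Q i r) -> (forall i r s, r <= s -> Q i r -> Q i s) ->
  exists r, forall i, Q i r.
Proof.
move=> HQ mono; have [r rQ] := choice HQ.
exists (\sum_i `|r i|) => i; apply: mono (rQ i).
by rewrite (bigD1 i)//= (le_trans (ler_norm _))// lerDl sumr_ge0.
Qed.

Lemma ae_forall_fin d (T : measurableType d) (mu : {measure set T -> \bar R})
    (I : finType) (Q : I -> T -> Prop) :
  (forall i, {ae mu, forall x, Q i x}) -> {ae mu, forall x, forall i, Q i x}.
Proof. by move=> H; apply: filter_forall. Qed.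

End finite_bounds.

(** * Matrices of weak derivatives *)

Section weak_matrices.
Context {R : realType} {n : nat}.
Local Notation Leb := (lebesgueRn R n).

(** [weak_partial] is a chosen representative; this identifies it almost everywhere with any
    explicit matrix of weak derivatives. *)
Lemma weak_partial_mx a b (idx : 'I_a -> 'I_b -> 'I_n)
    (f : 'I_a -> 'I_b -> 'rV[R]_n -> R) (G : 'rV[R]_n -> 'M[R]_(a, b)) :
  (forall i j, is_weak_partial (idx i j) (f i j) (fun x => G x i j)) ->
  let V x : 'M[R]_(a, b) := \matrix_(i, j) weak_partial (idx i j) (f i j) x in
  loc_integrable_mx V /\ {ae Leb, forall x, V x = G x}.
Proof.
move=> fG V; split.
  move=> i j; have -> : (fun y => V y i j) = weak_partial (idx i j) (f i j).
    by apply/funext => y; rewrite mxE.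
  exact: (weak_partialP (fG i j)).1.
have : {ae Leb, forall x, forall ij : 'I_a * 'I_b, V x ij.1 ij.2 = G x ij.1 ij.2}.
  apply: ae_forall_fin => -[i j]; apply: ae_imply (weak_partial_ae (fG i j)) => x.
  by rewrite mxE.
by apply: ae_imply => x H; apply/matrixP => i j; exact: (H (i, j)).
Qed.

Lemma Ccoo_mollify (f psi : 'rV[R]_n -> R) r : loc_integrable f ->
  (forall y, f y != 0 -> `|y| <= r) -> Ccoo psi -> Ccoo (mollify f psi).
Proof.
move=> lf fr cpsi; have [s _ psis] := Ccoo_supp cpsi.
apply: (@Ccoo_ball _ _ _ (r + s)); first exact: smooth_mollify.
by move=> x; exact: mollify_supp fr psis.
Qed.

Lemma Ccoo_mollifyM (v eta psi : 'rV[R]_n -> R) : loc_integrable v -> Ccoo eta ->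
  Ccoo psi -> Ccoo (mollify (fun y => eta y * v y) psi).
Proof.
move=> lv ceta cpsi; have [r _ etar] := Ccoo_supp ceta.
apply: (Ccoo_mollify (r := r) (loc_integrable_mulCcoo lv ceta) _ cpsi) => y.
by rewrite mulf_eq0 negb_or => /andP[/etar].
Qed.

(** Mollifying the weak derivative of eta v gives the classical derivative of the mollification of
    eta v, a test function. *)
Lemma weak_partial_mollifyM j (v g eta psi : 'rV[R]_n -> R) : loc_integrable v ->
  is_weak_partial j v g -> Ccoo eta -> Ccoo psi ->
  is_weak_partial j (mollify (fun y => eta y * v y) psi)
    (mollify (fun y => eta y * g y + partial j eta y * v y) psi).
Proof.
move=> lv vg ceta cpsi.
have -> : mollify (fun y => eta y * g y + partial j eta y * v y) psi =
    partial j (mollify (fun y => eta y * v y) psi).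
  apply/funext => x; apply/esym.
  exact: (partial_mollify x (loc_integrable_mulCcoo lv ceta) (weak_partialM lv vg ceta) cpsi).
by apply: Ccoo_weak_partial; exact: Ccoo_mollifyM.
Qed.

Lemma W11loc_Ccoo (w : 'rV[R]_n -> R) : Ccoo w -> W11loc w.
Proof.
move=> cw; split; first exact: Ccoo_loc_integrable.
by move=> j; exists (partial j w); exact: Ccoo_weak_partial.
Qed.

End weak_matrices.

(** * The two density statements *)

Section density.
Context {R : realType} {n : nat}.
Local Notation Leb := (lebesgueRn R n).
Hypothesis n_gt0 : (0 < n)%N.
Context (q : 'rV[R]_n -> R) (P C0 : R).
Hypothesis mq : measurable_fun [set: Rn R n] q.
Hypothesis qP : forall x, 1 <= q x <= P.
Hypothesis C00 : 0 <= C0.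
Hypothesis LH : forall x y : 'rV[R]_n, 0 < enorm (x - y) < 1 / 2 ->
  `|q x - q y| <= C0 / - ln (enorm (x - y)).
Context {m : nat} (W : 'rV[R]_n -> 'M[R]_m) (A : R).
Hypothesis mW : measurable_mx (W : Rn R n -> 'M[R]_m).
Hypothesis detW : {ae Leb, forall x, \det (W x) != 0}.
Hypothesis AP : Ap_bound q W A.

Lemma measurable_enorm_weight l (F : 'rV[R]_n -> 'M[R]_(m, l)) : loc_integrable_mx F ->
  measurable_fun [set: Rn R n] (fun x => enorm (W x *m F x)).
Proof.
move=> lF; apply: measurable_enorm; apply: (measurable_mulmx mW).
exact: loc_integrable_mx_measurable.
Qed.

Lemma modular_ae_le l (F G : 'rV[R]_n -> 'M[R]_(m, l)) : loc_integrable_mx F ->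
  loc_integrable_mx G -> {ae Leb, forall x, F x = G x} ->
  (\int[Leb]_x (enorm (W x *m F x) `^ q x)%:E <=
   \int[Leb]_x (enorm (W x *m G x) `^ q x)%:E)%E.
Proof.
move=> lF lG FG; apply: (ae_le_integral_EFin measurableT).
- exact: (measurable_powR2 (measurable_enorm_weight lF) mq).
- exact: (measurable_powR2 (measurable_enorm_weight lG) mq).
- by move=> x; exact: powR_ge0.
- by move=> x; exact: powR_ge0.
- by apply: ae_imply FG => x -> _.
Qed.

(** This puts test functions in the weighted space: they are bounded with bounded support, and |W|^q
    is locally integrable. *)
Lemma Ccoo_modular_lty l (F : 'rV[R]_n -> 'M[R]_(m, l)) :
  (forall i j, Ccoo (fun x => F x i j)) ->
  (\int[Leb]_x (enorm (W x *m F x) `^ q x)%:E < +oo)%E.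
Proof.
move=> cF.
have [r Hr] : exists r, forall ij : 'I_m * 'I_l, (forall x, `|F x ij.1 ij.2| <= r) /\
    (forall x, F x ij.1 ij.2 != 0 -> `|x| <= r).
  apply: finite_uniform => [[i j]|ij r s rs [H1 H2]]; last first.
    by split=> x; [exact: le_trans (H1 x) rs|move=> /H2/le_trans; apply].
  have [r _ rs] := Ccoo_supp (cF i j); have [M _ MF] := Ccoo_bounded (cF i j).
  exists (Num.max r M); split => x /=.
    by apply: (le_trans (MF x)); rewrite le_max lexx orbT.
  by move=> /rs/le_trans; apply; rewrite le_max lexx.
pose c : R := 1 + (m * l)%:R * `|r|.
have c1 : 1 <= c by rewrite lerDl mulr_ge0.
have mB := @measurable_normball R n r.
have mW' : measurable_fun [set: Rn R n] (fun x => enorm (W x)) := measurable_enorm mW.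
rewrite (@integral_setT_supp _ _ _ Leb (normball r)); last 2 first.
- by move=> x; exact: powR_ge0.
- move=> x xr; have [q1 _] := andP (qP x).
  have -> : F x = 0.
    apply/matrixP => i j; rewrite mxE; apply/eqP; apply: contra_notT xr.
    exact: (Hr (i, j)).2.
  by rewrite mulmx0 enorm0 powR0// gt_eqF// (lt_le_trans ltr01).
apply: (@le_lt_trans _ _ (\int[Leb]_(x in normball r) ((c * enorm (W x)) `^ q x)%:E)%E).
  apply: le_integral_EFin => x _; first exact: powR_ge0.
  have [q1 _] := andP (qP x).
  apply: ge0_ler_powR; rewrite ?nnegrE ?enorm_ge0 ?(le_trans ler01 q1)//.
    by rewrite mulr_ge0 ?enorm_ge0// (le_trans ler01).
  apply: (le_trans (enorm_mulmx _ _)); rewrite mulrC ler_wpM2r ?enorm_ge0//.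
  apply: (le_trans (enorm_le_sum _)).
  apply: (@le_trans _ _ (\sum_(i < m) \sum_(j < l) `|r|)).
    apply: ler_sum => i _; apply: ler_sum => j _.
    exact: le_trans ((Hr (i, j)).1 x) (ler_norm _).
  by rewrite !sumr_const !card_ord -mulrnA mulnC -[_ *+ (m * l)]mulr_natl /c lerDr.
apply: (le_lt_trans (integral_powR_scale Leb mB mW' mq (fun x => enorm_ge0 _) qP c1)).
apply: lte_mul_pinfty; [by rewrite lee_fin powR_ge0|by []|].
exact: (weight_loc_powR mq qP mW detW AP r).
Qed.

Lemma lpnorm_opnorm_lty l (F G : 'rV[R]_n -> 'M[R]_(m, l)) : loc_integrable_mx F ->
  loc_integrable_mx G -> {ae Leb, forall x, F x = G x} ->
  (\int[Leb]_x (enorm (W x *m G x) `^ q x)%:E < +oo)%E ->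
  (lpnorm (EFin \o q) (fun x => (opnorm (W x *m F x))%:E) < +oo)%E.
Proof.
move=> lF lG FG Goo.
apply: (lpnorm_lty mq qP (measurable_enorm_weight lF)) => [x|].
  by rewrite ger0_norm ?opnorm_ge0// opnorm_le_enorm.
exact: le_lt_trans (modular_ae_le lF lG FG) Goo.
Qed.

Lemma density_vec : dense_subset (sobolev_norm_vec (EFin \o q) W)
  (sobolev_vec (EFin \o q) W) Ccoo_vec.
Proof.
have mxP (f : 'rV[R]_n -> 'cV[R]_m) (G : 'rV[R]_n -> 'M[R]_(m, n)) :
    (forall i j, is_weak_partial j (fun y => f y i 0) (fun x => G x i j)) ->
    loc_integrable_mx (weak_jacobian f) /\ {ae Leb, forall x, weak_jacobian f x = G x}.
  exact: (weak_partial_mx (idx := fun _ j => j)).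
have col (f : 'rV[R]_n -> 'cV[R]_m) : (forall i, loc_integrable (fun y => f y i 0)) ->
    loc_integrable_mx f by move=> lf i j; rewrite (ord1 j); exact: lf.
split=> [w cw|u [Wu Nu] e e0].
  split; first by move=> i; exact: W11loc_Ccoo.
  pose G x : 'M[R]_(m, n) := \matrix_(i, j) partial j (fun y => w y i 0) x.
  have GE i j : (fun x => G x i j) = partial j (fun y => w y i 0).
    by apply/funext => x; rewrite mxE.
  have lG : loc_integrable_mx G.
    by move=> i j; rewrite GE; apply: Ccoo_loc_integrable; exact: Ccoo_partial.
  have [lV Vae] : loc_integrable_mx (weak_jacobian w) /\
      {ae Leb, forall x, weak_jacobian w x = G x}.
    by apply: mxP => i j; rewrite GE; exact: Ccoo_weak_partial.
  apply: lte_add_pinfty.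
    have lw := col w (fun i => Ccoo_loc_integrable (cw i)).
    apply: (lpnorm_lty mq qP (measurable_enorm_weight lw)) => [x|].
      by rewrite ger0_norm// enorm_ge0.
    by apply: Ccoo_modular_lty => i j; rewrite (ord1 j); exact: cw.
  apply: (lpnorm_opnorm_lty lV lG Vae); apply: Ccoo_modular_lty => i j.
  by rewrite GE; exact: Ccoo_partial.
have lu i : loc_integrable (fun y => u y i 0) := (Wu i).1.
have lF0 : loc_integrable_mx u := col u lu.
have wu i j : is_weak_partial j (fun y => u y i 0) (fun x => weak_jacobian u x i j).
  have -> : (fun x => weak_jacobian u x i j) = weak_partial j (fun y => u y i 0).
    by apply/funext => x; rewrite mxE.
  by have [g ug] := (Wu i).2 j; exact: weak_partialP ug.
have lF1 : loc_integrable_mx (weak_jacobian u) by move=> i j; exact: (wu i j).1.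
have N0 : (lpnorm (EFin \o q) (fun x => (enorm (W x *m u x))%:E) < +oo)%E.
  by apply: le_lt_trans Nu; rewrite leeDl//; exact: lpnorm_ge0.
have N1 : (lpnorm (EFin \o q) (fun x => (opnorm (W x *m weak_jacobian u x))%:E) < +oo)%E.
  by apply: le_lt_trans Nu; rewrite leeDr//; exact: lpnorm_ge0.
have F0oo : (\int[Leb]_x (enorm (W x *m u x) `^ q x)%:E < +oo)%E.
  apply: (lpnorm_lty_int mq qP (measurable_enorm_weight lF0) ler01 _ _ N0) => x.
    exact: enorm_ge0.
  by rewrite mul1r ger0_norm// enorm_ge0.
have F1oo : (\int[Leb]_x (enorm (W x *m weak_jacobian u x) `^ q x)%:E < +oo)%E.
  apply: (lpnorm_lty_int mq qP (measurable_enorm_weight lF1) (ler0n R (m * n)) _ _ N1) => x.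
    exact: enorm_ge0.
  by rewrite ger0_norm ?opnorm_ge0// enorm_le_opnorm.
(* The bounds on the two norms are not strict; two thirds of e leave the strict inequality that
   density asks for. *)
have e30 : 0 < e / 3 by rewrite divr_gt0.
have [t t0 Ht] := lpnorm_small mq qP e30.
(* The product rule for the Jacobian is eta Du + u (grad eta)^T, whence the row of partial
   derivatives. *)
have [eta [psi [ceta cpsi H0 H1]]] := smooth_approx n_gt0 mq qP C00 LH mW detW AP
  (fun _ j => j) lF0 lF1 F0oo F1oo t0.
pose w := mollify_mx (fun y => eta y *: u y) psi.
have wE i : (fun x => w x i 0) = mollify (fun y => eta y * u y i 0) psi.
  by apply/funext => x; rewrite mxE; congr mollify; apply/funext => y; rewrite mxE.
have cw : Ccoo_vec w by move=> i; rewrite wE; exact: Ccoo_mollifyM (lu i) ceta cpsi.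
have lw : loc_integrable_mx w := col w (fun i => Ccoo_loc_integrable (cw i)).
pose G1 (y : 'rV[R]_n) : 'M[R]_(m, n) := eta y *: weak_jacobian u y +
  u y *m partial_mx (fun (_ : 'I_1) j => j) eta y.
have G1E i j : (fun y => G1 y i j) =
    (fun y => eta y * weak_jacobian u y i j + partial j eta y * u y i 0).
  apply/funext => y; rewrite /G1 mxE [X in X + _]mxE [X in _ + X]mxE big_ord1.
  by congr (_ + _); rewrite mxE mulrC.
have ww i j : is_weak_partial j (fun y => w y i 0) (fun x => mollify_mx G1 psi x i j).
  have -> : (fun x => mollify_mx G1 psi x i j) = mollify (fun y => G1 y i j) psi.
    by apply/funext => x; rewrite mxE.
  by rewrite wE G1E; exact: weak_partial_mollifyM (lu i) (wu i j) ceta cpsi.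
have luw : loc_integrable_mx (fun x => u x - w x).
  move=> i j; have -> : (fun y => (u y - w y) i j) = (fun y => u y i j - w y i j).
    by apply/funext => y; rewrite !mxE.
  exact: loc_integrableB.
have lD : loc_integrable_mx (fun x => weak_jacobian u x - mollify_mx G1 psi x).
  move=> i j.
  have -> : (fun y => (weak_jacobian u y - mollify_mx G1 psi y) i j) =
      (fun y => weak_jacobian u y i j - mollify_mx G1 psi y i j).
    by apply/funext => y; rewrite !mxE.
  exact: loc_integrableB (lF1 i j) (ww i j).1.
have [lV Vae] : loc_integrable_mx (weak_jacobian (fun x => u x - w x)) /\
    {ae Leb, forall x, weak_jacobian (fun x => u x - w x) x =
      weak_jacobian u x - mollify_mx G1 psi x}.
  apply: mxP => i j.
  have -> : (fun y => (u y - w y) i 0) = (fun y => u y i 0 - w y i 0).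
    by apply/funext => y; rewrite !mxE.
  have -> : (fun y => (weak_jacobian u y - mollify_mx G1 psi y) i j) =
      (fun y => weak_jacobian u y i j - mollify_mx G1 psi y i j).
    by apply/funext => y; rewrite !mxE.
  exact: is_weak_partialB (lu i) (lw i 0) (wu i j) (ww i j).
exists w => //.
apply: (@le_lt_trans _ _ ((e / 3)%:E + (e / 3)%:E)%E); last by rewrite -EFinD lte_fin; lra.
apply: leeD.
  apply: (Ht _ _ (measurable_enorm_weight luw)) => [x|].
    by rewrite ger0_norm// enorm_ge0.
  exact: H0.
apply: (Ht _ _ (measurable_enorm_weight lV)) => [x|].
  by rewrite ger0_norm ?opnorm_ge0// opnorm_le_enorm.
exact: le_trans (modular_ae_le lV lD Vae) H1.
Qed.

End density.

Section density_scalar.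
Context {R : realType} {n : nat}.
Local Notation Leb := (lebesgueRn R n).
Hypothesis n_gt0 : (0 < n)%N.
Context (q : 'rV[R]_n -> R) (P C0 : R).
Hypothesis mq : measurable_fun [set: Rn R n] q.
Hypothesis qP : forall x, 1 <= q x <= P.
Hypothesis C00 : 0 <= C0.
Hypothesis LH : forall x y : 'rV[R]_n, 0 < enorm (x - y) < 1 / 2 ->
  `|q x - q y| <= C0 / - ln (enorm (x - y)).
Context (W : 'rV[R]_n -> 'M[R]_n) (A : R).
Hypothesis mW : measurable_mx (W : Rn R n -> 'M[R]_n).
Hypothesis detW : {ae Leb, forall x, \det (W x) != 0}.
Hypothesis AP : Ap_bound q W A.

(* The scalar [u] is treated as the matrix [u I], so that [|W (u I)|] is
   comparable to [|u| |W|]. *)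
Lemma loc_integrable_scalar_mx (u : 'rV[R]_n -> R) : loc_integrable u ->
  loc_integrable_mx (fun x => (u x)%:M : 'M[R]_n).
Proof.
move=> lu i j; have -> : (fun y => (u y)%:M i j) = (fun y => (i == j)%:R * u y).
  by apply/funext => y; rewrite mxE mulr_natl.
exact: loc_integrableZ.
Qed.

Lemma scalar_weight_le (u : 'rV[R]_n -> R) x :
  `|u x * opnorm (W x)| <= enorm (W x *m (u x)%:M).
Proof.
by rewrite enorm_mul_cst normrM (ger0_norm (opnorm_ge0 _)) ler_wpM2l// opnorm_le_enorm.
Qed.

Lemma density_scalar :
  dense_subset (sobolev_norm (EFin \o q) (fun x => opnorm (W x)) W)
    (sobolev (EFin \o q) (fun x => opnorm (W x)) W) Ccoo.
Proof.
have mxP (f : 'rV[R]_n -> R) (G : 'rV[R]_n -> 'cV[R]_n) :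
    (forall i, is_weak_partial i f (fun x => G x i 0)) ->
    loc_integrable_mx (weak_grad f) /\ {ae Leb, forall x, weak_grad f x = G x}.
  move=> H; apply: (weak_partial_mx (idx := fun i _ => i) (f := fun _ _ => f)) => i j.
  by rewrite (ord1 j).
split=> [w cw|u [[lu Wu] Nu] e e0].
  split; first exact: W11loc_Ccoo.
  pose G x : 'cV[R]_n := \col_i partial i w x.
  have GE i j : (fun x => G x i j) = partial i w by apply/funext => x; rewrite mxE.
  have lG : loc_integrable_mx G.
    by move=> i j; rewrite GE; apply: Ccoo_loc_integrable; exact: Ccoo_partial.
  have [lV Vae] : loc_integrable_mx (weak_grad w) /\
      {ae Leb, forall x, weak_grad w x = G x}.
    by apply: mxP => i; rewrite GE; exact: Ccoo_weak_partial.
  apply: lte_add_pinfty.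
    have lw := loc_integrable_scalar_mx (Ccoo_loc_integrable cw).
    apply: (lpnorm_lty mq qP (measurable_enorm_weight mW lw)) => [x|].
      exact: scalar_weight_le.
    apply: (Ccoo_modular_lty mq qP mW detW AP) => i j.
    have -> : (fun y => (w y)%:M i j) = (fun y => (i == j)%:R * w y).
      by apply/funext => y; rewrite mxE mulr_natl.
    by apply: CcooM cw; exact: smooth_cst.
  apply: (lpnorm_lty mq qP (measurable_enorm_weight mW lV)) => [x|].
    by rewrite ger0_norm// enorm_ge0.
  apply: (le_lt_trans (modular_ae_le mq mW lV lG Vae)).
  apply: (Ccoo_modular_lty mq qP mW detW AP) => i j.
  by rewrite GE; exact: Ccoo_partial.
have lF0 := loc_integrable_scalar_mx lu.
have wu i : is_weak_partial i u (fun x => weak_grad u x i 0).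
  have -> : (fun x => weak_grad u x i 0) = weak_partial i u.
    by apply/funext => x; rewrite mxE.
  by have [g ug] := Wu i; exact: weak_partialP ug.
have lF1 : loc_integrable_mx (weak_grad u).
  by move=> i j; rewrite (ord1 j); exact: (wu i).1.
have N0 : (lpnorm (EFin \o q) (fun x => (u x * opnorm (W x))%:E) < +oo)%E.
  by apply: le_lt_trans Nu; rewrite leeDl//; exact: lpnorm_ge0.
have N1 : (lpnorm (EFin \o q) (fun x => (enorm (W x *m weak_grad u x))%:E) < +oo)%E.
  by apply: le_lt_trans Nu; rewrite leeDr//; exact: lpnorm_ge0.
have F0oo : (\int[Leb]_x (enorm (W x *m (u x)%:M) `^ q x)%:E < +oo)%E.
  apply: (lpnorm_lty_int mq qP (measurable_enorm_weight mW lF0) (ler0n R (n * n)) _ _ N0) => x.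
    exact: enorm_ge0.
  rewrite enorm_mul_cst normrM (ger0_norm (opnorm_ge0 _)) mulrCA ler_wpM2l//.
  exact: enorm_le_opnorm.
have F1oo : (\int[Leb]_x (enorm (W x *m weak_grad u x) `^ q x)%:E < +oo)%E.
  apply: (lpnorm_lty_int mq qP (measurable_enorm_weight mW lF1) ler01 _ _ N1) => x.
    exact: enorm_ge0.
  by rewrite mul1r ger0_norm// enorm_ge0.
have e30 : 0 < e / 3 by rewrite divr_gt0.
have [t t0 Ht] := lpnorm_small mq qP e30.
(* The gradient of eta u is eta (grad u) + (u I) grad eta, whence the column of partial
   derivatives. *)
have [eta [psi [ceta cpsi H0 H1]]] := smooth_approx n_gt0 mq qP C00 LH mW detW AP
  (fun i _ => i) lF0 lF1 F0oo F1oo t0.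
pose w := mollify (fun y => eta y * u y) psi.
have cw : Ccoo w by exact: Ccoo_mollifyM lu ceta cpsi.
have lw := Ccoo_loc_integrable cw.
have wE x : mollify_mx (fun y => eta y *: (u y)%:M : 'M[R]_n) psi x = (w x)%:M.
  apply/matrixP => i j; rewrite !mxE.
  have -> : (fun y => (eta y *: (u y)%:M : 'M[R]_n) i j) =
      (fun y => (i == j)%:R * (eta y * u y)).
    by apply/funext => y; rewrite !mxE mulr_natl mulrnAr.
  by rewrite (mollifyZ _ _ (loc_integrable_mulCcoo lu ceta) cpsi) mulr_natl.
pose G1 (y : 'rV[R]_n) : 'cV[R]_n := eta y *: weak_grad u y +
  (u y)%:M *m partial_mx (fun i (_ : 'I_1) => i) eta y.
have G1E i : (fun y => G1 y i 0) =
    (fun y => eta y * weak_grad u y i 0 + partial i eta y * u y).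
  apply/funext => y; rewrite /G1 mul_scalar_mx mxE [X in X + _]mxE [X in _ + X]mxE.
  by congr (_ + _); rewrite mxE mulrC.
have ww i : is_weak_partial i w (fun x => mollify_mx G1 psi x i 0).
  have -> : (fun x => mollify_mx G1 psi x i 0) = mollify (fun y => G1 y i 0) psi.
    by apply/funext => x; rewrite mxE.
  by rewrite G1E; exact: weak_partial_mollifyM lu (wu i) ceta cpsi.
have luw := loc_integrable_scalar_mx (loc_integrableB lu lw).
have DE i : (fun y => (weak_grad u y - mollify_mx G1 psi y) i 0) =
      (fun y => weak_grad u y i 0 - mollify_mx G1 psi y i 0).
  by apply/funext => y; rewrite !mxE.
have lD : loc_integrable_mx (fun x => weak_grad u x - mollify_mx G1 psi x).
  move=> i j; rewrite (ord1 j) DE.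
  exact: loc_integrableB (wu i).1 (ww i).1.
have [lV Vae] : loc_integrable_mx (weak_grad (fun x => u x - w x)) /\
    {ae Leb, forall x, weak_grad (fun x => u x - w x) x =
      weak_grad u x - mollify_mx G1 psi x}.
  by apply: mxP => i; rewrite DE; exact: is_weak_partialB lu lw (wu i) (ww i).
exists w => //.
apply: (@le_lt_trans _ _ ((e / 3)%:E + (e / 3)%:E)%E); last by rewrite -EFinD lte_fin; lra.
apply: leeD.
  apply: (Ht _ _ (measurable_enorm_weight mW luw)) => [x|].
    exact: (scalar_weight_le (fun x => u x - w x)).
  apply: le_trans H0; apply: le_integral_EFin => x _; first exact: powR_ge0.
  by rewrite wE raddfB.
apply: (Ht _ _ (measurable_enorm_weight mW lV)) => [x|].
  by rewrite ger0_norm// enorm_ge0.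
exact: le_trans (modular_ae_le mq mW lV lD Vae) H1.
Qed.

End density_scalar.

Lemma Ap_factors {R : realType} {n m : nat} (q : 'rV[R]_n -> R) (W : 'rV[R]_n -> 'M[R]_m) :
  Ap (EFin \o q) W -> [/\ measurable_mx (W : Rn R n -> 'M[R]_m),
    {ae lebesgueRn R n, forall x, \det (W x) != 0} & exists A, Ap_bound q W A].
Proof.
move=> [[_ mW _] pdW /Ap_bound_exists AP]; split => //.
by apply: ae_imply pdW => x; exact: pdmx_det.
Qed.

Theorem corollary1p8 (R : realType) (n : nat) (n_gt0 : (0 < n)%N)
  (p : 'rV[R]_n -> \bar R) (hp : exponent p)
  (hp_ess : (1 <= ess_inf (lebesgueRn R n) p <= ess_sup (lebesgueRn R n) p)%E)
  (hp_fin : (ess_sup (lebesgueRn R n) p < +oo)%E)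
  (hLH : log_hoelder p) :
  (forall (d : nat) (W : 'rV[R]_n -> 'M[R]_d), (0 < d)%N -> Ap p W ->
     dense_subset (sobolev_norm_vec p W) (sobolev_vec p W) Ccoo_vec)
  /\
  (forall W : 'rV[R]_n -> 'M[R]_n, Ap p W ->
     let v := fun x => opnorm (W x) in
     dense_subset (sobolev_norm p v W) (sobolev p v W) Ccoo).
Proof.
have [q [P [C0 [pq mq qP C00 LH]]]] := log_hoelder_real hp hLH.
rewrite {}pq; split=> [d W _ /Ap_factors[mW detW [A AP]]|W /Ap_factors[mW detW [A AP]] v].
  exact: (density_vec n_gt0 mq qP C00 LH mW detW AP).
exact: (density_scalar n_gt0 mq qP C00 LH mW detW AP).
Qed.
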